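(* Let $n\ge2$, $1<\mathscr{P}\le n-1$, let $0\le l<k\le\binom{n-1}{\mathscr{P}-1}$ be integers and $p,q$ constants with $p>q-l$. Let $\varphi\in C^2(\mathbb{S}^n)$ be positive and let $u\in C^4(\mathbb{S}^n)$ be a positive admissible solution of $$\frac{\sigma_k(\Lambda(\nabla^2u+uI))}{\sigma_l(\Lambda(\nabla^2u+uI))}=u^{p-1}(u^2+|\nabla u|^2)^{\frac{k+1-q}{2}}\varphi\quad\text{on }\mathbb{S}^n.$$ Then there exists a positive constant $C$, depending only on $n,k,l,p,q$, $\min_{\mathbb{S}^n}\varphi$, $\|u\|_{C^1}$ and $\|\varphi\|_{C^2}$, such that $\max_{\mathbb{S}^n}|\nabla^2u|\le C$.
   Context: $\mathbb{S}^n$ is the unit sphere with its standard metric; $\nabla u$, $\nabla^2u$ are the gradient and covariant Hessian in a local orthonormal frame; $I$ is the identity. Put $N=\binom{n}{\mathscr{P}}$ and let $\mathbf{I}_1,\dots,\mathbf{I}_N$ enumerate the multi-indices $1\le i_1<\dots<i_{\mathscr{P}}\le n$. For a symmetric matrix $A$ with eigenvalues $\lambda$, $\Lambda(A)=(\Lambda_{\mathbf{I}_1},\dots,\Lambda_{\mathbf{I}_N})$ with $\Lambda_{\mathbf{I}}=\lambda_{i_1}+\dots+\lambda_{i_{\mathscr{P}}}$. $\sigma_m$ is the $m$-th elementary symmetric polynomial, $\sigma_0=1$; $\Gamma_k=\{\mu\in\mathbb{R}^N:\sigma_j(\mu)>0,\ 1\le j\le k\}$. A function $u\in C^2(\mathbb{S}^n)$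 is admissible if $\Lambda(\nabla^2u+uI)\in\Gamma_k$ at every point. *)

(* Defs.v *)
From HB Require Import structures.
From mathcomp Require Import all_boot all_order all_algebra.
From mathcomp Require Import all_classical all_reals all_analysis.
Set Implicit Arguments. Unset Strict Implicit. Unset Printing Implicit Defensive.
Import Order.TTheory GRing.Theory Num.Theory.
Import numFieldNormedType.Exports.
Local Open Scope classical_set_scope.
Local Open Scope ring_scope.

Section Defs.
Variable R : realType.

Definition enorm (d : nat) (x : 'rV[R]_d) : R := Num.sqrt (\sum_i x 0 i ^+ 2).
Definition sphere (n : nat) : set 'rV[R]_(n.+1) := [set x | enorm x = 1].
Definition punct (d : nat) : set 'rV[R]_d := ~` [set 0].

(* 0-homogeneous extension of a function given on S^n to R^{n+1} \ {0}. *)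
Definition ext (d : nat) (u : 'rV[R]_d -> R) : 'rV[R]_d -> R :=
  fun x => u ((enorm x)^-1 *: x).

Definition ev (d : nat) (i : 'I_d) : 'rV[R]_d := delta_mx 0 i.
Definition pd (d : nat) (i : 'I_d) (f : 'rV[R]_d -> R) : 'rV[R]_d -> R :=
  fun x => derive f x (ev i).

Fixpoint CkOn (d : nat) (k : nat) (U : set 'rV[R]_d) (f : 'rV[R]_d -> R) : Prop :=
  match k with
  | 0 => {within U, continuous f}
  | k'.+1 => {within U, continuous f} /\
             (forall (i : 'I_d) x, U x -> derivable f x (ev i)) /\
             (forall i : 'I_d, CkOn k' U (pd i f))
  end.

Definition Ck_sphere (n k : nat) (u : 'rV[R]_(n.+1) -> R) : Prop :=
  CkOn k (@punct n.+1) (ext u).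

Definition grad (d : nat) (u : 'rV[R]_d -> R) (x : 'rV[R]_d) : 'rV[R]_d :=
  \row_j pd j (ext u) x.
Definition hess (d : nat) (u : 'rV[R]_d -> R) (x : 'rV[R]_d) : 'M[R]_d :=
  \matrix_(i, j) pd i (pd j (ext u)) x.

(* E is a (row) orthonormal frame of the tangent space T_x S^n *)
Definition frame (n : nat) (x : 'rV[R]_(n.+1)) (E : 'M[R]_(n, n.+1)) : Prop :=
  E *m E^T = 1%:M /\ E *m x^T = 0.

Definition cov_hess (n : nat) (u : 'rV[R]_(n.+1) -> R) (x : 'rV[R]_(n.+1))
  (E : 'M[R]_(n, n.+1)) : 'M[R]_n := E *m hess u x *m E^T.

Definition grad_sq (d : nat) (u : 'rV[R]_d -> R) (x : 'rV[R]_d) : R :=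
  \sum_j (grad u x) 0 j ^+ 2.
Definition frob (m : nat) (A : 'M[R]_m) : R :=
  Num.sqrt (\sum_i \sum_j A i j ^+ 2).

Definition eigs (m : nat) (A : 'M[R]_m) (lam : 'I_m -> R) : Prop :=
  char_poly A = \prod_i ('X - (lam i)%:P).

Definition esym (T : finType) (D : {set T}) (mu : T -> R) (m : nat) : R :=
  \sum_(S : {set T} | (S \subset D) && (#|S| == m)) \prod_(t in S) mu t.

(* multi-indices 1 <= i_1 < ... < i_P <= n, as P-element subsets of 'I_n *)
Definition multi_idx (n P : nat) : {set {set 'I_n}} := [set I : {set 'I_n} | #|I| == P].

Definition Lam (n : nat) (lam : 'I_n -> R) : {set 'I_n} -> R :=
  fun I => \sum_(i in I) lam i.

Definition sigmaL (n P : nat) (lam : 'I_n -> R) (m : nat) : R :=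
  esym (multi_idx n P) (Lam lam) m.

Definition in_Gamma (n P k : nat) (lam : 'I_n -> R) : Prop :=
  forall j : nat, (1 <= j <= k)%N -> 0 < sigmaL P lam j.

Definition admissible (n P k : nat) (u : 'rV[R]_(n.+1) -> R) : Prop :=
  forall x E lam, sphere x -> frame x E ->
    eigs (cov_hess u x E + (u x)%:M) lam -> in_Gamma P k lam.

End Defs.

(* Main.v *)
From Pilot Require Import Defs.
From HB Require Import structures.
From mathcomp Require Import all_boot all_order all_algebra all_fingroup.
From mathcomp Require Import all_classical all_reals all_analysis.
From mathcomp Require Import ring lra.
Import Order.TTheory GRing.Theory Num.Theory.
Import numFieldNormedType.Exports.

(**
Write w for the 1-homogeneous extension of u. On the sphere the Hessian of w on
the tangent space is b = cov_hess u + u I, and |Dw|^2 = u^2 + |grad u|^2, so the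
equation becomes F(b) = (p-1) ln w + (k+1-q)/2 ln |Dw|^2 + ln phi with
F = ln (sigma_k / sigma_l) of the sums Lam, and all derivatives are Euclidean.

F is a sum of logarithms of the quotients sigma_j / sigma_(j-1), each of which
lies below a linear functional with nonnegative coefficients touching it at a
given point of the Garding cone; so F has supporting functionals G at every
eigenvalue vector. Testing G on vectors of the cone shows that all its
coefficients are comparable: this is where k <= 'C(n - 1, P - 1) enters, as each
index i lies in at least k of the multi-indices.

At a minimum of u the equation bounds u from below, because p > q - l. At a
maximum of w_ee + A/2 |Dw|^2 over points and unit directions e, the supporting
functional gives \sum_i G_i w_iia and a lower bound for \sum_i G_i w_iiee. The
term A \sum_i G_i w_ii^2, which is at least A c |G| |b|^2, dominates all the
others for A large, which bounds b from above at the maximum. Positivity of the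
trace of b then bounds b from below.
*)

Local Open Scope ring_scope.
(* the short name [esym] denotes ssrfun's symmetry of equality *)
Local Notation esigma := Pilot.Defs.esym.

(** * Elementary symmetric functions and the Garding cone *)

Section ElementarySymmetric.
Context {R : realType} {T : finType}.
Implicit Types (D S : {set T}) (mu nu : T -> R).

(** Neither F nor the eigenvalues are ever differentiated. A supporting functional at the
    eigenvalues of b(x) gives, along a tangent line x + s e_a, an inequality between two functions
    of s that agree at s = 0; comparing their 2-jets there yields the once differentiated equation
    as an equality and the twice differentiated one as an inequality. Two obstacles shape this. The
    functional acts on eigenvalues, while along the line only diagonal entries in a fixed frame are
    at hand: Schur's theorem and a rearrangement bridge the gap. And the line leaves the sphere:
    homogeneity brings it back at the price of weights sqrt(1 + s^2) and 1 + s^2, whose second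
    derivatives produce the harmless terms \sum_i G_i w_ii and 2 G_a w_aa. The third order terms
    coming from |Dw|^2 disappear in two ways: after summation against G by the differentiated
    equation, and in the direction e by the critical point condition. All derivatives being
    Euclidean, w_iiee = w_eeii holds without curvature corrections. Every constant is fixed before
    the solution is introduced, which is how the dependence of C is expressed. *)

Lemma esym0 D mu : esigma D mu 0 = 1.
Proof.
rewrite /esigma (big_pred1 finset.set0) ?big_set0 // => S.
by rewrite cards_eq0 /=; case: (S =P finset.set0) => [->|]; rewrite ?finset.sub0set ?andbF.
Qed.

Lemma eq_esym D mu nu m :
  (forall i, i \in D -> mu i = nu i) -> esigma D mu m = esigma D nu m.
Proof.
move=> e; apply: eq_bigr => S /andP[SD _]; apply: eq_bigr => i iS.
by apply: e; apply: (fintype.subsetP SD).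
Qed.

Lemma esym_recl D mu i m : i \in D ->
  esigma D mu m.+1 = mu i * esigma (D :\ i) mu m + esigma (D :\ i) mu m.+1.
Proof.
move=> iD; rewrite /esigma (bigID (fun S : {set T} => i \in S)) /=; congr (_ + _).
  rewrite (reindex_onto (fun S : {set T} => i |: S) (fun S => S :\ i)) /=; last first.
    by move=> S /andP[_ iS]; rewrite finset.setD1K.
  rewrite mulr_sumr; apply: eq_big => [S|S]; last first.
    move=> /andP[/andP[_ _] /eqP e]; rewrite big_setU1 //.
    by rewrite -e setD11.
  rewrite setU11 andbT finset.subUset finset.sub1set iD /=.
  apply/idP/idP.
    move=> /andP[/andP[SD c] /eqP e].
    have iS : i \notin S by rewrite -e setD11.
    rewrite -e; rewrite finset.setU1K //; move: c; rewrite cardsU1 iS eqSS => ->.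
    by rewrite andbT finset.subsetD1 SD iS.
  rewrite finset.subsetD1 => /andP[/andP[SD iS] /eqP c].
  by rewrite SD finset.setU1K // eqxx cardsU1 iS c eqxx.
apply: eq_bigl => S; rewrite finset.subsetD1.
by rewrite -!andbA; congr (_ && _); rewrite andbC.
Qed.

(** Double counting of the pairs of an index [i] and a set [S] containing it: each [S] of size
    [m.+1] is met [m.+1] times. *)
Lemma esym_euler D mu m :
  \sum_(i in D) mu i * esigma (D :\ i) mu m = m.+1%:R * esigma D mu m.+1.
Proof.
transitivity (\sum_(i in D) \sum_(S : {set T} | [&& S \subset D, #|S| == m.+1 & i \in S])
    \prod_(t in S) mu t).
  apply: eq_bigr => i iD; have := esym_recl D mu i m iD.
  rewrite {1}/esigma (bigID (fun S : {set T} => i \in S)) /=.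
  rewrite [X in _ + X = _](_ : _ = esigma (D :\ i) mu m.+1).
    by move=> /addIr <-; apply: eq_bigl => S; rewrite andbA.
  apply: eq_bigl => S; rewrite finset.subsetD1.
  by rewrite -!andbA; congr (_ && _); rewrite andbC.
rewrite (exchange_big_dep (fun S : {set T} => (S \subset D) && (#|S| == m.+1))) /=; last first.
  by move=> i S iD /and3P[-> ->].
rewrite /esigma mulr_sumr; apply: eq_bigr => S /andP[SD /eqP c].
rewrite SD c eqxx /= (eq_bigl (fun i => i \in S)); last first.
  by move=> i; rewrite andbC; case: (boolP (i \in S)) => //= iS; apply: (fintype.subsetP SD).
by rewrite big_const iter_addr_0 c mulr_natl.
Qed.

Lemma esym1 D mu : esigma D mu 1 = \sum_(i in D) mu i.
Proof.
have := esym_euler D mu 0; rewrite mulr1n mul1r => <-; apply: eq_bigr => i iD.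
by rewrite esym0 mulr1.
Qed.

Lemma esym_const D (c : R) m : esigma D (fun=> c) m = 'C(#|D|, m)%:R * c ^+ m.
Proof.
rewrite /esigma (eq_bigr (fun=> c ^+ m)).
  rewrite sumr_const mulr_natl; congr (_ *+ _).
  by rewrite -cards_draws cardsE; apply: eq_card => S.
by move=> S /andP[_ /eqP <-]; rewrite prodr_const.
Qed.

(** The cone is taken relative to an index set [D], because the inductions below delete indices one
    at a time. *)
Definition garding D mu k := forall j, (1 <= j <= k)%N -> 0 < esigma D mu j.

Lemma garding_ge0 D mu k j : garding D mu k -> (j <= k)%N -> 0 < esigma D mu j.
Proof. by move=> g; case: j => [|j] jk; [rewrite esym0|apply: g]. Qed.

Lemma garding_leq D mu k j : garding D mu k -> (j <= k)%N -> garding D mu j.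
Proof. by move=> g jk i /andP[i1 ij]; apply: g; rewrite i1 (leq_trans ij jk). Qed.

(* If sigma_k(mu | i) <= 0, lower the coordinate mu_i until sigma_k vanishes;
   this keeps sigma_{k+1} > 0, but on {sigma_k = 0} the Euler identity reads
   (k+1) sigma_{k+1} = - \sum_j mu_j^2 sigma_{k-1}(mu | j) <= 0. *)
Lemma garding_D1_weak D k : forall mu, garding D mu k -> 0 <= esigma D mu k.+1 ->
  forall i, i \in D ->
  [/\ (forall m, (m < k)%N -> 0 < esigma (D :\ i) mu m), 0 <= esigma (D :\ i) mu k
    & 0 < esigma D mu k.+1 -> 0 < esigma (D :\ i) mu k].
Proof.
elim: k => [|k IH] mu g s i iD; first by split; rewrite ?esym0 // ler01.
have gk : garding D mu k by apply: garding_leq g _.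
have sk : 0 < esigma D mu k.+1 by apply: g; rewrite leqnn.
have [P1 P2 /(_ sk) P3] := IH mu gk (ltW sk) i iD.
have pos m : (m < k.+1)%N -> 0 < esigma (D :\ i) mu m.
  by rewrite ltnS leq_eqVlt => /orP[/eqP -> //|/P1].
(* Both remaining claims are refuted by one contradiction. Either alternative makes sigma_{k+2}
   strictly positive after the coordinate [i] has been lowered to the zero of sigma_{k+1}. *)
have key : 0 <= - esigma (D :\ i) mu k.+1 ->
   0 < esigma D mu k.+2 \/ 0 < - esigma (D :\ i) mu k.+1 -> False.
  set a := - _ => a0 hs.
  pose x := a / esigma (D :\ i) mu k.
  have x0 : 0 <= x by rewrite divr_ge0 // ltW.
  pose mu' := [eta mu with i |-> x].
  have e m : esigma (D :\ i) mu' m = esigma (D :\ i) mu m.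
    by apply: eq_esym => j; rewrite !inE /mu' /= => /andP[/negPf -> _].
  have mu'i : mu' i = x by rewrite /mu' /= eqxx.
  have rec m : esigma D mu' m.+1 = x * esigma (D :\ i) mu m + esigma (D :\ i) mu m.+1.
    by rewrite (esym_recl D mu' i) // mu'i !e.
  have sk0 : esigma D mu' k.+1 = 0.
    by rewrite rec /x /a divfK ?gt_eqF ?addNr.
  have g' : garding D mu' k.
    case=> // m /andP[_ mk]; rewrite rec.
    apply: ltr_wpDl; last by apply: pos.
    by apply: mulr_ge0 => //; apply/ltW/pos; rewrite ltnS ltnW.
  have xle : x < mu i.
    rewrite /x ltr_pdivrMr //.
    have := sk; rewrite (esym_recl D mu i) // /a; lra.
  have pos2 : 0 < esigma D mu' k.+2.
    have xa : 0 <= (mu i - x) * a by rewrite mulr_ge0 // subr_ge0 ltW.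
    have xa1 : 0 < a -> 0 < (mu i - x) * a by move=> ?; rewrite mulr_gt0 // subr_gt0.
    have -> : esigma D mu' k.+2 = esigma D mu k.+2 + (mu i - x) * a.
      by rewrite rec (esym_recl D mu i k.+1 iD) /a; ring.
    by case: hs => [h|/xa1 h]; lra.
  have h0 : 0 <= esigma D mu' k.+1 by rewrite sk0.
  have E := esym_euler D mu' k.+1.
  suff : \sum_(i0 in D) mu' i0 * esigma (D :\ i0) mu' k.+1 <= 0.
    rewrite E leNgt => /negP; apply; by rewrite mulr_gt0 // ltr0n.
  apply: sumr_le0 => j jD.
  have [_ Q2 _] := IH mu' g' h0 j jD.
  have := esym_recl D mu' j k jD; rewrite sk0.
  have := mulr_ge0 (sqr_ge0 (mu' j)) Q2.
  by move=> h1 h2; have -> : esigma (D :\ j) mu' k.+1 = - (mu' j * esigma (D :\ j) mu' k);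
     [lra | rewrite mulrN mulrA -expr2; lra].
split => //.
  rewrite leNgt; apply/negP => h; apply: key; [lra|right; lra].
move=> h; rewrite ltNge; apply/negP => h1; apply: key; [lra|by left].
Qed.

(** Deleting an index costs exactly one order of the cone; this is what lets the quotients be
    treated by induction on the order. *)
Lemma garding_D1 D k mu i : garding D mu k.+1 -> i \in D -> garding (D :\ i) mu k.
Proof.
move=> g iD m /andP[m1 mk].
have gm : garding D mu m.+1 by apply: garding_leq g _.
have sm : 0 < esigma D mu m.+1 by apply: gm; rewrite leqnn.
have [_ _ ->//] := garding_D1_weak D m mu (garding_leq _ _ _ _ gm (leqnSn m)) (ltW sm) i iD.
Qed.

Definition esymq D mu k := esigma D mu k.+1 / esigma D mu k.

Lemma esymq_gt0 D mu k j : garding D mu k -> (j < k)%N -> 0 < esymq D mu j.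
Proof. by move=> g jk; rewrite divr_gt0 // (garding_ge0 _ _ k) // ltnW. Qed.

Lemma esymq_shift D mu k i : garding D mu k.+2 -> i \in D ->
  0 < mu i + esymq (D :\ i) mu k.
Proof.
move=> g iD; have g1 := garding_D1 _ _ _ _ g iD.
have p0 : 0 < esigma (D :\ i) mu k by apply: garding_ge0 g1 _.
rewrite (_ : _ + _ = esigma D mu k.+1 / esigma (D :\ i) mu k).
  by rewrite divr_gt0 // (garding_ge0 _ _ _ _ g).
by rewrite (esym_recl D mu i) // /esymq mulrDl mulfK // gt_eqF.
Qed.

(** Euler's identity divided by sigma_{k+1}. With x = mu_i and y the lower quotient of mu without i,
    each summand is x y / (x + y), which is concave on x + y > 0 and nondecreasing in y; concavity
    of the quotients thus propagates from order k to k+1. *)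
Lemma esymq_rec D mu k : garding D mu k.+2 ->
  k.+2%:R * esymq D mu k.+1 =
  \sum_(i in D) (mu i - mu i ^+ 2 / (mu i + esymq (D :\ i) mu k)).
Proof.
move=> g; rewrite /esymq mulrA -esym_euler mulr_suml; apply: eq_bigr => i iD.
have g1 := garding_D1 _ _ _ _ g iD.
have p0 : 0 < esigma (D :\ i) mu k by apply: garding_ge0 g1 _.
have p1 : 0 < esigma D mu k.+1 by apply: garding_ge0 g _.
move: p1; rewrite (esym_recl D mu i k) // => p1.
have := p0; have := p1; move: (mu i) (esigma _ _ _) (esigma _ _ _) => x y z h1 h2.
have hz : z != 0 by rewrite gt_eqF.
field; rewrite ?hz.
have -> : x * z + y != 0 by rewrite gt_eqF.
by [].
Qed.

(** Induction along [esymq_rec]. For x + y > 0 and any b, x y / (x + y) <= (1 - b)^2 x + b^2 y, with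
    equality at b = x / (x + y). Freezing b at its value for [mu], and bounding y by the functional
    of the previous order, leaves a linear functional with nonnegative coefficients. *)
Lemma esymq_support D k mu : garding D mu k.+1 ->
  exists L : T -> R, [/\ (forall i, 0 <= L i),
    \sum_(i in D) L i * mu i = esymq D mu k
  & forall nu, garding D nu k.+1 -> esymq D nu k <= \sum_(i in D) L i * nu i].
Proof.
elim: k D mu => [|k IH] D mu g.
  exists (fun=> 1); split=> [i|//|nu gn]; rewrite ?ler01 //.
    rewrite /esymq esym0 divr1 esym1; by apply: eq_bigr => i _; rewrite mul1r.
  rewrite /esymq esym0 divr1 esym1 ler_sum // => i _; by rewrite mul1r.
have step i : exists L : T -> R, i \in D -> [/\ (forall j, 0 <= L j),
    \sum_(j in D :\ i) L j * mu j = esymq (D :\ i) mu k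
  & forall nu, garding (D :\ i) nu k.+1 ->
       esymq (D :\ i) nu k <= \sum_(j in D :\ i) L j * nu j].
  have [iD|_] := boolP (i \in D); last by exists mu.
  by have [L HL] := IH _ _ (garding_D1 _ _ _ _ g iD); exists L.
have [Li HLi] := choice step.
(* The optimal b of the elementary inequality at [mu]; [L] collects the coefficient of each
   coordinate after the two sums are exchanged. *)
pose a i := mu i / (mu i + esymq (D :\ i) mu k).
pose L j := k.+2%:R^-1 * ((1 - a j) ^+ 2 + \sum_(i in D :\ j) a i ^+ 2 * Li i j).
have k0 : (0 : R) < k.+2%:R by rewrite ltr0n.
have LE nu : \sum_(j in D) L j * nu j = k.+2%:R^-1 *
   \sum_(i in D) ((1 - a i) ^+ 2 * nu i + a i ^+ 2 * \sum_(j in D :\ i) Li i j * nu j).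
  rewrite mulr_sumr (eq_bigr (fun j => k.+2%:R^-1 * ((1 - a j) ^+ 2 * nu j) +
    k.+2%:R^-1 * \sum_(i in D :\ j) a i ^+ 2 * Li i j * nu j)); last first.
    by move=> j _; rewrite /L -mulrA mulrDl mulrDr mulr_suml.
  under [RHS]eq_bigr do rewrite mulrDr.
  rewrite !big_split /=; congr (_ + _).
  rewrite -!mulr_sumr; congr (_ * _).
  under [RHS]eq_bigr do rewrite mulr_sumr.
  rewrite (exchange_big_dep (fun j => j \in D)) /=; last first.
    move=> i j iD; by rewrite !inE => /andP[_ ->].
  apply: eq_bigr => j jD; apply: eq_big => [i|i _]; last by rewrite mulrA.
  by rewrite !inE jD andbT eq_sym andbC.
exists L; split.
- move=> j; rewrite /L mulr_ge0 ?invr_ge0 ?ler0n // addr_ge0 ?sqr_ge0 //.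
  apply: sumr_ge0 => i; rewrite !inE => /andP[_ iD]; rewrite mulr_ge0 ?sqr_ge0 //.
  by have [h _ _] := HLi i iD.
- rewrite LE; apply: (mulfI (lt0r_neq0 k0)); rewrite mulVKf ?gt_eqF //.
  rewrite esymq_rec //; apply: eq_bigr => i iD.
  have [_ -> _] := HLi i iD.
  have := esymq_shift _ _ _ _ g iD; rewrite /a; move: (esymq _ _ _) (mu i) => y x h.
  have h1 : x + y != 0 by rewrite gt_eqF.
  by field.
move=> nu gn; rewrite LE -(ler_pM2l k0) mulVKf ?gt_eqF //.
rewrite esymq_rec //; apply: ler_sum => i iD.
have [_ _ /(_ nu (garding_D1 _ _ _ _ gn iD))] := HLi i iD.
move: (\sum_(j in D :\ i) _) => Z hZ.
have := esymq_shift _ _ _ _ gn iD; move: (esymq _ _ _) hZ => y hZ p0.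
apply: (@le_trans _ _ ((1 - a i) ^+ 2 * nu i + a i ^+ 2 * y)); last first.
  by rewrite lerD2l ler_wpM2l // sqr_ge0.
move: (a i) (nu i) p0 => b x p0.
(* The defect in the elementary inequality is a square divided by x + y. *)
have -> : (1 - b) ^+ 2 * x + b ^+ 2 * y = x - x ^+ 2 / (x + y) + (x - b * (x + y)) ^+ 2 / (x + y).
  by field; rewrite gt_eqF.
by rewrite lerDl divr_ge0 ?sqr_ge0 // ltW.
Qed.

(** The logarithm telescopes into [d] logarithms of consecutive quotients, and ln t <= t - 1 turns a
    supporting functional M of a quotient q into M / q(mu) for ln q. Each factor contributes 1 to
    the value at [mu], hence the total [d]. Nonnegativity on the cone is kept for comparing the
    coefficients later. *)
Lemma ln_esym_support D l d mu : garding D mu (l + d) ->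
  exists L : T -> R, [/\ (forall i, 0 <= L i),
    \sum_(i in D) L i * mu i = d%:R,
    (forall nu, garding D nu (l + d) -> 0 <= \sum_(i in D) L i * nu i)
  & forall nu, garding D nu (l + d) ->
      ln (esigma D nu (l + d) / esigma D nu l) <=
      ln (esigma D mu (l + d) / esigma D mu l) + \sum_(i in D) L i * nu i - d%:R].
Proof.
elim: d => [|d IH] g.
  exists (fun=> 0); split => //.
  - by rewrite big1 // => i _; rewrite mul0r.
  - by move=> nu _; rewrite big1 // => i _; rewrite mul0r.
  move=> nu; rewrite !addn0 => gn; rewrite addn0 in g.
  rewrite !mulfV ?gt_eqF ?(garding_ge0 _ _ _ _ g) ?(garding_ge0 _ _ _ _ gn) //.
  by rewrite big1 ?addr0 ?subr0 // => i _; rewrite mul0r.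
rewrite addnS in g *.
have g' : garding D mu (l + d) by apply: garding_leq g _.
have [L [L0 Lmu Lnu Lln]] := IH g'.
have [M [M0 Mmu Mnu]] := esymq_support D (l + d) mu g.
have q0 : 0 < esymq D mu (l + d) by apply: esymq_gt0 g _.
have ME nu : \sum_(i in D) (L i + M i / esymq D mu (l + d)) * nu i =
   \sum_(i in D) L i * nu i + (\sum_(i in D) M i * nu i) / esymq D mu (l + d).
  rewrite mulr_suml -big_split /=; apply: eq_bigr => i _.
  by rewrite mulrDl mulrAC.
have Qrec nu : garding D nu (l + d).+1 ->
  ln (esigma D nu (l + d).+1 / esigma D nu l) =
  ln (esymq D nu (l + d)) + ln (esigma D nu (l + d) / esigma D nu l).
  move=> gn; have p j : (j <= (l + d).+1)%N -> 0 < esigma D nu j.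
    by move=> h; apply: garding_ge0 gn h.
  rewrite -lnM ?posrE ?divr_gt0 ?p ?leqnn // ?leqW ?leq_addr //.
  congr ln; rewrite /esymq [RHS]mulrA divfK // gt_eqF // p //.
exists (fun i => L i + M i / esymq D mu (l + d)); split.
- by move=> i; rewrite addr_ge0 // divr_ge0 // ltW.
- by rewrite ME Lmu Mmu mulfV ?gt_eqF // natr1.
- move=> nu gn; rewrite ME addr_ge0 //; first exact/Lnu/(garding_leq _ _ _ _ gn).
  by rewrite divr_ge0 ?(ltW q0) // (le_trans _ (Mnu _ gn)) // ltW // (esymq_gt0 _ _ _ _ gn).
move=> nu gn; rewrite !Qrec // ME -natr1.
have := Lln nu (garding_leq _ _ _ _ gn (leqnSn _)).
have qn0 : 0 < esymq D nu (l + d) by apply: esymq_gt0 gn _.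
have h1 : ln (esymq D nu (l + d)) - ln (esymq D mu (l + d)) <=
    esymq D nu (l + d) / esymq D mu (l + d) - 1.
  rewrite -ln_div ?posrE //.
  have := divr_gt0 qn0 q0; move: (esymq D nu _ / _) => t t0.
  have := @le_ln1Dx R (t - 1); rewrite [1 + _]addrC subrK; apply; lra.
have h2 : esymq D nu (l + d) / esymq D mu (l + d) <=
    (\sum_(i in D) M i * nu i) / esymq D mu (l + d).
  by rewrite ler_pM2r ?invr_gt0 // Mnu.
lra.
Qed.

(** In sigma_m one m-subset of [S] contributes 1. Any other product is either 1 or contains a factor
    -e times factors of modulus at most 1, so it is at least -e; with e below the inverse of the
    number of all subsets, these cannot cancel the 1. *)
Lemma garding_indicator D S k : S \subset D -> (k <= #|S|)%N ->
  garding D (fun i => if i \in S then 1 else - (#|{set T}|.+1%:R)^-1) k.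
Proof.
move=> SD kS m /andP[_ mk].
set e := _^-1; set f := fun i => _.
have e0 : 0 <= e :> R by rewrite invr_ge0 ler0n.
have e1 : e <= 1 :> R by rewrite invf_le1 ?ltr0n // ler1n.
have [A AS cA] : exists2 A : {set T}, A \subset S & #|A| = m.
  have : (0 < #|[set B : {set T} | B \subset S & #|B| == m]|)%N.
    by rewrite cards_draws bin_gt0 (leq_trans mk).
  by rewrite finset.card_gt0 => /finset.set0Pn[B]; rewrite inE => /andP[? /eqP ?]; exists B.
have fn i : `|f i| <= 1 by rewrite /f; case: ifP => _; rewrite ?normrN ?normr1 ?ger0_norm.
rewrite /Defs.esym (bigD1 A) /=; last by rewrite (fintype.subset_trans AS SD) cA eqxx.
rewrite big1 => [|i iA]; last by rewrite /f (fintype.subsetP AS).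
suff h : - (#|{set T}|%:R * e) <= 
    \sum_(B : {set T} | (B \subset D) && (#|B| == m) && (B != A)) \prod_(t in B) f t.
  have : #|{set T}|%:R * e < 1 :> R.
    by rewrite /e ltr_pdivrMr ?ltr0n // mul1r ltr_nat.
  lra.
apply: (@le_trans _ _ (\sum_(B : {set T} | (B \subset D) && (#|B| == m) && (B != A)) - e)).
  rewrite sumrN lerN2 sumr_const -[leLHS]mulr_natl ler_wpM2r //.
  by rewrite ler_nat max_card.
apply: ler_sum => B _.
have [/fintype.subsetP BS|/subsetPn[i iB iS]] := boolP (B \subset S).
  rewrite big1 => [|i iB]; last by rewrite /f BS.
  by rewrite lerNl (le_trans (lerN10 R)).
rewrite (bigD1 i) //= {1}/f (negPf iS) mulNr lerN2.
rewrite -[leRHS]mulr1 ler_wpM2l //.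
apply: le_trans (ler_norm _) _; rewrite normr_prod.
by apply: prodr_ile1 => j _; rewrite normr_ge0 fn.
Qed.

End ElementarySymmetric.

(** * Supporting functionals for the quotient of the P-fold sums *)

Section SigmaLam.
Context {R : realType}.

Lemma card_multi_idx_mem n P (i : 'I_n) : (0 < P)%N ->
  #|[set I in multi_idx n P | i \in I]| = 'C(n - 1, P - 1).
Proof.
move=> P0; have -> : (n - 1)%N = #|[set~ i]|.
  by rewrite cardsC1 card_ord subn1.
rewrite -cards_draws -(card_in_imset (f := fun I : {set 'I_n} => I :\ i)); last first.
  move=> I J; rewrite !inE => /andP[_ iI] /andP[_ iJ] e.
  by rewrite -(finset.setD1K iI) e finset.setD1K.
apply: eq_card => J; rewrite inE; apply/imsetP/andP.
  move=> [I]; rewrite !inE => /andP[/eqP cI iI] ->.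
  split; last by rewrite -cI (cardsD1 i I) iI add1n subn1.
  by apply/fintype.subsetP => j; rewrite !inE => /andP[].
move=> [/fintype.subsetP Ji /eqP cJ].
have iJ : i \notin J by apply/negP => /Ji; rewrite !inE eqxx.
exists (i |: J); last by rewrite finset.setU1K.
by rewrite !inE eqxx cardsU1 iJ cJ subn1 add1n prednK // eqxx.
Qed.

(** G_i is the sum of the coefficients L_I over the multi-indices I containing i. The constant [c]
    precedes [lam]: it makes the linearized operator uniformly elliptic relative to the trace of G,
    and bounds this trace from below in terms of the quotient alone. *)
Lemma sigmaL_support (n P k l : nat) : (1 < P)%N -> (P <= n - 1)%N ->
  (l < k)%N -> (k <= 'C(n - 1, P - 1))%N ->
  exists c : R, 0 < c /\ forall lam : 'I_n -> R, in_Gamma P k lam ->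
  exists G : 'I_n -> R,
  [/\ forall i, 0 <= G i, forall i, c * \sum_j G j <= G i,
     \sum_i G i * lam i = (k - l)%:R,
     c <= (1 + sigmaL P lam k / sigmaL P lam l) * \sum_j G j
   & forall nu : 'I_n -> R, in_Gamma P k nu ->
      ln (sigmaL P nu k / sigmaL P nu l) <=
      ln (sigmaL P lam k / sigmaL P lam l) + \sum_i G i * nu i - (k - l)%:R].
Proof.
move=> P1 Pn lk kC; set D := multi_idx n P.
pose e : R := (#|{set {set 'I_n}}|.+1%:R)^-1.
have e0 : 0 < e by rewrite invr_gt0 ltr0n.
have P0 : (0 : R) < P%:R by rewrite ltr0n ltnW.
have nP : (P <= n)%N by rewrite (leq_trans Pn) // leq_subr.
have cD : #|D| = 'C(n, P) by rewrite /D /multi_idx card_draws card_ord.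
have kD : (k <= #|D|)%N.
  rewrite cD (leq_trans kC) //.
  case: n P {D e e0 kC cD} P1 Pn P0 nP => [|n] [|P] // _ _ _ _.
  by rewrite !subn1 /= binS leq_addl.
(* The value of the quotient at the vector of ones in the space of multi-indices. *)
pose c1 : R := 'C(#|D|, k)%:R / 'C(#|D|, l)%:R.
have c10 : 0 < c1.
  by rewrite divr_gt0 ?ltr0n ?bin_gt0 // (leq_trans (ltnW lk)).
(* The first entry serves the comparability of the G_i, the second the lower bound for their sum. *)
exists (Num.min (e / (1 + e) / P%:R) (1 / (1 + c1^-1))).
split.
  rewrite lt_min !divr_gt0 ?addr_gt0 ?invr_gt0 //.
move=> lam gl.
have [d kd] : exists d, k = (l + d)%N by exists (k - l)%N; rewrite subnKC // ltnW.
have d0 : (0 < d)%N by move: lk; rewrite kd -[X in (X < _)%N]addn0 ltn_add2l.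
have gl' : garding D (Lam lam) (l + d) by rewrite -kd.
have [L [L0 Llam Lnu Lln]] := ln_esym_support D l d (Lam lam) gl'.
pose G i := \sum_(I in [set I in D | i \in I]) L I.
have GE nu : \sum_i G i * nu i = \sum_(I in D) L I * Lam nu I.
  under eq_bigr do rewrite mulr_suml.
  rewrite (exchange_big_dep (fun I => I \in D)) /=; last first.
    by move=> i I _; rewrite !inE => /andP[->].
  apply: eq_bigr => I ID; rewrite /Lam mulr_sumr; apply: eq_bigl => i.
  by rewrite inE ID.
have SG : \sum_i G i = P%:R * \sum_(I in D) L I.
  rewrite (eq_bigr (fun i => G i * 1)) => [|i _]; last by rewrite mulr1.
  rewrite GE mulr_sumr; apply: eq_bigr => I; rewrite inE => /eqP cI.
  by rewrite /Lam sumr_const cI mulrC.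
have SL0 : 0 <= \sum_(I in D) L I by apply: sumr_ge0.
exists G; split.
- by move=> i; apply: sumr_ge0.
(* Nonnegativity of L on the vector equal to 1 on the multi-indices through [i] and to -e elsewhere
   reads G_i >= e (\sum L - G_i), while \sum G = P \sum L. *)
- move=> i; set S := [set I in D | i \in I].
  have SD : S \subset D by apply/fintype.subsetP => I; rewrite inE => /andP[].
  have kS : (l + d <= #|S|)%N by rewrite -kd card_multi_idx_mem // ltnW.
  have := Lnu _ (garding_indicator D S (l + d) SD kS).
  rewrite (bigID (fun I => I \in S)) /=.
  rewrite (eq_bigl (fun I => I \in S)) => [|I]; last by rewrite !inE andbA andbb.
  rewrite (eq_bigr L) => [|I ->]; last by rewrite mulr1.
  rewrite -/(G i) [X in _ + X](_ : _ = - e * (\sum_(I in D) L I - G i)); last first.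
    rewrite [in RHS](bigID (fun I => I \in S)) /=.
    rewrite [X in _ = _ * (X + _ - _)](eq_bigl (fun I => I \in S)) => [|I]; last by rewrite !inE andbA andbb.
    rewrite -/(G i) addrC addKr mulr_sumr; apply: eq_bigr => I /andP[_ /negPf ->].
    by rewrite mulrC.
  move=> h; apply: (@le_trans _ _ (e / (1 + e) / P%:R * \sum_j G j)).
    by rewrite ler_wpM2r ?ge_min ?lexx // sumr_ge0 // => j _; apply: sumr_ge0.
  rewrite SG mulrA divfK ?gt_eqF // mulrAC ler_pdivrMr ?addr_gt0 //.
  lra.
- by rewrite GE Llam kd addKn.
- set Q := sigmaL P lam k / sigmaL P lam l.
  have Q0 : 0 < Q.
    by rewrite divr_gt0 // -?/(Defs.esym D (Lam lam) _) (garding_ge0 _ _ _ _ gl) // ltnW.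
  (* At the constant vector [s] the quotient is c1 s^d, which is at least Q since s >= 1 and d >= 1.
     The two logarithms in the support inequality then compare favourably, and s \sum L >= d >= 1
     remains. *)
  pose s := 1 + Q / c1.
  have s1 : 1 <= s by rewrite lerDl divr_ge0 // ltW.
  have s0 : 0 < s by rewrite (lt_le_trans ltr01).
  have gs : garding D (fun=> s) (l + d).
    move=> m /andP[_ mk]; rewrite esym_const mulr_gt0 ?exprn_gt0 // ltr0n bin_gt0.
    by rewrite (leq_trans _ kD) // kd.
  have := Lln _ gs; rewrite -kd !esym_const.
  rewrite -mulr_suml.
  have -> : 'C(#|D|, k)%:R * s ^+ k / ('C(#|D|, l)%:R * s ^+ l) = c1 * s ^+ d.
    rewrite /c1 kd exprD; field.
    by rewrite expf_neq0 ?gt_eqF // ltr0n bin_gt0 (leq_trans (ltnW lk)).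
  have h1 : Q <= c1 * s ^+ d.
    rewrite mulrC -ler_pdivrMr //.
    apply: (@le_trans _ _ s); first by rewrite lerDr.
    by rewrite -[leLHS]expr1 ler_weXn2l.
  have h2 : ln Q <= ln (c1 * s ^+ d).
    by rewrite ler_ln ?posrE // (lt_le_trans Q0).
  rewrite -/(sigmaL P lam k) -/(sigmaL P lam l) -/Q => h3.
  have h4 : 1 <= (\sum_(i in D) L i) * s.
    have : (1 : R) <= d%:R by rewrite ler1n.
    lra.
  have Ple : \sum_(I in D) L I <= \sum_j G j.
    by rewrite SG ler_peMl // ler1n ltnW.
  apply: (@le_trans _ _ (1 / (1 + c1^-1))); first by rewrite ge_min lexx orbT.
  rewrite ler_pdivrMr ?addr_gt0 ?invr_gt0 // (le_trans h4) //.
  rewrite mulrAC mulrC ler_pM //; first exact: ltW.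
  have : 0 < c1^-1 by rewrite invr_gt0.
  rewrite /s; nra.
move=> nu gn; rewrite GE kd addKn; apply: Lln; by rewrite -kd.
Qed.

End SigmaLam.

(** * Symmetry, majorization and rearrangement *)

Section Rearrangement.
Context {R : realType}.

Lemma sigmaL_const n P m (a : R) :
  sigmaL P (fun _ : 'I_n => a) m = 'C('C(n, P), m)%:R * (P%:R * a) ^+ m.
Proof.
rewrite /sigmaL (eq_esym _ _ (fun=> P%:R * a)).
  by rewrite esym_const /multi_idx card_draws card_ord.
by move=> I; rewrite inE /Lam => /eqP cI; rewrite sumr_const cI mulr_natl.
Qed.

Lemma sigmaL1 n P (lam : 'I_n -> R) : (0 < P)%N ->
  sigmaL P lam 1 = 'C(n - 1, P - 1)%:R * \sum_i lam i.
Proof.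
move=> P0; rewrite /sigmaL esym1 /Lam.
rewrite (exchange_big_dep predT) //= mulr_sumr; apply: eq_bigr => i _.
rewrite sumr_const mulr_natl -(card_multi_idx_mem n P i P0).
by congr (_ *+ _); apply: eq_card => I; rewrite [RHS]inE.
Qed.

Lemma sigmaL_perm n P (lam : 'I_n -> R) (s : {perm 'I_n}) m :
  sigmaL P (fun i => lam (s i)) m = sigmaL P lam m.
Proof.
pose f (I : {set 'I_n}) := [set s i | i in I].
pose g (I : {set 'I_n}) := [set (s^-1)%g i | i in I].
have fK : cancel f g.
  move=> I; rewrite /f /g -imset_comp (eq_imset (g := id)) ?imset_id // => i /=.
  by rewrite permK.
have gK : cancel g f.
  move=> I; rewrite /f /g -imset_comp (eq_imset (g := id)) ?imset_id // => i /=.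
  by rewrite permKV.
have cf I : #|f I| = #|I| by apply: card_imset; apply: perm_inj.
rewrite /sigmaL /Defs.esym [RHS](reindex (fun S : {set {set 'I_n}} => [set f I | I in S])) /=; last first.
  exists (fun S : {set {set 'I_n}} => [set g I | I in S]) => S _.
    by rewrite -imset_comp (eq_imset (g := id)) ?imset_id // => i /=; rewrite fK.
  by rewrite -imset_comp (eq_imset (g := id)) ?imset_id // => i /=; rewrite gK.
apply: eq_big => [S|S _].
  rewrite card_imset; last exact: can_inj fK.
  congr (_ && _); apply/fintype.subsetP/fintype.subsetP => H I.
    by move=> /imsetP[J JS ->]; have := H J JS; rewrite !inE cf.
  by move=> IS; have := H _ (imset_f f IS); rewrite !inE cf.
rewrite big_imset /=; last by move=> I J _ _; apply: can_inj fK _ _.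
apply: eq_bigr => I _; rewrite /Lam /f big_imset //= => i j _ _.
exact: perm_inj.
Qed.

Lemma exists_sorting_perm n (G : 'I_n -> R) :
  exists s : {perm 'I_n}, forall i j : 'I_n, (i <= j)%N -> G (s i) <= G (s j).
Proof.
pose r (i j : 'I_n) := G i <= G j.
pose t := sort r (enum 'I_n).
have tn : size t = n by rewrite size_sort size_enum_ord.
have tu : uniq t by rewrite sort_uniq enum_uniq.
pose f (i : 'I_n) := nth i t i.
have fE x0 i : f i = nth x0 t i by apply: set_nth_default; rewrite tn.
have fi : injective f.
  move=> i j; rewrite (fE i j) {1}/f => /eqP.
  by rewrite nth_uniq ?tn // => /eqP /val_inj.
exists (perm fi) => i j ij; rewrite !permE (fE i j).
have rt : transitive r by move=> y x z; apply: le_trans.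
have rr : reflexive r by move=> x; apply: lexx.
have st : sorted r t by apply: sort_sorted => x y; apply: le_total.
by apply: (sorted_leq_nth rt rr i st); rewrite ?inE ?tn.
Qed.

(** Summation by parts. The induction carries the stronger bound by G_m times the partial sum of d;
    since the total of d vanishes, the sign of G does not matter. *)
Lemma abel_ge0 n (G d : nat -> R) : (forall i, (i.+1 < n)%N -> G i <= G i.+1) ->
  (forall m, (m <= n)%N -> \sum_(0 <= i < m) d i <= 0) ->
  \sum_(0 <= i < n) d i = 0 -> 0 <= \sum_(0 <= i < n) G i * d i.
Proof.
move=> Gm dm d0.
suff H m : (m < n)%N -> G m * \sum_(0 <= i < m.+1) d i <= \sum_(0 <= i < m.+1) G i * d i.
  case: n {Gm dm} H d0 => [|n] H d0; first by rewrite big_nil.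
  by have := H n (leqnn _); rewrite d0 mulr0.
elim: m => [|m IH] mn; first by rewrite !big_nat1.
rewrite big_nat_recr //= [leRHS]big_nat_recr //= mulrDr lerD2r.
apply: le_trans (IH (ltnW mn)); apply: ler_wnM2r; last exact: Gm.
by apply: dm; apply: ltnW.
Qed.

(* A doubly stochastic average of lam is majorized by lam. *)
Lemma doubly_stochastic_rearrangement n (A : 'I_n -> 'I_n -> R) (G lam : 'I_n -> R) :
  (forall i j, 0 <= A i j) -> (forall i, \sum_j A i j = 1) ->
  (forall j, \sum_i A i j = 1) ->
  exists s : {perm 'I_n},
    \sum_i G i * lam (s i) <= \sum_i G i * \sum_j A i j * lam j.
Proof.
move=> A0 Ar Ac.
have [s Hs] := exists_sorting_perm n G.
have [r Hr] := exists_sorting_perm n (fun i => - lam i).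
(* The permutation pairs the smallest weight with the largest entry of [lam]: [s] sorts [G] upwards
   and [r] sorts [lam] downwards. In these orders the claim becomes an Abel sum of the differences
   [d]. *)
exists (s^-1 * r)%g.
rewrite (reindex_inj (perm_inj (s := s))) [leRHS](reindex_inj (perm_inj (s := s))) /=.
rewrite -subr_ge0 -sumrB.
case: n A G lam A0 Ar Ac s Hs r Hr => [|n] A G lam A0 Ar Ac s Hs r Hr.
  by rewrite big_ord0.
pose d (i : 'I_n.+1) := \sum_j A (s i) (r j) * lam (r j) - lam (r i).
rewrite (eq_bigr (fun i => G (s i) * d i)); last first.
  move=> i _; rewrite permM permK /d mulrBr; congr (_ * _ - _).
  by rewrite (reindex_inj (perm_inj (s := r))).
have toord (f : 'I_n.+1 -> R) m : (m <= n.+1)%N ->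
    \sum_(0 <= i < m) f (inord i) = \sum_(i < n.+1 | (i < m)%N) f i.
  move=> mn; rewrite big_mkord (big_ord_widen _ (fun i => f (inord i)) mn).
  by apply: eq_bigr => i _; rewrite inord_val.
have sumd m : (m <= n.+1)%N -> \sum_(0 <= i < m) d (inord i) =
    \sum_j (\sum_(i < n.+1 | (i < m)%N) A (s i) (r j) - (j < m)%N%:R) * lam (r j).
  move=> mn; rewrite (toord d) // /d sumrB exchange_big /=.
  under [RHS]eq_bigr do rewrite mulrBl.
  rewrite sumrB; congr (_ - _); first by apply: eq_bigr => j _; rewrite mulr_suml.
  rewrite big_mkcond; apply: eq_bigr => j _.
  by case: ifP; rewrite ?mul1r ?mul0r.
have w0 m j : 0 <= \sum_(i < n.+1 | (i < m)%N) A (s i) (r j) by apply: sumr_ge0.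
have w1 m j : \sum_(i < n.+1 | (i < m)%N) A (s i) (r j) <= 1.
  rewrite -(Ac (r j)) [leRHS](reindex_inj (perm_inj (s := s))) /=.
  rewrite [leRHS](bigID (fun i : 'I_n.+1 => (i < m)%N)) /= lerDl; exact: sumr_ge0.
have wsum m : (m <= n.+1)%N ->
  \sum_j (\sum_(i < n.+1 | (i < m)%N) A (s i) (r j) - (j < m)%N%:R) = 0.
  move=> mn; rewrite sumrB exchange_big /=.
  rewrite (eq_bigr (fun=> 1)); last first.
    by move=> i _; rewrite -(Ar (s i)) [RHS](reindex_inj (perm_inj (s := r))).
  rewrite [X in _ - X](bigID (fun i : 'I_n.+1 => (i < m)%N)) /=.
  rewrite [X in _ - (_ + X)]big1 => [|i /negPf -> //].
  by rewrite addr0 [X in _ - X](eq_bigr (fun=> 1)) ?subrr // => i ->.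
have sumdn : \sum_(0 <= i < n.+1) d (inord i) = 0.
  rewrite sumd // big1 // => j _.
  rewrite ltn_ord (eq_bigl predT) => [|i]; last by rewrite ltn_ord.
  rewrite (_ : \sum_i _ = 1) ?subrr ?mul0r // -(Ac (r j)).
  by rewrite [RHS](reindex_inj (perm_inj (s := s))).
have -> : \sum_i G (s i) * d i = \sum_(0 <= i < n.+1) G (s (inord i)) * d (inord i).
  rewrite (toord (fun i => G (s i) * d i)) //; apply: eq_bigl => i.
  by rewrite ltn_ord.
apply: (@abel_ge0 n.+1 (fun i => G (s (inord i))) (fun i => d (inord i))).
- by move=> i ni; apply: Hs; rewrite !inordK // ltnW.
- move=> m; rewrite leq_eqVlt => /orP[/eqP ->|mn].
    by rewrite sumdn.
  rewrite sumd; last exact: ltnW.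
  (* The weights sum to zero, so the constant lam(r m) may be subtracted. Every term is then
     nonpositive: for j < m a weight <= 0 meets a difference >= 0, and for j >= m the signs are
     reversed. *)
  have -> : \sum_j (\sum_(i < n.+1 | (i < m)%N) A (s i) (r j) - (j < m)%N%:R) * lam (r j)
    = \sum_j (\sum_(i < n.+1 | (i < m)%N) A (s i) (r j) - (j < m)%N%:R) * (lam (r j) - lam (r (inord m))).
    under [RHS]eq_bigr do rewrite mulrBr.
    by rewrite sumrB -[X in _ = _ - X]mulr_suml wsum ?mul0r ?subr0 // ltnW.
  apply: sumr_le0 => j _; case: (ltnP j m) => jm /=.
    apply: mulr_le0_ge0; first by rewrite subr_le0.
    have := Hr j (inord m); rewrite inordK // => /(_ (ltnW jm)); lra.
  rewrite subr0; apply: mulr_ge0_le0 => //.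
  have := Hr (inord m) j; rewrite inordK // => /(_ jm); lra.
exact: sumdn.
Qed.

End Rearrangement.

Local Open Scope classical_set_scope.
Local Open Scope ring_scope.

(** * Spectral theorem *)

Section Spectral.
Context {R : realType}.

Lemma mx11_eqP (A B : 'M[R]_1) : A 0 0 = B 0 0 -> A = B.
Proof. by move=> e; apply/matrixP => i j; rewrite !ord1. Qed.

Lemma mul_rV_trE d (x y : 'rV[R]_d) : (x *m y^T) 0 0 = \sum_i x 0 i * y 0 i.
Proof. by rewrite mxE; apply: eq_bigr => i _; rewrite mxE. Qed.

Lemma mul_rV_mx_trE d (A : 'M[R]_d) (x y : 'rV[R]_d) :
  (x *m A *m y^T) 0 0 = \sum_i \sum_j x 0 i * A i j * y 0 j.
Proof.
rewrite mul_rV_trE exchange_big /=; apply: eq_bigr => j _.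
by rewrite mxE mulr_suml.
Qed.

Lemma enorm_ge0 d (x : 'rV[R]_d) : 0 <= enorm x.
Proof. exact: sqrtr_ge0. Qed.

Lemma enorm_sqr d (x : 'rV[R]_d) : enorm x ^+ 2 = \sum_i x 0 i ^+ 2.
Proof. by rewrite sqr_sqrtr // sumr_ge0 // => i _; apply: sqr_ge0. Qed.

Lemma enorm1P d (x : 'rV[R]_d) : enorm x = 1 <-> x *m x^T = 1%:M.
Proof.
split=> [h|h].
  apply: mx11_eqP; rewrite mul_rV_trE mxE /=.
  by under eq_bigr do rewrite -expr2; rewrite -enorm_sqr h expr1n.
have : (x *m x^T) 0 0 = 1 by rewrite h mxE.
rewrite mul_rV_trE; under eq_bigr do rewrite -expr2.
by rewrite /enorm => ->; rewrite sqrtr1.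
Qed.

Lemma enormZ d (a : R) (x : 'rV[R]_d) : enorm (a *: x) = `|a| * enorm x.
Proof.
rewrite /enorm -sqrtr_sqr -sqrtrM ?sqr_ge0 // mulr_sumr; congr Num.sqrt.
by apply: eq_bigr => i _; rewrite mxE exprMn.
Qed.

Lemma enorm_gt0 d (x : 'rV[R]_d) : x != 0 -> 0 < enorm x.
Proof.
move=> x0; rewrite sqrtr_gt0 lt_neqAle eq_sym; apply/andP; split; last first.
  by rewrite sumr_ge0 // => i _; apply: sqr_ge0.
apply: contra x0; rewrite psumr_eq0 => [|i _]; last exact: sqr_ge0.
move=> /allP h; apply/eqP/rowP => i; rewrite mxE; apply/eqP.
by have := h i (mem_index_enum _); rewrite sqrf_eq0.
Qed.

Lemma enorm_normalize d (x : 'rV[R]_d) : x != 0 -> enorm ((enorm x)^-1 *: x) = 1.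
Proof.
move=> /enorm_gt0 h; rewrite enormZ ger0_norm ?invr_ge0 ?enorm_ge0 //.
by rewrite mulVf // gt_eqF.
Qed.

Lemma cvg_sum_ord (T : Type) (F : set_system T) {FF : Filter F} d
    (f : 'I_d -> T -> R) (a : 'I_d -> R) :
  (forall i, f i x @[x --> F] --> a i) ->
  \sum_i f i x @[x --> F] --> \sum_i a i.
Proof.
by move=> h; apply: cvg_big => //; exact: add_continuous.
Qed.

Lemma sqr_sum_continuous d : continuous (fun x : 'rV[R]_d => \sum_i x 0 i ^+ 2).
Proof.
move=> x; apply: (@cvg_sum_ord _ (nbhs x) _ d (fun i y => y 0 i ^+ 2)) => i.
by apply: (@cvgM _ _ (nbhs x)); apply: coord_continuous.
Qed.

Lemma compact_unit_sphere d : compact [set x : 'rV[R]_d | enorm x = 1].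
Proof.
apply: bounded_closed_compact.
  exists 1; split; first exact: real1.
  move=> M M1 x /= x1.
  rewrite [leLHS]/Num.norm /= mx_normrE; apply/bigmax_leP; split; first by lra.
  move=> [i j] _ /=; rewrite ord1 (le_trans _ (ltW M1)) //.
  rewrite -(expr_le1 (n := 2)) // real_normK ?num_real //.
  rewrite -[leRHS](expr1n _ 2) -x1 enorm_sqr (bigD1 j) //= lerDl.
  by rewrite sumr_ge0 // => k _; apply: sqr_ge0.
apply: (@closed_comp _ _ (@enorm R d) [set y | y = 1]) => [x _|]; last exact: closed_eq.
apply: continuous_comp; last exact: sqrt_continuous.
exact: sqr_sum_continuous.
Qed.

Lemma quadform_continuous d (A : 'M[R]_d) :
  continuous (fun x : 'rV[R]_d => (x *m A *m x^T) 0 0).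
Proof.
have -> : (fun x : 'rV[R]_d => (x *m A *m x^T) 0 0) =
    (fun x : 'rV[R]_d => \sum_i \sum_j x 0 i * A i j * x 0 j).
  by apply/funext => x; apply: mul_rV_mx_trE.
move=> x; apply: (@cvg_sum_ord _ (nbhs x)) => i; apply: (@cvg_sum_ord _ (nbhs x)) => j.
by apply: (@cvgM _ _ (nbhs x)); [apply: (@cvgM _ _ (nbhs x)); [apply: coord_continuous|apply: cvg_cst]|apply: coord_continuous].
Qed.

Lemma delta_unit d (i : 'I_d) : enorm (delta_mx 0 i : 'rV[R]_d) = 1.
Proof.
apply/enorm1P; apply: mx11_eqP.
rewrite mul_rV_trE (bigD1 i) //= !mxE !eqxx mulr1 big1 ?addr0 // => j ji.
by rewrite !mxE (negPf ji) andbF mul0r.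
Qed.

Lemma trmx_quad d (A : 'M[R]_d) (x y : 'rV[R]_d) : A^T = A ->
  (x *m A *m y^T) 0 0 = (y *m A *m x^T) 0 0.
Proof.
move=> sA; have <- : (x *m A *m y^T)^T 0 0 = (x *m A *m y^T) 0 0 by rewrite [LHS]mxE.
by rewrite !trmx_mul trmxK sA mulmxA.
Qed.

(** The form at v + t y equals 2 t c + t^2 b, where c is the cross term; it can stay nonnegative for
    all t only if c = 0. *)
Lemma psd_quad0 d (M : 'M[R]_d) (v : 'rV[R]_d) : M^T = M ->
  (forall y : 'rV[R]_d, 0 <= (y *m M *m y^T) 0 0) ->
  (v *m M *m v^T) 0 0 = 0 -> v *m M = 0.
Proof.
move=> sM qM qv.
apply/rowP => j; rewrite [RHS]mxE.
pose y : 'rV[R]_d := delta_mx 0 j.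
have cross : (v *m M *m y^T) 0 0 = (v *m M) 0 j.
  by rewrite mul_rV_trE (bigD1 j) //= big1 ?addr0 ?mxE ?eqxx ?mulr1 // => i ij; rewrite !mxE (negPf ij) mulr0.
rewrite -cross; set c := (v *m M *m y^T) 0 0.
have H t : 0 <= 2 * t * c + t ^+ 2 * (y *m M *m y^T) 0 0.
  have := qM (v + t *: y).
  have DE (A1 B1 : 'M[R]_1) : (A1 + B1) 0 0 = A1 0 0 + B1 0 0 by rewrite mxE.
  have ZE (k : R) (A1 : 'M[R]_1) : (k *: A1) 0 0 = k * A1 0 0 by rewrite mxE.
  rewrite [(_ + _)^T]linearD /= [(_ *: _)^T]linearZ /= !mulmxDl !mulmxDr.
  rewrite -!scalemxAl -!scalemxAr !DE !ZE.
  rewrite (trmx_quad _ _ y v sM) qv -/c; lra.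
move: H; move: ((y *m M *m y^T) 0 0) => b H.
apply/eqP; apply/negPn/negP => c0.
have c2 : 0 < c ^+ 2 by rewrite lt_neqAle eq_sym sqrf_eq0 c0 sqr_ge0.
have b0 : 0 < 1 + `|b| by rewrite ltr_wpDr.
(* The denominator 1 + |b| replaces the b of the minimizer -c / b, so that b = 0 needs no separate
   case. *)
have := H (- c / (1 + `|b|)).
have -> : 2 * (- c / (1 + `|b|)) * c + (- c / (1 + `|b|)) ^+ 2 * b =
   (c ^+ 2 / (1 + `|b|) ^+ 2) * (b - 2 * (1 + `|b|)).
  by field; rewrite gt_eqF.
rewrite pmulr_rge0 ?(divr_gt0 c2) ?exprn_gt0 //.
by have := ler_norm b; have := normr_ge0 b; lra.
Qed.

(** At a maximum v of the quadratic form on the sphere, with value a, the matrix a - A is positive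
    semidefinite and v is isotropic for it, hence in its kernel. *)
Lemma sym_max_eigenvector d (A : 'M[R]_d.+1) : A^T = A ->
  exists v : 'rV[R]_d.+1, exists a : R, enorm v = 1 /\ v *m A = a *: v.
Proof.
move=> sA.
have S0 : [set x : 'rV[R]_d.+1 | enorm x = 1] !=set0.
  by exists (delta_mx 0 ord0); apply: delta_unit.
have [v] := @EVT_max_rV R d.+1 (fun x => (x *m A *m x^T) 0 0) _ S0 (compact_unit_sphere d.+1)
  (continuous_subspaceT (quadform_continuous d.+1 A)).
rewrite inE /= => v1 vmax.
pose a := (v *m A *m v^T) 0 0; exists v, a; split=> //.
pose M := a%:M - A.
have sM : M^T = M by rewrite /M linearB /= sA tr_scalar_mx.
have yy (y : 'rV[R]_d.+1) : (y *m y^T) 0 0 = enorm y ^+ 2.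
  by rewrite mul_rV_trE enorm_sqr; apply: eq_bigr => i _; rewrite expr2.
have ME (y : 'rV[R]_d.+1) : (y *m M *m y^T) 0 0 = a * enorm y ^+ 2 - (y *m A *m y^T) 0 0.
  by rewrite /M mulmxBr mulmxBl mul_mx_scalar -scalemxAl -yy mxE [in LHS]mxE [X in _ + X]mxE.
have qM (y : 'rV[R]_d.+1) : 0 <= (y *m M *m y^T) 0 0.
  have [->|y0] := eqVneq y 0; first by rewrite !mul0mx mxE.
  have en := enorm_gt0 _ _ y0.
  have := vmax ((enorm y)^-1 *: y); rewrite inE /= => /(_ (enorm_normalize _ _ y0)).
  have -> : (((enorm y)^-1 *: y) *m A *m ((enorm y)^-1 *: y)^T) 0 0 =
      (y *m A *m y^T) 0 0 / enorm y ^+ 2.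
    rewrite linearZ /= -!scalemxAl -scalemxAr scalerA mxE -invfM -expr2.
    by rewrite mulrC.
  by rewrite ler_pdivrMr ?exprn_gt0 // ME subr_ge0.
have qv : (v *m M *m v^T) 0 0 = 0.
  by rewrite ME v1 expr1n mulr1 subrr.
suff : v *m M = 0.
  rewrite /M mulmxBr mul_mx_scalar => /eqP; rewrite subr_eq0 => /eqP <- //.
exact: psd_quad0.
Qed.

(** The reflection in the hyperplane orthogonal to v - e_0 exchanges e_0 and v; for v = e_0 that
    hyperplane is undefined and the identity serves. *)
Lemma householder d (v : 'rV[R]_d.+1) : enorm v = 1 ->
  exists H : 'M[R]_d.+1, H *m H^T = 1%:M /\ row 0 H = v.
Proof.
move=> v1; pose e : 'rV[R]_d.+1 := delta_mx 0 0.
have [->|ve] := eqVneq v e.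
  exists 1%:M; rewrite trmx1 mul1mx; split=> //.
  by apply/rowP => j; rewrite !mxE eqxx /= eq_sym.
pose z := v - e; pose s := (z *m z^T) 0 0.
have zz : z *m z^T = s%:M by apply: mx11_eqP; rewrite [RHS]mxE.
have z0 : z != 0 by rewrite subr_eq0.
have s0 : s != 0.
  rewrite /s mul_rV_trE; under eq_bigr do rewrite -expr2.
  by rewrite -enorm_sqr expf_neq0 // gt_eqF // enorm_gt0.
pose W := z^T *m z.
have WW : W *m W = s *: W.
  by rewrite /W mulmxA -(mulmxA z^T z) zz mul_mx_scalar -scalemxAl.
have WT : W^T = W by rewrite /W trmx_mul trmxK.
exists (1%:M - (2 / s) *: W); split.
  have -> : (1%:M - (2 / s) *: W)^T = 1%:M - (2 / s) *: W.
    by rewrite linearB /= linearZ /= WT trmx1.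
  rewrite mulmxBl mul1mx mulmxBr -!scalemxAl mulmx1 -scalemxAr WW !scalerA.
  rewrite (_ : 2 / s * (2 / s) * s = 2 / s + 2 / s); last by field.
  by rewrite scalerDl opprB addrK subrK.
rewrite linearB /= linearZ /= row_mul.
have -> : row 0 z^T = (z 0 0)%:M.
  by apply: mx11_eqP; rewrite !mxE mulr1n.
rewrite mul_scalar_mx scalerA.
have -> : row 0 (1%:M : 'M[R]_d.+1) = e by apply/rowP => j; rewrite !mxE eqxx /= eq_sym.
have -> : 2 / s * z 0 0 = -1.
  have : s = - 2 * z 0 0.
    have vv : \sum_i v 0 i * v 0 i = 1.
      by rewrite -mul_rV_trE; move/enorm1P: v1 => ->; rewrite mxE.
    have ee : \sum_i e 0 i * e 0 i = 1.
      by rewrite -mul_rV_trE; move/enorm1P: (delta_unit d.+1 0) => ->; rewrite mxE.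
    have vE : \sum_i v 0 i * e 0 i = v 0 0.
      by rewrite (bigD1 0) //= big1 ?addr0 ?mxE ?eqxx ?mulr1 // => i ij; rewrite !mxE (negPf ij) mulr0.
    rewrite /s mul_rV_trE /z !mxE eqxx.
    rewrite (eq_bigr (fun i => (v 0 i * v 0 i + e 0 i * e 0 i) - (v 0 i * e 0 i + v 0 i * e 0 i))).
      rewrite sumrB !big_split /= vv ee vE; ring.
    by move=> i _; rewrite !mxE; ring.
  move=> hs; move: s0; rewrite hs => s0.
  have : z 0 0 != 0 by move: s0; rewrite mulf_eq0 negb_or => /andP[].
  by move=> h; field.
by rewrite scaleN1r opprK /z addrC subrK.
Qed.

Lemma exists_frame n (x : 'rV[R]_n.+1) : sphere x -> exists E : 'M[R]_(n, n.+1), frame x E.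
Proof.
move=> /householder [H [HH Hx]].
exists (dsubmx (H : 'M[R]_(1 + n, n.+1))).
have e : (H : 'M[R]_(1 + n, n.+1)) = col_mx x (dsubmx (H : 'M[R]_(1 + n, n.+1))).
  rewrite -{1}[H](@vsubmxK _ 1 n); congr col_mx.
  rewrite -Hx; apply/matrixP => i j; rewrite !mxE ord1.
  by congr (H _ _); apply: val_inj.
have : col_mx x (dsubmx (H : 'M[R]_(1 + n, n.+1))) *m
  (col_mx x (dsubmx (H : 'M[R]_(1 + n, n.+1))))^T = (1%:M : 'M[R]_(1 + n)).
  by rewrite -e; exact: HH.
rewrite tr_col_mx mul_col_row scalar_mx_block => /eq_block_mx [_ _ h1 h2].
by split.
Qed.

(** Rotating a unit eigenvector to the first basis vector makes the matrix block diagonal by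
    symmetry, and the induction applies to the lower block. *)
Lemma spectral_theorem n (A : 'M[R]_n) : A^T = A ->
  exists O : 'M[R]_n, exists lam : 'rV[R]_n,
    O *m O^T = 1%:M /\ O *m A *m O^T = diag_mx lam.
Proof.
elim: n A => [|n IH] A sA.
  by exists 1%:M, 0; split; apply/matrixP => -[].
have [v [a [v1 va]]] := sym_max_eigenvector n A sA.
have [H [HH Hv]] := householder n v v1.
pose B : 'M[R]_(1 + n) := H *m A *m H^T.
have sB : B^T = B by rewrite /B !trmx_mul trmxK sA mulmxA.
have rB : row 0 B = a *: delta_mx 0 0.
  rewrite /B !row_mul Hv va -scalemxAl; congr (_ *: _).
  by rewrite -Hv -row_mul HH; apply/rowP => j; rewrite !mxE eqxx eq_sym.
have B0 j : B (lshift n (0 : 'I_1)) j = a * (val j == 0%N)%:R.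
  have := congr1 (fun M : 'rV_n.+1 => M 0 j) rB.
  rewrite [LHS]mxE [RHS]mxE [X in _ = a * X]mxE eqxx /= => <-.
  by congr (B _ _); apply: val_inj.
have BE : B = block_mx a%:M 0 0 (drsubmx B).
  rewrite -{1}[B]submxK; congr block_mx.
  - by apply: mx11_eqP; rewrite mxE mxE B0 !mxE mulr1 mulr1n.
  - apply/matrixP => i j; rewrite mxE mxE ord1 B0 !mxE.
    by rewrite /= mulr0.
  - apply/matrixP => i j; rewrite mxE mxE -sB mxE ord1 B0 !mxE.
    by rewrite /= mulr0.
have [|O [lam [OO Olam]]] := IH (drsubmx B); first by rewrite trmx_drsub sB.
pose K : 'M[R]_(1 + n) := block_mx 1%:M 0 0 O.
have KK : K *m K^T = 1%:M.
  rewrite /K tr_block_mx.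
  rewrite mulmx_block !trmx0 !mul0mx !mulmx0 !addr0 !add0r trmx1 mulmx1 OO.
  by rewrite -scalar_mx_block.
have KB : K *m B *m K^T = diag_mx (row_mx a%:M lam).
  rewrite (_ : K *m B *m K^T = block_mx a%:M 0 0 (O *m drsubmx B *m O^T)).
    rewrite Olam diag_mx_row; congr block_mx.
    by apply: mx11_eqP; rewrite !mxE.
  rewrite {1}BE /K tr_block_mx !mulmx_block !trmx0 !mul0mx !mulmx0 !addr0 !add0r.
  by rewrite trmx1 !mul1mx mulmx1 ?mul0mx ?addr0.
exists (K *m H), (row_mx a%:M lam : 'rV[R]_(1 + n)); split.
  by rewrite trmx_mul mulmxA -(mulmxA K) HH mulmx1; exact: KK.
by rewrite trmx_mul !mulmxA -[K *m H *m A]mulmxA -[K *m (H *m A) *m H^T]mulmxA; exact: KB.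
Qed.

Lemma eigs_diag n (lam : 'rV[R]_n) : eigs (diag_mx lam) (fun i => lam 0 i).
Proof.
rewrite /eigs char_poly_trig ?diag_mx_is_trig //.
by apply: eq_bigr => i _; rewrite mxE eqxx mulr1n.
Qed.

End Spectral.

(** * Second order jets *)

Section OneVariable.
Context {R : realType}.

Lemma mean_value_bound (g g' : R -> R) (h M : R) :
  (forall t : R, `|t| <= `|h| -> is_derive t 1 g (g' t) /\ `|g' t| <= M) ->
  `|g h - g 0| <= M * `|h|.
Proof.
move=> H.
have key a b : a <= b -> `|a| <= `|h| -> `|b| <= `|h| -> `|g b - g a| <= M * (b - a).
  move=> ab ha hb.
  have hc t : a <= t <= b -> `|t| <= `|h|.
    move=> /andP[at_ tb]; move: ha hb; rewrite !ler_norml => /andP[? ?] /andP[? ?].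
    by apply/andP; split; lra.
  have [c cab ->] : exists2 c, c \in `[a, b]%R & g b - g a = g' c * (b - a).
    apply: MVT_segment => // [x xab|].
      have xab' : a <= x <= b by rewrite !ltW ?(itvP xab).
      by have [] := H x (hc x xab').
    apply: derivable_within_continuous => x xab.
    have xab' : a <= x <= b by rewrite !(itvP xab).
    by have [[]] := H x (hc x xab').
  rewrite normrM (ger0_norm (_ : 0 <= b - a)) ?subr_ge0 // ler_wpM2r ?subr_ge0 //.
  have cab' : a <= c <= b by rewrite !(itvP cab).
  by have [] := H c (hc c cab').
have [h0|h0] := leP 0 h.
  by have := key 0 h h0; rewrite normr0 subr0 (ger0_norm h0); apply.
have := key h 0 (ltW h0); rewrite normr0 sub0r (ltr0_norm h0) distrC; apply => //.
by rewrite oppr_ge0 ltW.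
Qed.

(** [F1] is differentiable at 0 only, so no second order Taylor formula is at hand. If c < 0, the
    difference quotients of [F1] force F1 < 0 just to the right of 0, and the mean value theorem
    puts F below F 0 there. *)
Lemma second_derivative_min (F F1 : R -> R) (c : R) :
  (forall s : R, is_derive s 1 F (F1 s)) -> is_derive (0 : R) 1 F1 c ->
  (forall s, F 0 <= F s) -> F1 0 = 0 /\ 0 <= c.
Proof.
move=> dF [dF1 cE] Fmin.
have F10 : F1 0 = 0.
  have h : is_derive (0 : R) 1 F 0.
    apply: (@derive1_at_min R F (-1) 1 0); first by lra.
    - by move=> t _; have [] := dF t.
    - by rewrite in_itv /=; apply/andP; split; lra.
    - by [].
  by have [_ <-] := dF 0; have [_ ->] := h.
split => //.
rewrite leNgt; apply/negP => c0.
have cvg : (fun h : R => h^-1 *: ((F1 \o shift 0) (h *: 1) - F1 0)) @ 0^' --> c.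
  by rewrite -cE.
have : \forall h \near 0^', h^-1 *: ((F1 \o shift 0) (h *: (1 : R)) - F1 0) < 0.
  exact: (cvgr_lt c cvg).
rewrite near_withinE => /nbhs_ballP[e /= e0 He].
have neg s : 0 < s < e -> F1 s < 0.
  move=> /andP[s0 se]; have := He s.
  rewrite /= /ball /= sub0r normrN gtr0_norm // => /(_ se).
  rewrite gt_eqF // => /(_ isT); rewrite F10 subr0 addr0 [s *: 1]mulr1.
  by rewrite [_ *: _]mulrC pmulr_llt0 // invr_gt0.
have [x xi] : exists2 x, x \in `]0, (e / 2)[%R & F (e / 2) - F 0 = F1 x * (e / 2 - 0).
  apply: MVT => //; first by lra.
  by apply: derivable_within_continuous => x _; have [] := dF x.
have x2 : 0 < x < e by rewrite !(itvP xi) /= (lt_trans (y := e / 2)) ?(itvP xi) //; lra.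
have := neg x x2; have := Fmin (e / 2) => h1 h2 h3.
have : F1 x * (e / 2 - 0) < 0 by rewrite pmulr_llt0 //; lra.
lra.
Qed.

Lemma is_derive_mul (F G : R -> R) (x a b : R) :
  is_derive x 1 F a -> is_derive x 1 G b ->
  is_derive x 1 (fun s => F s * G s) (F x * b + a * G x).
Proof.
move=> dF dG; apply: (is_derive_eq (is_deriveM dF dG)).
by rewrite -![_ *: _]/(_ * _) [G x * a]mulrC.
Qed.

(** The first derivative is required on the whole line, the second at 0 only. This is stable under
    sums, products and logarithms, and is what the test at a global minimum consumes. *)
Definition jet2 (F : R -> R) (a b c : R) := exists F1 : R -> R,
  [/\ forall s : R, is_derive s 1 F (F1 s), F 0 = a, F1 0 = b & is_derive (0 : R) 1 F1 c].

Lemma jet2_min F a b c : jet2 F a b c -> (forall s, a <= F s) -> b = 0 /\ 0 <= c.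
Proof.
move=> [F1 [dF <- <- dF1]] Fmin; exact: second_derivative_min dF dF1 Fmin.
Qed.

Lemma jet2_eq F G a b c a' b' c' : jet2 F a b c -> F =1 G ->
  a = a' -> b = b' -> c = c' -> jet2 G a' b' c'.
Proof. by move=> h /funext <- <- <- <-. Qed.

Lemma jet2_cst k : jet2 (fun=> k) k 0 0.
Proof.
by exists (fun=> 0); split => // [s|]; apply: is_derive_cst.
Qed.

Lemma jet2D F G a b c a' b' c' : jet2 F a b c -> jet2 G a' b' c' ->
  jet2 (fun s => F s + G s) (a + a') (b + b') (c + c').
Proof.
move=> [F1 [dF <- <- dF1]] [G1 [dG <- <- dG1]].
by exists (fun s => F1 s + G1 s); split => // [s|]; apply: is_deriveD.
Qed.

Lemma jet2M F G a b c a' b' c' : jet2 F a b c -> jet2 G a' b' c' ->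
  jet2 (fun s => F s * G s) (a * a') (a * b' + b * a') (a * c' + 2 * b * b' + c * a').
Proof.
move=> [F1 [dF <- <- dF1]] [G1 [dG <- <- dG1]].
exists (fun s => F s * G1 s + F1 s * G s); split => // [s|].
  exact: is_derive_mul.
apply: (is_derive_eq (is_deriveD (is_derive_mul _ _ _ _ _ (dF 0) dG1)
  (is_derive_mul _ _ _ _ _ dF1 (dG 0)))).
ring.
Qed.

Lemma jet2_sqr F a b c : jet2 F a b c ->
  jet2 (fun s => F s ^+ 2) (a ^+ 2) (2 * (a * b)) (2 * (b ^+ 2 + a * c)).
Proof.
by move=> h; apply: jet2_eq (jet2M _ _ _ _ _ _ _ _ h h) _ _ _ _ => [s|||]; ring.
Qed.

Lemma jet2Z k F a b c : jet2 F a b c -> jet2 (fun s => k * F s) (k * a) (k * b) (k * c).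
Proof.
by move=> h; apply: jet2_eq (jet2M _ _ _ _ _ _ _ _ (jet2_cst k) h) _ _ _ _ => //; ring.
Qed.

Lemma jet2N F a b c : jet2 F a b c -> jet2 (fun s => - F s) (- a) (- b) (- c).
Proof.
move=> h; apply: jet2_eq (jet2Z (-1) _ _ _ _ h) _ _ _ _ => [s|||]; exact: mulN1r.
Qed.

Lemma jet2_sum d (F : 'I_d -> R -> R) (a b c : 'I_d -> R) (P : pred 'I_d) :
  (forall i, P i -> jet2 (F i) (a i) (b i) (c i)) ->
  jet2 (fun s => \sum_(i | P i) F i s) (\sum_(i | P i) a i) (\sum_(i | P i) b i) (\sum_(i | P i) c i).
Proof.
move=> H; elim: (index_enum _) => [|i r IH].
  apply: jet2_eq (jet2_cst 0) _ _ _ _ => [s|||]; by rewrite big_nil.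
have [Pi|Pi] := boolP (P i).
  by apply: jet2_eq (jet2D _ _ _ _ _ _ _ _ (H i Pi) IH) _ _ _ _ => [s|||]; rewrite [RHS]big_cons Pi.
by apply: jet2_eq IH _ _ _ _ => [s|||]; rewrite [RHS]big_cons (negPf Pi).
Qed.

Lemma jet2_ln F a b c : jet2 F a b c -> (forall s, 0 < F s) ->
  jet2 (fun s => ln (F s)) (ln a) (b / a) (c / a - (b / a) ^+ 2).
Proof.
move=> [F1 [dF <- <- dF1]] Fp.
have F0 : F 0 != 0 by rewrite gt_eqF.
exists (fun s => F1 s / F s); split => // [s|].
  apply: (is_derive_eq (is_derive1_comp (is_derive1_ln (Fp s)) (dF s))).
  by rewrite mulrC.
have [dF0 vF0] := dF 0.
have dV : is_derive (0 : R) 1 (fun s => (F s)^-1) (- (F 0) ^- 2 *: F1 0).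
  apply: DeriveDef; first exact: derivableV.
  by rewrite deriveV // vF0.
apply: (is_derive_eq (is_derive_mul _ _ _ _ _ dF1 dV)).
by rewrite -![_ *: _]/(_ * _); field.
Qed.

Lemma jet2_1Dsqr : jet2 (fun s => 1 + s ^+ 2) 1 0 2.
Proof.
have jid : jet2 (fun s => s) 0 1 0.
  exists (fun=> 1); split=> // [s|]; [exact: is_derive_id|exact: is_derive_cst].
apply: jet2_eq (jet2D _ _ _ _ _ _ _ _ (jet2_cst 1) (jet2M _ _ _ _ _ _ _ _ jid jid)) _ _ _ _.
- by move=> s /=; rewrite expr2.
- ring.
- ring.
- ring.
Qed.

Lemma jet2_sqrt1Dsqr : jet2 (fun s => Num.sqrt (1 + s ^+ 2)) 1 0 1.
Proof.
have [G1 [dG _ G10 dG1]] := jet2_1Dsqr.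
have p s : 0 < 1 + s ^+ 2 :> R by rewrite ltr_wpDr // sqr_ge0.
have dS (s : R) : is_derive s 1 (fun s : R => Num.sqrt (1 + s ^+ 2)) ((2 * Num.sqrt (1 + s ^+ 2))^-1 * G1 s).
  exact: (@is_derive1_comp _ Num.sqrt (fun s => 1 + s ^+ 2) s _ _ (is_derive1_sqrt (p s)) (dG s)).
have s0 : Num.sqrt (1 + 0 ^+ 2) = 1 :> R by rewrite expr0n addr0 sqrtr1.
exists (fun s => (2 * Num.sqrt (1 + s ^+ 2))^-1 * G1 s); split => //.
  by rewrite G10 mulr0.
have [dS0 vS0] := dS 0.
have dT : is_derive (0 : R) 1 (fun s : R => 2 * Num.sqrt (1 + s ^+ 2)) (2 * 0).
  apply: (is_derive_eq (is_derive_mul (fun=> 2) (fun s => Num.sqrt (1 + s ^+ 2)) 0 _ _ (is_derive_cst (2 : R) (0 : R) 1) (dS 0))).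
  by rewrite G10 mulr0 !mul0r addr0.
have dV : is_derive (0 : R) 1 (fun s : R => (2 * Num.sqrt (1 + s ^+ 2))^-1) (- (2 * Num.sqrt (1 + 0 ^+ 2)) ^- 2 *: (2 * 0)).
  have [dT0 vT0] := dT.
  apply: DeriveDef; first by apply: derivableV => //; rewrite s0 mulr1.
  by rewrite deriveV ?s0 ?mulr1 // vT0.
apply: (is_derive_eq (is_derive_mul (fun s => (2 * Num.sqrt (1 + s ^+ 2))^-1) G1 0 _ _ dV dG1)).
by rewrite -![_ *: _]/(_ * _) /= s0 G10; field.
Qed.

(** Right side minus left side is nonnegative and vanishes at s = 0, so its 2-jet there has zero
    slope and nonnegative second derivative. The extra terms come from the weights: sqrt(1 + s^2)
    has second derivative 1 and multiplies the whole sum, 1 + s^2 has second derivative 2 and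
    multiplies the term of index [a]. *)
Lemma jet2_support n (a : 'I_n) (G lam T Q : 'I_n -> R) (W : 'I_n -> R -> R)
    (L : R -> R) (c L0 L1 L2 : R) :
  (forall i, jet2 (W i) (lam i) (T i) (Q i)) -> jet2 L L0 L1 L2 ->
  c + \sum_i G i * lam i = L0 ->
  (forall s, L s <= c + Num.sqrt (1 + s ^+ 2) *
     (\sum_(i | i != a) G i * W i s + (1 + s ^+ 2) * (G a * W a s))) ->
  \sum_i G i * T i = L1 /\
  L2 <= \sum_i G i * Q i + \sum_i G i * lam i + 2 * (G a * lam a).
Proof.
move=> JW JL c0 H.
have J1 := jet2_sum n _ _ _ _ (fun i => i != a) (fun i _ => jet2Z (G i) _ _ _ _ (JW i)).
have J2 := jet2M _ _ _ _ _ _ _ _ jet2_1Dsqr (jet2Z (G a) _ _ _ _ (JW a)).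
have J3 := jet2M _ _ _ _ _ _ _ _ jet2_sqrt1Dsqr (jet2D _ _ _ _ _ _ _ _ J1 J2).
have J := jet2D _ _ _ _ _ _ _ _ (jet2D _ _ _ _ _ _ _ _ (jet2_cst c) J3) (jet2N _ _ _ _ JL).
have sumE (f : 'I_n -> R) : \sum_i G i * f i = \sum_(i | i != a) G i * f i + G a * f a.
  by rewrite (bigD1 a) //= addrC.
move: J; rewrite -c0 !sumE => J.
have [|h1 h2] := jet2_min _ _ _ _ J.
  move=> s; have := H s; lra.
by split; lra.
Qed.

(** [N] stands for the norm along a tangent line, whose second derivative 1 yields the extra [w0].
    The factors 2 in the jet of [Z], a squared gradient, cancel against A / 2. *)
Lemma jet2_maximum (N W Z : R -> R) (A w0 w1 w2 z0 z1 z2 : R) :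
  jet2 N 1 0 1 -> jet2 W w0 w1 w2 -> jet2 Z z0 (2 * z1) (2 * z2) ->
  (forall s, N s * W s + A / 2 * Z s <= w0 + A / 2 * z0) ->
  w1 = - (A * z1) /\ w0 + w2 + A * z2 <= 0.
Proof.
move=> JN JW JZ H.
have J := jet2N _ _ _ _ (jet2D _ _ _ _ _ _ _ _ (jet2M _ _ _ _ _ _ _ _ JN JW) (jet2Z (A / 2) _ _ _ _ JZ)).
have [|h1 h2] := jet2_min _ _ _ _ J.
  by move=> s; rewrite lerN2 mul1r; apply: H.
by split; lra.
Qed.

End OneVariable.

(** * Functions of class Ck *)

Section Ck.
Context {R : realType} {d : nat}.
Implicit Types (U : set 'rV[R]_d) (f g : 'rV[R]_d -> R) (x y v e : 'rV[R]_d).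

Lemma withinP U f : open U ->
  {within U, continuous f} <-> (forall x, U x -> {for x, continuous f}).
Proof.
move=> oU; rewrite continuous_open_subspace //; split=> h x Ux; apply: h => //.
  exact/mem_set.
by rewrite inE in Ux.
Qed.

Lemma CkOn_within k U f : CkOn k U f -> {within U, continuous f}.
Proof. by case: k => [//|k] []. Qed.

Lemma CkOn_for k U f x : open U -> CkOn k U f -> U x -> {for x, continuous f}.
Proof. by move=> oU /CkOn_within /(withinP U f oU); apply. Qed.

Lemma CkOnW k U f : CkOn k.+1 U f -> CkOn k U f.
Proof.
elim: k f => [|k IH] f [cf [df pf]]; first exact: cf.
by split => //; split => // i; apply: IH.
Qed.

Lemma CkOn_leq j k U f : (j <= k)%N -> CkOn k U f -> CkOn j U f.
Proof.
move=> /subnK <-; elim: (k - j)%N => // m IH; rewrite addSn => /CkOnW; exact: IH.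
Qed.

Lemma CkOn_pd k U f i : CkOn k.+1 U f -> CkOn k U (pd i f).
Proof. by move=> [_ [_ h]]; apply: h. Qed.

Lemma CkOn_derivable k U f i x : CkOn k.+1 U f -> U x -> derivable f x (ev R i).
Proof. by move=> [_ [h _]] Ux; apply: h. Qed.

Lemma near_open U f g x : open U -> U x -> (forall y, U y -> f y = g y) ->
  \near x, f x = g x.
Proof.
move=> oU Ux h; have : nbhs x U by apply: open_nbhs_nbhs.
by apply: filterS.
Qed.

Lemma near_continuous f g x : (\near x, f x = g x) ->
  {for x, continuous f} -> {for x, continuous g}.
Proof.
move=> nh cf; rewrite /prop_for /continuous_at -(nbhs_singleton nh).
apply: cvg_trans cf; apply: (near_eq_cvg (F := nbhs x)); exact: nh.
Qed.

Lemma pd_congr U f g i x : open U -> U x -> (forall y, U y -> f y = g y) ->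
  pd i f x = pd i g x.
Proof. by move=> oU Ux h; apply: near_eq_derive; apply: near_open oU Ux h. Qed.

Lemma CkOn_congr k U f g : open U -> (forall y, U y -> f y = g y) ->
  CkOn k U f -> CkOn k U g.
Proof.
move=> oU; elim: k f g => [|k IH] f g h /=.
  move=> /(withinP _ _ oU) cf; apply/(withinP _ _ oU) => x Ux.
  exact: near_continuous (near_open _ _ _ _ oU Ux h) (cf x Ux).
move=> [cf [df pf]]; split; last split.
- move: cf => /(withinP _ _ oU) cf; apply/(withinP _ _ oU) => x Ux.
  exact: near_continuous (near_open _ _ _ _ oU Ux h) (cf x Ux).
- by move=> i x Ux; apply: near_eq_derivable (df i x Ux); apply: near_open oU Ux h.
- move=> i; apply: IH (pf i) => y Uy; exact: (pd_congr U).
Qed.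

Lemma CkOn_cst k U (c : R) : open U -> CkOn k U (fun=> c).
Proof.
move=> oU; elim: k c => [|k IH] c /=; first by apply/(withinP _ _ oU) => x _; apply: cst_continuous.
split; first by apply/(withinP _ _ oU) => x _; apply: cst_continuous.
split=> [i x _|i]; first exact: derivable_cst.
apply: CkOn_congr (IH 0) => // y _; by rewrite /pd derive_cst.
Qed.

Lemma pdD k U f g i x : CkOn k.+1 U f -> CkOn k.+1 U g -> U x ->
  pd i (fun y => f y + g y) x = pd i f x + pd i g x.
Proof.
by move=> cf cg Ux; apply: (deriveD (f := f) (g := g));
  [exact: CkOn_derivable cf Ux|exact: CkOn_derivable cg Ux].
Qed.

Lemma pdM k U f g i x : CkOn k.+1 U f -> CkOn k.+1 U g -> U x ->
  pd i (fun y => f y * g y) x = f x * pd i g x + pd i f x * g x.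
Proof.
move=> cf cg Ux; rewrite /pd (deriveM (f := f) (g := g)); last 2 first.
- exact: CkOn_derivable cf Ux.
- exact: CkOn_derivable cg Ux.
by rewrite -![_ *: _]/(_ * _) [g x * _]mulrC.
Qed.

Lemma CkOnD k U f g : open U -> CkOn k U f -> CkOn k U g ->
  CkOn k U (fun y => f y + g y).
Proof.
move=> oU; elim: k f g => [|k IH] f g cf cg.
  apply/(withinP _ _ oU) => x Ux.
  by apply: (@continuousD _ _ _ f g); [exact: CkOn_for cf Ux|exact: CkOn_for cg Ux].
split; last split.
- apply/(withinP _ _ oU) => x Ux.
  by apply: (@continuousD _ _ _ f g); [exact: CkOn_for cf Ux|exact: CkOn_for cg Ux].
- by move=> i x Ux; apply: (derivableD (f := f) (g := g));
  [exact: CkOn_derivable cf Ux|exact: CkOn_derivable cg Ux].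
move=> i; apply: CkOn_congr (IH _ _ (CkOn_pd _ _ _ i cf) (CkOn_pd _ _ _ i cg)) => // y Uy.
exact/esym/(pdD k U).
Qed.

Lemma CkOnM k U f g : open U -> CkOn k U f -> CkOn k U g ->
  CkOn k U (fun y => f y * g y).
Proof.
move=> oU; elim: k f g => [|k IH] f g cf cg.
  apply/(withinP _ _ oU) => x Ux.
  by apply: (@continuousM _ _ f g); [exact: CkOn_for cf Ux|exact: CkOn_for cg Ux].
split; last split.
- apply/(withinP _ _ oU) => x Ux.
  by apply: (@continuousM _ _ f g); [exact: CkOn_for cf Ux|exact: CkOn_for cg Ux].
- by move=> i x Ux; apply: (derivableM (f := f) (g := g));
  [exact: CkOn_derivable cf Ux|exact: CkOn_derivable cg Ux].
move=> i; apply: CkOn_congr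
  (CkOnD k U _ _ oU (IH _ _ (CkOnW _ _ _ cf) (CkOn_pd _ _ _ i cg))
   (IH _ _ (CkOn_pd _ _ _ i cf) (CkOnW _ _ _ cg))) => // y Uy.
exact/esym/(pdM k U).
Qed.

Lemma CkOn_sum k U (n : nat) (F : 'I_n -> 'rV[R]_d -> R) : open U ->
  (forall i, CkOn k U (F i)) -> CkOn k U (fun y => \sum_i F i y).
Proof.
move=> oU h; elim: (index_enum _) => [|i r IH].
  by apply: CkOn_congr (CkOn_cst k U 0 oU) => // y _; rewrite big_nil.
by apply: CkOn_congr (CkOnD _ _ _ _ oU (h i) IH) => // y _; rewrite big_cons.
Qed.

Lemma cvg_is_derive f x v (a : R) :
  (fun h : R => h^-1 *: ((f \o shift x) (h *: v) - f x)) @ 0^' --> a -> is_derive x v f a.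
Proof.
by move=> h; apply: DeriveDef; [apply/cvg_ex; exists a|apply: cvg_lim].
Qed.

Lemma CkOn_coord k U i : open U -> CkOn k U (fun y => y 0 i).
Proof.
move=> oU.
have cc : {within U, continuous (fun y : 'rV[R]_d => y 0 i)}.
  by apply/(withinP _ _ oU) => x _; apply: coord_continuous.
case: k => [|k]; first exact: cc.
have dE j (x : 'rV[R]_d) : is_derive x (ev R j) (fun y : 'rV[R]_d => y 0 i) (i == j)%:R.
  apply: cvg_is_derive.
  apply: (@cvg_trans _ ((fun=> (i == j)%:R : R) @ dnbhs (0 : R))); last exact: cvg_cst.
  apply: (near_eq_cvg (F := dnbhs (0 : R))); near=> h; rewrite /= !mxE eqxx /= addrK.
  rewrite -[_ *: _]/(_ * _) mulrA mulVf ?mul1r //.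
  near: h; exact: nbhs_dnbhs_neq.
split; [exact: cc|split].
  by move=> j x _; have [] := dE j x.
move=> j; apply: CkOn_congr (CkOn_cst k U (i == j)%:R oU) => // y _.
by rewrite /pd; have [_ ->] := dE j y.
Unshelve. all: by end_near. Qed.

Definition dird e f x := \sum_j e 0 j * pd j f x.

Lemma CkOn_dird k U f e : open U -> CkOn k.+1 U f -> CkOn k U (dird e f).
Proof.
move=> oU cf; apply: CkOn_sum => // j; apply: CkOnM => //; first exact: CkOn_cst.
exact: CkOn_pd.
Qed.

(** Uniformity in the base point [y] makes the derivative additive in the direction [v], which plain
    directional derivatives need not be. *)
Definition strict_derive f x v (a : R) := forall eps : R, 0 < eps ->
  exists2 del : R, 0 < del & forall y (h : R), `|y - x| < del -> `|h| < del ->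
    `|f (y + h *: v) - f y - h * a| <= eps * `|h|.

Lemma strict_deriveD f x v w a b : strict_derive f x v a -> strict_derive f x w b ->
  strict_derive f x (v + w) (a + b).
Proof.
move=> H1 H2 eps e0; have e20 : 0 < eps / 2 by rewrite divr_gt0.
have [d1 d10 {}H1] := H1 _ e20; have [d2 d20 {}H2] := H2 _ e20.
have v0 : 0 < 1 + `|v| by rewrite ltr_wpDr.
exists (Num.min d1 (d2 / 2 / (1 + `|v|))).
  by rewrite lt_min d10 !divr_gt0.
move=> y h; rewrite !lt_min => /andP[y1 y2] /andP[h1 h2].
have q : d2 / 2 / (1 + `|v|) <= d2 / 2.
  by rewrite ler_pdivrMr //; have := normr_ge0 v; nra.
have h2' : `|h| < d2 by apply: lt_le_trans h2 _; apply: le_trans q _; lra.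
have yv : `|y + h *: v - x| < d2.
  rewrite addrAC (le_lt_trans (ler_normD _ _)) // normrZ.
  have : `|h| * `|v| < d2 / 2.
    apply: (@le_lt_trans _ _ (`|h| * (1 + `|v|))); first by rewrite ler_wpM2l // lerDr.
    by rewrite -ltr_pdivlMr.
  lra.
have := H1 y h y1 h1; have := H2 _ h yv h2'.
have -> : y + h *: v + h *: w = y + h *: (v + w) by rewrite scalerDr addrA.
set A := f (y + h *: (v + w)); set B := f (y + h *: v).
have -> : A - f y - h * (a + b) = (A - B - h * b) + (B - f y - h * a) by ring.
by move=> k1 k2; apply: le_trans (ler_normD _ _) _; lra.
Qed.

Lemma strict_deriveZ f x v a c : strict_derive f x v a -> strict_derive f x (c *: v) (c * a).
Proof.
move=> H eps e0.
have c0 : 0 < 1 + `|c| by rewrite ltr_wpDr.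
have [del d0 {}H] := H (eps / (1 + `|c|)) (divr_gt0 e0 c0).
exists (Num.min del (del / (1 + `|c|))); first by rewrite lt_min d0 divr_gt0.
move=> y h; rewrite !lt_min => /andP[y1 _] /andP[_ h2].
have hc : `|h * c| < del.
  rewrite normrM (@le_lt_trans _ _ (`|h| * (1 + `|c|))) ?ler_wpM2l ?lerDr //.
  by rewrite -ltr_pdivlMr.
have := H y (h * c) y1 hc; rewrite scalerA mulrA => /le_trans; apply.
rewrite normrM mulrAC ler_pdivrMr //.
by have := mulr_ge0 (ltW e0) (normr_ge0 h); lra.
Qed.

Lemma is_derive_line f x e (s a : R) : is_derive (x + s *: e) e f a ->
  is_derive s 1 (fun t : R => f (x + t *: e)) a.
Proof.
move=> [df va].
have E : (fun h0 : R => h0^-1 *: (((fun t : R => f (x + t *: e)) \o shift s) (h0 *: (1 : R)) - f (x + s *: e)))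
   = (fun h0 : R => h0^-1 *: ((f \o shift (x + s *: e)) (h0 *: e) - f (x + s *: e))).
  apply/funext => h0 /=; congr (_ *: (f _ - _)).
  by rewrite [h0 *: 1]mulr1 scalerDl addrCA.
by apply: DeriveDef; rewrite /derivable /derive E.
Qed.

(** The mean value theorem is applied to f minus its linear part; continuity of the partial
    derivative makes the error uniform in the base point. *)
Lemma strict_derive_ev U f x i : open U -> CkOn 1 U f -> U x ->
  strict_derive f x (ev R i) (pd i f x).
Proof.
move=> oU cf Ux eps e0.
have cp := CkOn_for 0 _ _ _ oU (CkOn_pd _ _ _ i cf) Ux.
have : nbhs x [set y | U y /\ `|pd i f x - pd i f y| < eps].
  apply: filterI; first by apply: open_nbhs_nbhs.
  by move/cvgrPdist_lt : cp; apply.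
move=> /nbhs_normP [del /= d0 Hd].
have e1 : 0 < 1 + `|ev R i| by rewrite ltr_wpDr.
exists (Num.min (del / 2) (del / 2 / (1 + `|ev R i|))).
  by rewrite lt_min !divr_gt0.
move=> y h; rewrite !lt_min => /andP[y1 _] /andP[_ h2].
pose g t := f (y + t *: ev R i) - t * pd i f x.
have inU (t : R) : `|t| <= `|h| -> U (y + t *: ev R i) /\ `|pd i f x - pd i f (y + t *: ev R i)| < eps.
  move=> th; apply: Hd => /=.
  rewrite -opprB normrN addrAC (le_lt_trans (ler_normD _ _)) // normrZ.
  have : `|t| * `|ev R i| < del / 2.
    apply: (@le_lt_trans _ _ (`|h| * (1 + `|ev R i|))).
      by rewrite ler_pM // lerDr.
    by rewrite -ltr_pdivlMr.
  lra.
have := @mean_value_bound R g (fun t => pd i f (y + t *: ev R i) - pd i f x) h eps.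
rewrite /g scale0r addr0 mul0r subr0 => M.
have -> : f (y + h *: ev R i) - f y - h * pd i f x = f (y + h *: ev R i) - h * pd i f x - f y by ring.
apply: M => t th; have [Ut lt] := inU t th; split; last by rewrite distrC ltW.
have df := CkOn_derivable 0 _ _ i _ cf Ut.
have dF : is_derive t 1 (fun t : R => f (y + t *: ev R i)) (pd i f (y + t *: ev R i)).
  exact/is_derive_line/derivableP.
have dL : is_derive t 1 (fun t : R => t * pd i f x) (pd i f x).
  apply: (is_derive_eq (is_derive_mul (fun t => t) (fun=> pd i f x) t _ _ (is_derive_id t 1) (is_derive_cst (pd i f x) t 1))).
  by rewrite mulr0 add0r mul1r.
exact: (is_deriveB dF dL).
Qed.

Lemma rV_sum_ev e : e = \sum_j e 0 j *: ev R j.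
Proof. exact: row_sum_delta. Qed.

(** [CkOn] provides derivatives along coordinate vectors only. This assembles them into the
    derivative in an arbitrary direction, as frames require. *)
Lemma strict_derive_C1 U f x e : open U -> CkOn 1 U f -> U x ->
  strict_derive f x e (dird e f x).
Proof.
move=> oU cf Ux; rewrite {1}(rV_sum_ev e) /dird.
elim: (index_enum _) => [|i r IH]; last first.
  by rewrite !big_cons; apply: strict_deriveD => //; apply: strict_deriveZ; apply: (strict_derive_ev U).
rewrite !big_nil => eps e0; exists 1 => // y h _ _.
by rewrite scaler0 addr0 subrr mulr0 subr0 normr0 mulr_ge0 // ltW.
Qed.

Lemma strict_derive_is_derive f x v a : strict_derive f x v a -> is_derive x v f a.
Proof.
move=> H.
apply: cvg_is_derive; apply/cvgrPdist_le => eps e0.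
have [del d0 Hd] := H eps e0.
rewrite near_withinE; apply/nbhs_ballP; exists del => //= h.
rewrite /ball /= sub0r normrN => hd h0.
have := Hd x h; rewrite subrr normr0 => /(_ d0 hd).
rewrite [x + h *: v]addrC; set A := f (h *: v + x) => le1.
have -> : a - h^-1 *: (A - f x) = - (h^-1 * (A - f x - h * a)).
  by rewrite -[_ *: _]/(_ * _); field.
by rewrite normrN normrM normfV ler_pdivrMl ?normr_gt0 // [`|h| * _]mulrC.
Qed.

Lemma is_derive_line_C1 U f x e (s : R) : open U -> CkOn 1 U f -> U (x + s *: e) ->
  is_derive s 1 (fun t : R => f (x + t *: e)) (dird e f (x + s *: e)).
Proof.
move=> oU cf Us; apply: is_derive_line; apply: strict_derive_is_derive.
exact: (strict_derive_C1 U).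
Qed.

Lemma jet2_line U f x e : open U -> CkOn 2 U f -> (forall s : R, U (x + s *: e)) ->
  jet2 (fun s => f (x + s *: e)) (f x) (dird e f x) (dird e (dird e f) x).
Proof.
move=> oU cf Us; exists (fun s => dird e f (x + s *: e)); split.
- by move=> s; apply: (is_derive_line_C1 U) => //; apply: CkOnW.
- by rewrite scale0r addr0.
- by rewrite scale0r addr0.
have := is_derive_line_C1 U (dird e f) x e 0 oU (CkOn_dird 1 _ _ e oU cf) (Us 0).
by rewrite scale0r addr0.
Qed.

(* Both mixed derivatives are limits of the same second difference quotient. *)
Lemma pd_comm U f i j x : open U -> CkOn 2 U f -> U x ->
  pd i (pd j f) x = pd j (pd i f) x.
Proof.
move=> oU cf Ux.
have bnd k m (eps : R) : 0 < eps -> exists2 del : R, 0 < del & forall h : R, `|h| < del ->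
  `|f (x + h *: ev R m + h *: ev R k) - f (x + h *: ev R k) - f (x + h *: ev R m) + f x
     - h * (h * pd m (pd k f) x)| <= eps * `|h| * `|h|.
  move=> e0.
  have sd := strict_derive_ev U (pd k f) x m oU (CkOn_pd _ _ _ k cf) Ux.
  have [del d0 Hd] := sd eps e0.
  have : nbhs x U by apply: open_nbhs_nbhs.
  move=> /nbhs_normP [r /= r0 Hr].
  have k1 : 0 < 1 + `|ev R k| by rewrite ltr_wpDr.
  have m1 : 0 < 1 + `|ev R m| by rewrite ltr_wpDr.
  pose c := (1 + `|ev R k|) * (1 + `|ev R m|).
  have c0 : 0 < c by rewrite mulr_gt0.
  have ck : `|ev R k| <= c.
    by rewrite /c; have := normr_ge0 (ev R k); have := normr_ge0 (ev R m); nra.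
  have cm : `|ev R m| <= c.
    by rewrite /c; have := normr_ge0 (ev R k); have := normr_ge0 (ev R m); nra.
  have c1 : 1 <= c.
    by rewrite /c; have := normr_ge0 (ev R k); have := normr_ge0 (ev R m); nra.
  exists (Num.min del r / (2 * c)); first by rewrite divr_gt0 ?lt_min ?d0 ?mulr_gt0.
  move=> h; rewrite ltr_pdivlMr ?mulr_gt0 // lt_min => /andP[hd hr].
  have tb (t : R) : `|t| <= `|h| -> `|t *: ev R k| <= `|h| * c.
    by move=> th; rewrite normrZ ler_pM.
  have hb : `|h *: ev R m| <= `|h| * c by rewrite normrZ ler_pM.
  pose g t := f (x + h *: ev R m + t *: ev R k) - f (x + t *: ev R k) - t * (h * pd m (pd k f) x).
  have := @mean_value_bound R g (fun t => pd k f (x + h *: ev R m + t *: ev R k) - pd k f (x + t *: ev R k) - h * pd m (pd k f) x) h (eps * `|h|).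
  rewrite /g !scale0r !addr0 mul0r subr0.
  set A := f (x + _ + _); set B := f (x + h *: ev R k); set C := f (x + h *: ev R m) => M.
  have -> : A - B - C + f x - h * (h * pd m (pd k f) x) =
    A - B - h * (h * pd m (pd k f) x) - (C - f x) by ring.
  apply: M => t th.
  have U1 : U (x + t *: ev R k).
    apply: Hr => /=; rewrite opprD addrA subrr sub0r normrN.
    apply: le_lt_trans (tb t th) _; have := normr_ge0 h; nra.
  have U2 : U (x + h *: ev R m + t *: ev R k).
    apply: Hr => /=; rewrite -addrA opprD addrA subrr sub0r normrN.
    apply: le_lt_trans (ler_normD _ _) _; have := tb t th; have := normr_ge0 h; nra.
  split.
    have dev y : dird (ev R k) f y = pd k f y.
      rewrite /dird (bigD1 k) //= big1 ?addr0 ?mxE ?eqxx ?mul1r // => l lk.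
      by rewrite !mxE (negPf lk) mul0r.
    have d1 := is_derive_line_C1 U f (x + h *: ev R m) (ev R k) t oU (CkOnW _ _ _ cf) U2.
    have d2 := is_derive_line_C1 U f x (ev R k) t oU (CkOnW _ _ _ cf) U1.
    rewrite !dev in d1 d2.
    have dL : is_derive t 1 (fun t : R => t * (h * pd m (pd k f) x)) (h * pd m (pd k f) x).
      apply: (is_derive_eq (is_derive_mul (fun t => t) (fun=> h * pd m (pd k f) x) t _ _ (is_derive_id t 1) (is_derive_cst (h * pd m (pd k f) x) t 1))).
      by rewrite mulr0 add0r mul1r.
    exact: (is_deriveB (is_deriveB d1 d2) dL).
  rewrite [x + h *: _ + _]addrAC; apply: Hd.
    rewrite addrAC subrr add0r; apply: le_lt_trans (tb t th) _; have := normr_ge0 h; nra.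
  have := normr_ge0 h; nra.
apply/eqP; rewrite -subr_eq0 -normr_le0; apply/ler_addgt0Pl => eps e0 /=; rewrite addr0.
have e30 : 0 < eps / 2 by lra.
have [d1 d10 H1] := bnd i j _ e30; have [d2 d20 H2] := bnd j i _ e30.
pose h := Num.min d1 d2 / 2.
have m0 : 0 < Num.min d1 d2 by rewrite lt_min d10.
have h0 : 0 < h by rewrite /h divr_gt0.
have hm : `|h| < Num.min d1 d2 by rewrite gtr0_norm // /h; lra.
move: hm; rewrite lt_min => /andP[hd1 hd2].
have := H1 h hd1; have := H2 h hd2; rewrite (gtr0_norm h0).
rewrite [x + h *: ev R i + h *: ev R j]addrAC.
set A := f (x + _ + _); set B := f (x + _); set C := f (x + _).
set p1 := pd j _ x; set p2 := pd i _ x => k1 k2.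
rewrite -(ler_pM2r (mulr_gt0 h0 h0)) -{1}(gtr0_norm (mulr_gt0 h0 h0)) -normrM.
have -> : (p2 - p1) * (h * h) =
  (A - C - B + f x - h * (h * p1)) - (A - B - C + f x - h * (h * p2)) by ring.
apply: le_trans (ler_normB _ _) _; apply: (le_trans (lerD k2 k1)).
by rewrite -mulrDl -mulrDl -splitr mulrA.
Qed.

Lemma dird_congr U f g e x : open U -> U x -> (forall y, U y -> f y = g y) ->
  dird e f x = dird e g x.
Proof.
by move=> oU Ux h; apply: eq_bigr => j _; rewrite (pd_congr U f g).
Qed.

Lemma pd_sum U (n : nat) (F : 'I_n -> 'rV[R]_d -> R) i x : open U -> U x ->
  (forall j, CkOn 1 U (F j)) -> pd i (fun y => \sum_j F j y) x = \sum_j pd i (F j) x.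
Proof.
move=> oU Ux cF; rewrite /pd -derive_sum; last first.
  by move=> j; apply: CkOn_derivable (cF j) Ux.
by congr ('D__ _ _); apply/funext => y; rewrite fct_sumE.
Qed.

Lemma dird_dird U f e e' x : open U -> CkOn 2 U f -> U x ->
  dird e (dird e' f) x = \sum_i \sum_j e 0 i * e' 0 j * pd i (pd j f) x.
Proof.
move=> oU cf Ux; apply: eq_bigr => i _.
rewrite (pd_sum U) // => [|j]; last first.
  by apply: CkOnM => //; [apply: CkOn_cst|apply: CkOn_pd].
rewrite mulr_sumr; apply: eq_bigr => j _.
rewrite (pdM 0 U) //; [|exact: CkOn_cst|exact: CkOn_pd].
have -> : pd i (fun=> e' 0 j) x = 0 by exact: derive_cst.
by rewrite mul0r addr0 mulrA.
Qed.

Lemma dird_comm U f e e' x : open U -> CkOn 2 U f -> U x ->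
  dird e (dird e' f) x = dird e' (dird e f) x.
Proof.
move=> oU cf Ux; rewrite !(dird_dird U) // exchange_big /=.
apply: eq_bigr => i _; apply: eq_bigr => j _.
by rewrite (pd_comm U) // [e 0 j * _]mulrC.
Qed.

Lemma dird_comm4 U f e e' x : open U -> CkOn 4 U f -> U x ->
  dird e (dird e (dird e' (dird e' f))) x = dird e' (dird e' (dird e (dird e f))) x.
Proof.
move=> oU cf Ux.
have c3 v : CkOn 3 U (dird v f) by apply: CkOn_dird.
have c2 v w : CkOn 2 U (dird v (dird w f)) by apply: CkOn_dird.
have f2 : CkOn 2 U f by apply: CkOn_leq cf.
have c2' v : CkOn 2 U (dird v f) by exact/CkOnW/c3.
have s1 := dird_congr U _ _ e x oU Ux
  (fun y Uy => dird_comm U (dird e' f) e e' y oU (c2' e') Uy).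
have s2 := dird_comm U (dird e (dird e' f)) e e' x oU (c2 e e') Ux.
have s3 := dird_congr U _ _ e' x oU Ux (fun y Uy => dird_congr U _ _ e y oU Uy
  (fun z Uz => dird_comm U f e e' z oU f2 Uz)).
have s4 := dird_congr U _ _ e' x oU Ux
  (fun y Uy => dird_comm U (dird e f) e e' y oU (c2' e) Uy).
exact: (etrans s1 (etrans s2 (etrans s3 s4))).
Qed.

End Ck.

(** * Inverses, square roots and homogeneous functions *)

Section CkComposition.
Context {R : realType} {d : nat}.
Implicit Types (U : set 'rV[R]_d) (f g : 'rV[R]_d -> R) (x y v e : 'rV[R]_d).

Lemma is_derive_of_line f x e (a : R) :
  is_derive (0 : R) 1 (fun t : R => f (x + t *: e)) a -> is_derive x e f a.
Proof.
move=> [df va].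
have E : (fun h0 : R => h0^-1 *: (((fun t : R => f (x + t *: e)) \o shift 0) (h0 *: (1 : R)) - f (x + (0 : R) *: e)))
   = (fun h0 : R => h0^-1 *: ((f \o shift x) (h0 *: e) - f x)).
  apply/funext => h0 /=; rewrite scale0r !addr0; congr (_ *: (f _ - _)).
  by rewrite [h0 *: 1]mulr1 addrC.
by move: df va; rewrite /derivable /derive E => df va; apply: DeriveDef.
Qed.

Lemma is_derive_comp_dir (phi : R -> R) f x v (a b : R) :
  is_derive x v f a -> is_derive (f x) 1 phi b -> is_derive x v (fun y => phi (f y)) (b * a).
Proof.
move=> df dphi; apply: is_derive_of_line.
have df' : is_derive (0 : R) 1 (fun t : R => f (x + t *: v)) a.
  by apply: is_derive_line; rewrite scale0r addr0.
apply: (@is_derive1_comp _ phi (fun t : R => f (x + t *: v)) 0) => //.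
by rewrite scale0r addr0.
Qed.

Lemma CkOnV k U f : open U -> (forall x, U x -> f x != 0) -> CkOn k U f ->
  CkOn k U (fun y => (f y)^-1).
Proof.
move=> oU f0; have cV j : CkOn j U f -> {within U, continuous (fun y => (f y)^-1)}.
  move=> cf; apply/(withinP _ _ oU) => x Ux.
  by apply: (@continuousV _ _ f x (f0 x Ux)); exact: CkOn_for cf Ux.
elim: k => [|k IH] cf; first exact: cV cf.
split; [exact: cV cf|split].
  by move=> i x Ux; apply: (derivableV (f0 x Ux)); exact: CkOn_derivable cf Ux.
have IHk := IH (CkOnW _ _ _ cf).
move=> i; apply: CkOn_congr (CkOnM _ _ _ _ oU (CkOn_cst k U (-1) oU)
  (CkOnM _ _ _ _ oU (CkOnM _ _ _ _ oU IHk IHk) (CkOn_pd _ _ _ i cf))) => // y Uy.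
rewrite /pd deriveV ?f0 //; last exact: CkOn_derivable cf Uy.
by rewrite -[_ *: _]/(_ * _) mulN1r expr2 invfM mulNr.
Qed.

Lemma CkOn_sqrt k U f : open U -> (forall x, U x -> 0 < f x) -> CkOn k U f ->
  CkOn k U (fun y => Num.sqrt (f y)).
Proof.
move=> oU f0.
have cS j : CkOn j U f -> {within U, continuous (fun y => Num.sqrt (f y))}.
  move=> cf; apply/(withinP _ _ oU) => x Ux.
  by apply: (@continuous_comp _ _ _ f Num.sqrt); [exact: CkOn_for cf Ux|exact: sqrt_continuous].
elim: k => [|k IH] cf; first exact: cS cf.
have dS i x : U x -> is_derive x (ev R i) (fun y => Num.sqrt (f y))
    ((2 * Num.sqrt (f x))^-1 * pd i f x).
  move=> Ux; apply: is_derive_comp_dir; last exact/is_derive1_sqrt/f0.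
  by apply/derivableP; exact: CkOn_derivable cf Ux.
split; [exact: cS cf|split].
  by move=> i x Ux; have [] := dS i x Ux.
have IHk := IH (CkOnW _ _ _ cf).
have s0 x : U x -> 2 * Num.sqrt (f x) != 0.
  by move=> Ux; rewrite mulf_neq0 // gt_eqF // sqrtr_gt0 f0.
have IHV := CkOnV k U _ oU s0 (CkOnM _ _ _ _ oU (CkOn_cst k U 2 oU) IHk).
move=> i; apply: CkOn_congr (CkOnM _ _ _ _ oU IHV (CkOn_pd _ _ _ i cf)) => // y Uy.
by have [_ <-] := dS i y Uy.
Qed.

Lemma open_punct : open (@punct R d).
Proof. by apply: closed_openC; exact: accessible_closed_set1 (hausdorff_accessible (@norm_hausdorff _ _)) _. Qed.

Lemma punctE x : punct x <-> x != 0.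
Proof. by split=> [/eqP|/eqP]. Qed.

Lemma CkOn_enorm k : CkOn k (@punct R d) (@enorm R d).
Proof.
apply: CkOn_sqrt; first exact: open_punct.
  move=> x /punctE /enorm_gt0 h; by rewrite -enorm_sqr exprn_gt0.
apply: CkOn_sum; first exact: open_punct.
move=> i; apply: CkOn_congr (CkOnM _ _ _ _ open_punct (CkOn_coord k _ i open_punct) (CkOn_coord k _ i open_punct)).
  exact: open_punct.
by move=> y _; rewrite expr2.
Qed.

Lemma dirdM U f g e x : open U -> CkOn 1 U f -> CkOn 1 U g -> U x ->
  dird e (fun y => f y * g y) x = f x * dird e g x + dird e f x * g x.
Proof.
move=> oU cf cg Ux; rewrite /dird mulr_sumr mulr_suml -big_split /=.
by apply: eq_bigr => j _; rewrite (pdM 0 U) //; ring.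
Qed.

Lemma dirdD U f g e x : open U -> CkOn 1 U f -> CkOn 1 U g -> U x ->
  dird e (fun y => f y + g y) x = dird e f x + dird e g x.
Proof.
move=> oU cf cg Ux; rewrite /dird -big_split /=.
by apply: eq_bigr => j _; rewrite (pdD 0 U) //; ring.
Qed.

Lemma dirdE U f e x (a : R) : open U -> CkOn 1 U f -> U x -> is_derive x e f a ->
  dird e f x = a.
Proof.
move=> oU cf Ux [_ <-].
by have [_ <-] := strict_derive_is_derive _ _ _ _ (strict_derive_C1 U f x e oU cf Ux).
Qed.

Lemma dirdZl f e x (a : R) : dird (a *: e) f x = a * dird e f x.
Proof. by rewrite /dird mulr_sumr; apply: eq_bigr => j _; rewrite mxE mulrA. Qed.

(** The scaling identity is differentiated in the point, so differentiation lowers the degree of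
    homogeneity by one. *)
Lemma dird_homog (c : R -> R) f e x t : CkOn 1 (@punct R d) f -> x != 0 -> 0 < t ->
  (forall y s, y != 0 -> 0 < s -> f (s *: y) = c s * f y) ->
  t * dird e f (t *: x) = c t * dird e f x.
Proof.
move=> cf x0 t0 hf.
have tx0 : punct (t *: x) by apply/punctE; rewrite scaler_eq0 gt_eqF.
have px : punct x by apply/punctE.
rewrite -[LHS]dirdZl; apply: (dirdE _ f (t *: e) (t *: x) _ open_punct cf tx0).
apply: is_derive_of_line.
have : is_derive (0 : R) 1 (fun s : R => c t * f (x + s *: e)) (c t * dird e f x).
  have := is_derive_line_C1 _ f x e 0 open_punct cf.
  rewrite scale0r addr0 => /(_ px) h.
  apply: (is_derive_eq (is_derive_mul (fun=> c t) _ 0 _ _ (is_derive_cst (c t) (0 : R) 1) h)).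
  by rewrite mul0r addr0.
apply: near_eq_is_derive.
have : nbhs (0 : R) [set s | punct (x + s *: e)].
  have cx : {for (0 : R), continuous (fun s : R => x + s *: e)}.
    apply: (@continuousD _ _ _ (fun=> x) (fun s : R => s *: e)); first exact: cst_continuous.
    exact: scalel_continuous.
  apply: cx; rewrite scale0r addr0; apply: open_nbhs_nbhs; split=> //; exact: open_punct.
apply: filterS => s /punctE h.
by rewrite scalerA -[s * t]mulrC -scalerA -scalerDr hf.
Qed.

(** Euler's relation: the scaling identity is differentiated in the factor at 1, which moves the
    point along its own ray. *)
Lemma dird_euler (c : R -> R) (c' : R) f x : CkOn 1 (@punct R d) f -> x != 0 ->
  (forall s, 0 < s -> f (s *: x) = c s * f x) -> is_derive (1 : R) 1 c c' ->
  dird x f x = c' * f x.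
Proof.
move=> cf x0 hf dc.
have px : punct x by apply/punctE.
apply: (dirdE _ _ _ _ _ open_punct cf px).
apply: is_derive_of_line.
have : is_derive (0 : R) 1 (fun s : R => c (1 + s) * f x) (c' * f x).
  have dc1 : is_derive (0 : R) 1 (fun s : R => c (1 + s)) c'.
    have d1 : is_derive (0 : R) 1 (fun s : R => 1 + s) 1.
      by apply: (is_derive_eq (is_deriveD (is_derive_cst (1 : R) (0 : R) 1) (is_derive_id (0 : R) 1))); rewrite add0r.
    apply: (is_derive_eq (@is_derive1_comp _ c (fun s : R => 1 + s) 0 c' 1 _ d1)).
      by rewrite addr0.
    by rewrite mulr1.
  apply: (is_derive_eq (is_derive_mul _ (fun=> f x) 0 _ _ dc1 (is_derive_cst (f x) (0 : R) 1))).
  by rewrite mulr0 add0r.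
apply: near_eq_is_derive.
have : nbhs (0 : R) [set s | -1 < s] by apply: open_nbhs_nbhs; split; [exact: open_gt|rewrite /=; lra].
apply: filterS => s /= h.
rewrite -hf; last by lra.
by rewrite scalerDl scale1r.
Qed.

Definition hessm f x : 'M[R]_d := \matrix_(i, j) pd i (pd j f) x.

Lemma dird_hessm U f e e' x : open U -> CkOn 2 U f -> U x ->
  dird e (dird e' f) x = (e *m hessm f x *m e'^T) 0 0.
Proof.
move=> oU cf Ux; rewrite (dird_dird U) // mul_rV_mx_trE.
by apply: eq_bigr => i _; apply: eq_bigr => j _; rewrite mxE mulrAC.
Qed.

Lemma hessm_sym U f x : open U -> CkOn 2 U f -> U x -> (hessm f x)^T = hessm f x.
Proof.
by move=> oU cf Ux; apply/matrixP => i j; rewrite !mxE (pd_comm U).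
Qed.

End CkComposition.

(** * The 1-homogeneous extension *)

Section HomogeneousExtension.
Context {R : realType}.

Definition dotr d (x y : 'rV[R]_d) : R := (x *m y^T) 0 0.

Lemma dotrE d (x y : 'rV[R]_d) : dotr d x y = \sum_i x 0 i * y 0 i.
Proof. exact: mul_rV_trE. Qed.

Lemma dotrC d (x y : 'rV[R]_d) : dotr d x y = dotr d y x.
Proof. by rewrite !dotrE; apply: eq_bigr => i _; rewrite mulrC. Qed.

Lemma dotr_line d (x e y : 'rV[R]_d) (s : R) :
  dotr d (x + s *: e) y = dotr d x y + s * dotr d e y.
Proof.
rewrite !dotrE mulr_sumr -big_split /=.
by apply: eq_bigr => i _; rewrite !mxE; ring.
Qed.

Lemma enorm_dotr d (x : 'rV[R]_d) : enorm x = Num.sqrt (dotr d x x).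
Proof. by rewrite dotrE /enorm; congr Num.sqrt; apply: eq_bigr => i _; rewrite expr2. Qed.

Lemma dotr_unit d (x : 'rV[R]_d) : enorm x = 1 -> dotr d x x = 1.
Proof. by move=> /enorm1P; rewrite /dotr => ->; rewrite mxE. Qed.

Context {n : nat}.
Local Notation dot := (dotr n.+1).
Local Notation U := (@punct R n.+1).
Implicit Types (u f : 'rV[R]_n.+1 -> R) (x y e : 'rV[R]_n.+1) (E : 'M[R]_(n, n.+1)).

Definition hext u y := enorm y * ext u y.

Lemma sphere_neq0 x : sphere x -> x != 0.
Proof.
rewrite /sphere /= => x1; apply/eqP => x0; move: x1.
rewrite x0 enorm_dotr dotrE big1 => [|i _]; last by rewrite mxE mul0r.
by rewrite sqrtr0 => /eqP; rewrite eq_sym oner_eq0.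
Qed.

Lemma sphere_punct x : sphere x -> U x.
Proof. by move=> /sphere_neq0 /punctE. Qed.

Lemma ext_sphere u x : sphere x -> ext u x = u x.
Proof. by rewrite /sphere /ext /= => ->; rewrite invr1 scale1r. Qed.

Lemma hext_sphere u x : sphere x -> hext u x = u x.
Proof. by move=> Sx; rewrite /hext ext_sphere //; move: Sx; rewrite /sphere /= => ->; rewrite mul1r. Qed.

Lemma ext_homog u x s : 0 < s -> ext u (s *: x) = ext u x.
Proof.
move=> s0; rewrite /ext enormZ gtr0_norm // scalerA invfM mulrAC mulVf ?mul1r //.
by rewrite gt_eqF.
Qed.

Lemma hext_homog u x s : 0 < s -> hext u (s *: x) = s * hext u x.
Proof. by move=> s0; rewrite /hext ext_homog // enormZ gtr0_norm // mulrA. Qed.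

Lemma sphere_normalize x : x != 0 -> sphere ((enorm x)^-1 *: x).
Proof. exact: enorm_normalize. Qed.

Lemma CkOn_hext k u : CkOn k U (ext u) -> CkOn k U (hext u).
Proof. by move=> cu; apply: CkOnM => //; [exact: open_punct|exact: CkOn_enorm]. Qed.

Lemma CkOn_dot k e : CkOn k U (fun y => dot y e).
Proof.
apply: CkOn_congr (CkOn_sum k U n.+1 (fun i y => y 0 i * e 0 i) open_punct _); first exact: open_punct.
  by move=> y _; rewrite dotrE.
by move=> i; apply: CkOnM; [exact: open_punct|exact: CkOn_coord open_punct|exact: CkOn_cst open_punct].
Qed.

Lemma is_derive_affine (a b : R) (s : R) : is_derive s 1 (fun t : R => a + t * b) b.
Proof.
apply: (is_derive_eq (is_deriveD (is_derive_cst a s 1)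
  (is_derive_mul (fun t => t) (fun=> b) s _ _ (is_derive_id s 1) (is_derive_cst b s 1)))).
by rewrite add0r mulr0 add0r mul1r.
Qed.

Lemma dird_dot e e' x : U x -> dird e (fun y => dot y e') x = dot e e'.
Proof.
move=> Ux; apply: (dirdE _ _ _ _ _ open_punct (CkOn_dot 1 e') Ux).
apply: is_derive_of_line; under [fun t => _]funext do rewrite dotr_line.
exact: is_derive_affine.
Qed.

Lemma dird_enorm e x : U x -> dird e (@enorm R n.+1) x = dot x e / enorm x.
Proof.
move=> Ux; have r0 : 0 < enorm x by apply/enorm_gt0/punctE.
have := dirdM U (@enorm R n.+1) (@enorm R n.+1) e x open_punct (CkOn_enorm 1) (CkOn_enorm 1) Ux.
have -> : dird e (fun y => enorm y * enorm y) x = 2 * dot x e.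
  apply: (dirdE _ _ _ _ _ open_punct (CkOnM _ _ _ _ open_punct (CkOn_enorm 1) (CkOn_enorm 1)) Ux).
  apply: is_derive_of_line.
  have -> : (fun t : R => enorm (x + t *: e) * enorm (x + t *: e)) =
    (fun t => dot x x + t * (2 * dot x e + t * dot e e)).
    apply/funext => t; rewrite -expr2 enorm_sqr -dotrC.
    transitivity (dot (x + t *: e) (x + t *: e)).
      by rewrite dotrE; apply: eq_bigr => i _; rewrite expr2.
    by rewrite dotr_line ![dot _ (x + _)]dotrC !dotr_line [dot e x]dotrC; ring.
  apply: (is_derive_eq (is_deriveD (is_derive_cst (dot x x) (0 : R) 1)
    (is_derive_mul (fun t => t) _ 0 _ _ (is_derive_id (0 : R) 1) (is_derive_affine (2 * dot x e) (dot e e) 0)))).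
  ring.
move=> h; apply: (mulfI (lt0r_neq0 r0)); rewrite mulrCA mulfV ?gt_eqF // mulr1.
by rewrite [X in _ + X]mulrC in h; lra.
Qed.

Lemma dird_hext u e y : CkOn 1 U (ext u) -> U y ->
  dird e (hext u) y = dot y e * ((enorm y)^-1 * ext u y) + enorm y * dird e (ext u) y.
Proof.
move=> cu Uy; rewrite (dirdM U) //; [|exact: open_punct|exact: CkOn_enorm].
by rewrite dird_enorm //; ring.
Qed.

Lemma dird_ext_radial u x : CkOn 1 U (ext u) -> x != 0 -> dird x (ext u) x = 0.
Proof.
move=> cu x0; rewrite (dird_euler (fun=> 1) 0 (ext u) x cu x0); first exact: mul0r.
  by move=> s s0; rewrite ext_homog // mul1r.
Qed.

Lemma dird_hext_radial u x : CkOn 1 U (ext u) -> x != 0 -> dird x (hext u) x = hext u x.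
Proof.
move=> cu x0; rewrite (dird_euler id 1 (hext u) x (CkOn_hext 1 u cu) x0) ?mul1r //.
by move=> s s0; rewrite hext_homog.
Qed.

Lemma dird_hext_homog u e x s : CkOn 1 U (ext u) -> x != 0 -> 0 < s ->
  dird e (hext u) (s *: x) = dird e (hext u) x.
Proof.
move=> cu x0 s0.
have := dird_homog id (hext u) e x s (CkOn_hext 1 u cu) x0 s0 (fun y t _ t0 => hext_homog u y t t0).
by move=> /(mulfI (lt0r_neq0 s0)).
Qed.

Lemma dird2_hext_homog u e e' x s : CkOn 2 U (ext u) -> x != 0 -> 0 < s ->
  dird e (dird e' (hext u)) (s *: x) = s^-1 * dird e (dird e' (hext u)) x.
Proof.
move=> cu x0 s0.
have c1 : CkOn 1 U (dird e' (hext u)) by apply: CkOn_dird; [exact: open_punct|exact: CkOn_hext].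
have : s * dird e (dird e' (hext u)) (s *: x) = 1 * dird e (dird e' (hext u)) x.
  apply: (dird_homog (fun=> 1) _ e x s c1 x0 s0) => y t y0 t0.
  by rewrite mul1r dird_hext_homog //; apply: CkOnW.
by rewrite mul1r => <-; rewrite mulKf // gt_eqF.
Qed.

(** First derivatives of w have degree 0, so the Hessian of w annihilates the radial direction.
    Tilted frames and non-tangent test directions become harmless through this. *)
Lemma dird2_hext_radial u e x : CkOn 2 U (ext u) -> x != 0 ->
  dird x (dird e (hext u)) x = 0.
Proof.
move=> cu x0.
have c1 : CkOn 1 U (dird e (hext u)) by apply: CkOn_dird; [exact: open_punct|exact: CkOn_hext].
rewrite (dird_euler (fun=> 1) 0 _ x c1 x0); first exact: mul0r.
  by move=> s s0; rewrite dird_hext_homog ?mul1r //; apply: CkOnW.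
Qed.

Lemma dird3_hext_radial u e e' x : CkOn 3 U (ext u) -> x != 0 ->
  dird x (dird e (dird e' (hext u))) x = - dird e (dird e' (hext u)) x.
Proof.
move=> cu x0.
have c1 : CkOn 1 U (dird e (dird e' (hext u))).
  by do 2!(apply: CkOn_dird; first exact: open_punct); exact: CkOn_hext.
have dV : is_derive (1 : R) 1 (fun s : R => s^-1) (-1).
  apply: DeriveDef; first by apply: derivableV => //; rewrite oner_eq0.
  rewrite (deriveV (f := id)) ?oner_eq0 // derive_id expr1n invr1.
  by rewrite -[_ *: _]/(_ * _) mulr1.
rewrite (dird_euler (fun s => s^-1) (-1) _ x c1 x0 _ dV) ?mulN1r //.
by move=> s s0; rewrite dird2_hext_homog //; apply: CkOnW.
Qed.

(** Product rule for w = |y| times the 0-homogeneous extension: for tangent directions the mixed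
    terms vanish, and u times the scalar product comes from the second derivative of |y|. *)
Lemma dird2_hext u e e' x : CkOn 2 U (ext u) -> sphere x ->
  dot x e = 0 -> dot x e' = 0 ->
  dird e (dird e' (hext u)) x = dird e (dird e' (ext u)) x + u x * dot e e'.
Proof.
move=> cu Sx xe xe'; have Ux := sphere_punct x Sx; have oU := @open_punct R n.+1.
have x1 : enorm x = 1 := Sx.
have ciV : CkOn 1 U (fun y => (enorm y)^-1).
  apply: CkOnV => //; last exact: CkOn_enorm.
  by move=> y /punctE /enorm_gt0 h; rewrite gt_eqF.
have c1 : CkOn 1 U (ext u) by apply: CkOnW.
have c1e : CkOn 1 U (dird e' (ext u)) by apply: CkOn_dird.
have cA : CkOn 1 U (fun y => (enorm y)^-1 * ext u y) by apply: CkOnM.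
rewrite (dird_congr U _ (fun y => dot y e' * ((enorm y)^-1 * ext u y) + enorm y * dird e' (ext u) y) e x oU Ux); last first.
  by move=> y Uy; exact: dird_hext.
have cB := CkOnM 1 U _ _ oU (CkOn_dot 1 e') cA.
have cC := CkOnM 1 U _ _ oU (CkOn_enorm 1) c1e.
rewrite (dirdD U _ _ e x oU cB cC Ux) (dirdM U _ _ e x oU (CkOn_dot 1 e') cA Ux).
rewrite (dirdM U _ _ e x oU (CkOn_enorm 1) c1e Ux).
rewrite dird_dot // dird_enorm // xe xe' x1 ext_sphere // invr1.
by ring.
Qed.

(** Stacking [x] on [E] gives a square matrix with orthonormal rows; its columns are then
    orthonormal too. *)
Lemma frame_complete x E : sphere x -> frame x E -> E^T *m E + x^T *m x = 1%:M.
Proof.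
move=> /enorm1P xx [EE Ex].
have xE : x *m E^T = 0 by rewrite -[x]trmxK -trmx_mul Ex trmx0.
pose M : 'M[R]_(1 + n) := col_mx x E.
have : M *m M^T = 1%:M.
  by rewrite /M tr_col_mx mul_col_row xx xE Ex EE -scalar_mx_block.
move=> /mulmx1C; rewrite /M tr_col_mx mul_row_col addrC => h; exact: h.
Qed.

Lemma frame_parseval x E (a b : 'rV[R]_n.+1) : sphere x -> frame x E ->
  dot a b = \sum_i dot (row i E) a * dot (row i E) b + dot x a * dot x b.
Proof.
move=> Sx fE; rewrite [LHS]/dotr -[in LHS](mulmx1 a) -(frame_complete x E Sx fE).
rewrite mulmxDr mulmxDl mxE; congr (_ + _).
  rewrite mulmxA -mulmxA mxE; apply: eq_bigr => i _; congr (_ * _).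
    by rewrite dotrE [LHS]mxE; apply: eq_bigr => j _; rewrite !mxE mulrC.
  by rewrite dotrE [LHS]mxE; apply: eq_bigr => j _; rewrite !mxE.
rewrite mulmxA -mulmxA mxE big_ord1; congr (_ * _).
by rewrite -/(dotr n.+1 a x) dotrC.
Qed.

Lemma frame_row x E i j : frame x E -> dot (row i E) (row j E) = (i == j)%:R.
Proof.
move=> [EE _]; have := congr1 (fun M : 'M[R]_n => M i j) EE; rewrite /= [RHS]mxE => <-.
by rewrite dotrE [RHS]mxE; apply: eq_bigr => l _; rewrite !mxE.
Qed.

Lemma frame_row_orth x E i : frame x E -> dot x (row i E) = 0.
Proof.
move=> [_ Ex]; rewrite dotrC /dotr -row_mul Ex.
by rewrite !mxE.
Qed.

Lemma hessm_frame m f x (E : 'M[R]_(m, n.+1)) i j : U x -> CkOn 2 U f ->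
  (E *m hessm f x *m E^T) i j = dird (row i E) (dird (row j E) f) x.
Proof.
move=> Ux cf; rewrite (dird_hessm U f _ _ x open_punct cf Ux).
rewrite mul_rV_trE [LHS]mxE -row_mul; apply: eq_bigr => l _.
by congr (_ * _); rewrite ?mxE // [RHS]mxE.
Qed.

Lemma cov_hess_hext u x E : CkOn 2 U (ext u) -> sphere x -> frame x E ->
  cov_hess u x E + (u x)%:M = E *m hessm (hext u) x *m E^T.
Proof.
move=> cu Sx fE; have Ux := sphere_punct x Sx.
apply/matrixP => i j; apply: etrans (esym (hessm_frame _ _ x E i j Ux (CkOn_hext 2 u cu))).
rewrite dird2_hext // ?(frame_row_orth x E) // (frame_row x E) //.
rewrite [LHS]mxE [X in _ + X]mxE; congr (_ + _); first exact: hessm_frame.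
by case: eqP; rewrite ?mulr1 ?mulr0.
Qed.

Definition gradsq_hext u y := \sum_j (pd j (hext u) y) ^+ 2.

Lemma dird_grad f e y : dird e f y = dot e (\row_j pd j f y).
Proof. by rewrite dotrE; apply: eq_bigr => j _; rewrite mxE. Qed.

Lemma gradsq_frame f x E y : sphere x -> frame x E ->
  \sum_j (pd j f y) ^+ 2 = \sum_i dird (row i E) f y ^+ 2 + dird x f y ^+ 2.
Proof.
move=> Sx fE.
transitivity (dot (\row_j pd j f y) (\row_j pd j f y)).
  by rewrite dotrE; apply: eq_bigr => j _; rewrite mxE expr2.
rewrite (frame_parseval x E _ _ Sx fE) -expr2 -dird_grad; congr (_ + _).
by apply: eq_bigr => i _; rewrite -dird_grad expr2.
Qed.

Lemma gradsq_hextE u x : CkOn 1 U (ext u) -> sphere x ->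
  gradsq_hext u x = u x ^+ 2 + grad_sq u x.
Proof.
move=> cu Sx; have [E fE] := exists_frame n x Sx; have Ux := sphere_punct x Sx.
have x1 : enorm x = 1 := Sx.
rewrite /gradsq_hext (gradsq_frame _ x E) // dird_hext_radial ?sphere_neq0 // hext_sphere //.
rewrite addrC; congr (_ + _).
rewrite /grad_sq (eq_bigr (fun j => pd j (ext u) x ^+ 2)); last by move=> j _; rewrite mxE.
rewrite (gradsq_frame _ x E) // dird_ext_radial ?sphere_neq0 // expr0n addr0.
apply: eq_bigr => i _; rewrite dird_hext // (frame_row_orth x E) // x1.
by rewrite mul0r add0r mul1r.
Qed.

Lemma gradsq_hext_homog u x s : CkOn 1 U (ext u) -> x != 0 -> 0 < s ->
  gradsq_hext u (s *: x) = gradsq_hext u x.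
Proof.
move=> cu x0 s0; apply: eq_bigr => j _; congr (_ ^+ 2).
have pE y : pd j (hext u) y = dird (ev R j) (hext u) y.
  rewrite /dird (bigD1 j) //= big1 ?addr0 ?mxE ?eqxx ?mul1r // => l lj.
  by rewrite !mxE (negPf lj) mul0r.
by rewrite !pE dird_hext_homog.
Qed.

Lemma enorm_line x e s : sphere x -> enorm e = 1 -> dot x e = 0 ->
  enorm (x + s *: e) = Num.sqrt (1 + s ^+ 2).
Proof.
move=> Sx e1 xe; rewrite enorm_dotr dotr_line ![dot _ (x + _)]dotrC !dotr_line.
rewrite [dot e x]dotrC xe !dotr_unit //; congr Num.sqrt; ring.
Qed.

Lemma line_neq0 x e s : sphere x -> dot x e = 0 -> x + s *: e != 0.
Proof.
move=> Sx xe; apply/eqP => h.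
have := congr1 (fun y => dot y x) h.
rewrite dotr_line [dot e x]dotrC xe mulr0 addr0 dotr_unit // dotrE big1.
  by move/eqP; rewrite oner_eq0.
by move=> i _; rewrite mxE mul0r.
Qed.

End HomogeneousExtension.

(** * Supporting functionals along lines *)

Lemma sum_weight_split {R : realType} {n : nat} (a : 'I_n) (G B : 'I_n -> R) (r t : R) :
  \sum_i G i * (r * ((if i == a then t else 1) * B i)) =
  r * (\sum_(i | i != a) G i * B i + t * (G a * B a)).
Proof.
rewrite (bigD1 a) //= eqxx addrC mulrDr mulr_sumr; congr (_ + _); last by ring.
by apply: eq_bigr => i /negPf ->; ring.
Qed.

Record admissible_solution {R : realType} {n : nat} (P k l : nat) (p q : R)
    (u phi : 'rV[R]_(n.+1) -> R) : Prop := AdmissibleSolution {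
  sol_C2phi : Ck_sphere 2 phi;
  sol_phi_gt0 : forall x, sphere x -> 0 < phi x;
  sol_C4u : Ck_sphere 4 u;
  sol_u_gt0 : forall x, sphere x -> 0 < u x;
  sol_admissible : admissible P k u;
  sol_eq : forall x E lam, sphere x -> frame x E ->
    eigs (cov_hess u x E + (u x)%:M) lam ->
    sigmaL P lam k / sigmaL P lam l =
    powR (u x) (p - 1) * powR (u x ^+ 2 + grad_sq u x) ((k.+1%:R - q) / 2) * phi x }.

Section Solution.
Context {R : realType} {n : nat} (P k l : nat) (p q : R).
Context (u phi : 'rV[R]_(n.+1) -> R) (sol : admissible_solution P k l p q u phi).
Local Notation dot := (dotr n.+1).
Local Notation U := (@punct R n.+1).
Implicit Types (x y e : 'rV[R]_n.+1) (E : 'M[R]_(n, n.+1)) (lam : 'rV[R]_n).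

(** The 0-homogeneous extension of the logarithm of the right side. Subtracting ln |y| turns w back
    into u along rays while keeping w, whose jets are known, as the basic function. *)
Definition lnrhs y := (p - 1) * (ln (hext u y) - ln (enorm y)) +
  (k.+1%:R - q) / 2 * ln (gradsq_hext u y) + ln (ext phi y).

Lemma C4_ext : CkOn 4 U (ext u). Proof. exact: sol_C4u sol. Qed.
Lemma C3_ext : CkOn 3 U (ext u). Proof. exact: CkOnW C4_ext. Qed.
Lemma C2_ext : CkOn 2 U (ext u). Proof. exact: CkOnW C3_ext. Qed.
Lemma C1_ext : CkOn 1 U (ext u). Proof. exact: CkOnW C2_ext. Qed.

Lemma ext_u_gt0 y : y != 0 -> 0 < ext u y.
Proof. by move=> y0; apply: (sol_u_gt0 _ _ _ _ _ _ _ sol); apply: sphere_normalize. Qed.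

Lemma ext_phi_gt0 y : y != 0 -> 0 < ext phi y.
Proof. by move=> y0; apply: (sol_phi_gt0 _ _ _ _ _ _ _ sol); apply: sphere_normalize. Qed.

Lemma hext_gt0 y : y != 0 -> 0 < hext u y.
Proof. by move=> y0; rewrite mulr_gt0 ?ext_u_gt0 // enorm_gt0. Qed.

Lemma grad_sq_ge0 x : 0 <= grad_sq u x.
Proof. by apply: sumr_ge0 => j _; apply: sqr_ge0. Qed.

Lemma normalizeK y : y != 0 -> y = enorm y *: ((enorm y)^-1 *: y).
Proof. by move=> /enorm_gt0 h; rewrite scalerA mulfV ?scale1r // gt_eqF. Qed.

Lemma gradsq_hext_gt0 y : y != 0 -> 0 < gradsq_hext u y.
Proof.
move=> y0; rewrite (normalizeK y y0) gradsq_hext_homog ?enorm_gt0 //.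
- rewrite gradsq_hextE; [|exact: C1_ext|exact: sphere_normalize].
  rewrite ltr_pwDl ?grad_sq_ge0 // exprn_gt0 //.
  by apply: (sol_u_gt0 _ _ _ _ _ _ _ sol); apply: sphere_normalize.
- exact: C1_ext.
- exact/sphere_neq0/sphere_normalize.
Qed.

Lemma lnrhs_sphere x : sphere x ->
  lnrhs x = ln (powR (u x) (p - 1) * powR (u x ^+ 2 + grad_sq u x) ((k.+1%:R - q) / 2) * phi x).
Proof.
move=> Sx; have u0 := sol_u_gt0 _ _ _ _ _ _ _ sol x Sx; have f0 := sol_phi_gt0 _ _ _ _ _ _ _ sol x Sx.
have z0 : 0 < u x ^+ 2 + grad_sq u x by rewrite ltr_pwDl ?grad_sq_ge0 // exprn_gt0.
rewrite lnM ?posrE ?mulr_gt0 ?powR_gt0 // lnM ?posrE ?powR_gt0 // !ln_powR.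
rewrite /lnrhs hext_sphere // gradsq_hextE //; last exact: C1_ext.
by rewrite ext_sphere // (_ : enorm x = 1) // ln1 subr0.
Qed.

Lemma lnrhs_homog y (s : R) : y != 0 -> 0 < s -> lnrhs (s *: y) = lnrhs y.
Proof.
move=> y0 s0; rewrite /lnrhs hext_homog // gradsq_hext_homog //; last exact: C1_ext.
rewrite ext_homog // enormZ gtr0_norm // !lnM ?posrE ?hext_gt0 ?ext_u_gt0 ?enorm_gt0 //.
by congr (_ * _ + _ + _); ring.
Qed.

Lemma eigs_of_diag x E lam : sphere x -> frame x E ->
  E *m hessm (hext u) x *m E^T = diag_mx lam ->
  eigs (cov_hess u x E + (u x)%:M) (fun i => lam 0 i).
Proof.
move=> Sx fE d; rewrite cov_hess_hext //; last exact: C2_ext.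
by rewrite d; exact: eigs_diag.
Qed.

Lemma in_Gamma_diag x E lam : sphere x -> frame x E ->
  E *m hessm (hext u) x *m E^T = diag_mx lam -> in_Gamma P k (fun i => lam 0 i).
Proof.
move=> Sx fE d; apply: (sol_admissible _ _ _ _ _ _ _ sol x E) => //; exact: eigs_of_diag.
Qed.

Lemma lnQ_diag x E lam : sphere x -> frame x E ->
  E *m hessm (hext u) x *m E^T = diag_mx lam ->
  ln (sigmaL P (fun i => lam 0 i) k / sigmaL P (fun i => lam 0 i) l) = lnrhs x.
Proof.
move=> Sx fE d; rewrite lnrhs_sphere //; congr ln.
by apply: (sol_eq _ _ _ _ _ _ _ sol x E) => //; exact: eigs_of_diag.
Qed.

Lemma hessm_hext_sym x : sphere x -> (hessm (hext u) x)^T = hessm (hext u) x.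
Proof.
move=> Sx; apply: (hessm_sym U); [exact: open_punct|exact/CkOn_hext/C2_ext|exact: sphere_punct].
Qed.

Lemma frame_rotate x E (O : 'M[R]_n) : frame x E -> O *m O^T = 1%:M -> frame x (O *m E).
Proof.
move=> [EE Ex] OO; split; last by rewrite -mulmxA Ex mulmx0.
by rewrite trmx_mul mulmxA -(mulmxA O) EE mulmx1.
Qed.

Lemma spectral_frame x E : sphere x -> frame x E -> exists O : 'M[R]_n, exists lam,
  [/\ O *m O^T = 1%:M, frame x (O *m E)
    & (O *m E) *m hessm (hext u) x *m (O *m E)^T = diag_mx lam].
Proof.
move=> Sx fE.
have [|O [lam [OO D]]] := spectral_theorem n (E *m hessm (hext u) x *m E^T).
  by rewrite !trmx_mul trmxK hessm_hext_sym // mulmxA.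
exists O, lam; split => //; first exact: frame_rotate.
by rewrite trmx_mul -D !mulmxA.
Qed.

(* By Schur's theorem the diagonal of a symmetric matrix is a doubly stochastic
   average of its spectrum, so a supporting functional for eigenvalues also
   supports along diagonals. *)
Lemma support_diag x E (c : R) (G : 'I_n -> R) : sphere x -> frame x E ->
  (forall nu : 'I_n -> R, in_Gamma P k nu ->
    ln (sigmaL P nu k / sigmaL P nu l) <= c + \sum_i G i * nu i) ->
  lnrhs x <= c + \sum_i G i * dird (row i E) (dird (row i E) (hext u)) x.
Proof.
move=> Sx fE H.
have [ O [nu [OO fO D]]] := spectral_frame x E Sx fE.
have OtO : O^T *m O = 1%:M by apply: mulmx1C.
have bE : E *m hessm (hext u) x *m E^T = O^T *m diag_mx nu *m O.
  by rewrite -D trmx_mul !mulmxA OtO mul1mx -!mulmxA OtO mulmx1.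
have bii i : dird (row i E) (dird (row i E) (hext u)) x = \sum_j (O j i) ^+ 2 * nu 0 j.
  rewrite -hessm_frame; [|exact: sphere_punct|exact/CkOn_hext/C2_ext].
  rewrite bE mxE; apply: eq_bigr => j _.
  by rewrite mul_mx_diag [in LHS]mxE [in LHS]mxE expr2 mulrAC.
have Or i : \sum_j (O j i) ^+ 2 = 1.
  have := congr1 (fun M : 'M[R]_n => M i i) OtO; rewrite /= [RHS]mxE eqxx mulr1n => <-.
  by rewrite mxE; apply: eq_bigr => j _; rewrite mxE expr2.
have Oc i : \sum_j (O i j) ^+ 2 = 1.
  have := congr1 (fun M : 'M[R]_n => M i i) OO; rewrite /= [RHS]mxE eqxx mulr1n => <-.
  by rewrite mxE; apply: eq_bigr => j _; rewrite mxE expr2.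
have [s Hs] := doubly_stochastic_rearrangement n (fun i j => (O j i) ^+ 2) G (fun i => nu 0 i)
  (fun i j => sqr_ge0 _) Or Oc.
have gn := in_Gamma_diag x _ nu Sx fO D.
have := H (fun i => nu 0 (s i)) _.
rewrite !(sigmaL_perm n P (fun i => nu 0 i) s) (lnQ_diag x _ nu Sx fO D) => h.
apply: le_trans (h _) _.
  by move=> j jk; rewrite (sigmaL_perm n P (fun i => nu 0 i) s); exact: gn.
rewrite lerD2l (le_trans Hs) // le_eqVlt; apply/orP; left; apply/eqP.
by apply: eq_bigr => i _; rewrite bii.
Qed.

(** A frame at the normalized point of y = x + s e_a: only the vector of index [a] is tilted, to
    (e_a - s x) / r. It is written as r e_a minus a multiple of y because the Hessian at y
    annihilates y. *)
Definition line_frame x E (a : 'I_n) (s : R) : 'M[R]_(n, n.+1) :=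
  let r := Num.sqrt (1 + s ^+ 2) in
  \matrix_(i < n) (if i == a then r *: row a E - (s / r) *: (x + s *: row a E) else row i E).

(** The inequality along diagonals is used at z = y / r in the tilted frame and pulled back to y
    with the original directions. The Hessian has degree -1, whence the factor r; the tilted
    direction acts as r e_a, whence r^2 = 1 + s^2 on the term of index [a]. *)
Lemma support_line x E a s (c : R) (G : 'I_n -> R) : sphere x -> frame x E ->
  (forall nu : 'I_n -> R, in_Gamma P k nu ->
    ln (sigmaL P nu k / sigmaL P nu l) <= c + \sum_i G i * nu i) ->
  forall y r, y = x + s *: row a E -> r = Num.sqrt (1 + s ^+ 2) ->
  lnrhs y <= c + r * (\sum_(i | i != a) G i * dird (row i E) (dird (row i E) (hext u)) y
     + (1 + s ^+ 2) * (G a * dird (row a E) (dird (row a E) (hext u)) y)).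
Proof.
move=> Sx fE H y r yE rE.
have r2 : r ^+ 2 = 1 + s ^+ 2 by rewrite rE sqr_sqrtr // addr_ge0 ?sqr_ge0.
have r0 : 0 < r by rewrite rE sqrtr_gt0 ltr_pwDl // sqr_ge0.
have rn0 : r != 0 by rewrite gt_eqF.
have xx : dot x x = 1 by apply: dotr_unit.
have xE i : dot x (row i E) = 0 by apply: frame_row_orth fE.
have EE i j : dot (row i E) (row j E) = (i == j)%:R by apply: frame_row fE.
have e1 : enorm (row a E) = 1 by rewrite enorm_dotr EE eqxx sqrtr1.
have y0 : y != 0 by rewrite yE; apply: line_neq0.
have ny : enorm y = r by rewrite yE rE; apply: enorm_line.
pose z := r^-1 *: y.
have Sz : sphere z by rewrite /z -ny; apply: sphere_normalize.
pose F := line_frame x E a s.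
have rowF i : row i F = if i == a then r *: row a E - s *: z else row i E.
  rewrite rowK -rE -yE; case: ifP => // _; congr (_ - _).
  by rewrite /z scalerA.
have dzE i : dot z (row i E) = r^-1 * (s * (a == i)%:R).
  have := dotr_line n.+1 0 y (row i E) r^-1; rewrite add0r -/z => ->.
  have -> : dot 0 (row i E) = 0 by rewrite dotrE big1 // => j _; rewrite mxE mul0r.
  by rewrite add0r yE dotr_line xE EE add0r.
have zz : dot z z = 1 by apply: dotr_unit.
have dotBr (a1 b1 : R) e f e' : dot e' (a1 *: e - b1 *: f) = a1 * dot e' e - b1 * dot e' f.
  rewrite !dotrE !mulr_sumr -sumrB; apply: eq_bigr => j _; rewrite !mxE; ring.
have dotBl (a1 b1 : R) e f e' : dot (a1 *: e - b1 *: f) e' = a1 * dot e e' - b1 * dot f e'.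
  by rewrite dotrC dotBr ![dot e' _]dotrC.
have fF : frame z F.
  split; apply/matrixP => i j.
    have -> : (F *m F^T) i j = dot (row i F) (row j F).
      by rewrite dotrE mxE; apply: eq_bigr => m _; rewrite !mxE.
    have aiE i' : (a == i') = (i' == a) by rewrite eq_sym.
    rewrite !rowF [RHS]mxE; have [ia|ia] := boolP (i == a); have [ja|ja] := boolP (j == a).
    - rewrite dotBl !dotBr EE zz [dot (row a E) z]dotrC !dzE (eqP ia) (eqP ja) !eqxx /= mulr1 mulr1n.
      by transitivity (r ^+ 2 - s ^+ 2); [field|rewrite r2; ring].
    - rewrite dotBl EE dzE aiE (negPf ja) (eqP ia) aiE (negPf ja) /=; ring.
    - rewrite dotBr EE [dot _ z]dotrC dzE aiE (negPf ia) (eqP ja) (negPf ia) /=; ring.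
    - by rewrite EE; case: eqP.
  have -> : (F *m z^T) i j = dot (row i F) z.
    by rewrite dotrE mxE; apply: eq_bigr => m _; rewrite !mxE ord1.
  rewrite rowF mxE; have [ia|ia] := boolP (i == a).
    rewrite dotBl zz [dot (row a E) z]dotrC dzE eqxx /= mulr1n; by field.
  by rewrite dotrC dzE eq_sym (negPf ia) /=; ring.
have Uz := sphere_punct z Sz.
have D2 e e' : dird e (dird e' (hext u)) z = r * dird e (dird e' (hext u)) y.
  by rewrite /z dird2_hext_homog ?invr_gt0 ?invrK //; exact: C2_ext.
have cw : CkOn 2 U (hext u) by exact/CkOn_hext/C2_ext.
have lz : lnrhs y = lnrhs z by rewrite /z lnrhs_homog ?invr_gt0.
clearbody z.
have DF : dird (row a F) (dird (row a F) (hext u)) z =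
   (1 + s ^+ 2) * dird (row a E) (dird (row a E) (hext u)) z.
  have Hz e : (z *m hessm (hext u) z *m e^T) 0 0 = 0.
    rewrite -(dird_hessm U) //; last exact: open_punct.
    by apply: dird2_hext_radial; [exact: C2_ext|exact: sphere_neq0].
  rewrite !(dird_hessm U) //; try exact: open_punct.
  rewrite rowF eqxx; set e := row a E; set h := hessm _ z in Hz *.
  have hS : h^T = h by apply: hessm_hext_sym.
  have DE (A1 B1 : 'M[R]_1) : (A1 - B1) 0 0 = A1 0 0 - B1 0 0 by rewrite !mxE.
  have ZE (a1 : R) (A1 : 'M[R]_1) : (a1 *: A1) 0 0 = a1 * A1 0 0 by rewrite mxE.
  rewrite mulmxBl -!scalemxAl mulmxBl DE -!scalemxAl !ZE Hz mulr0 subr0.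
  rewrite [(_ - _)^T]linearB /= [(r *: e)^T]linearZ /= [(s *: z)^T]linearZ /=.
  rewrite mulmxBr DE -!scalemxAr !ZE (trmx_quad _ h e z hS) Hz mulr0 subr0.
  by rewrite mulrA -expr2 r2.
have DFi i : dird (row i F) (dird (row i F) (hext u)) z =
    r * ((if i == a then 1 + s ^+ 2 else 1) * dird (row i E) (dird (row i E) (hext u)) y).
  have [/eqP ->|ia] := boolP (i == a).
    by apply: (etrans DF); rewrite D2 mulrCA.
  by rewrite rowF (negPf ia) mul1r; exact: D2.
rewrite lz; apply: le_trans (support_diag z F c G Sz fF H) _; rewrite lerD2l.
rewrite -(sum_weight_split a G (fun i => dird (row i E) (dird (row i E) (hext u)) y)).
by rewrite le_eqVlt; apply/orP; left; apply/eqP/eq_bigr => i _; congr (_ * _); exact: DFi.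
Qed.

End Solution.

(** * Absorption of error terms *)

Section Absorption.
Context {R : realType}.

Lemma ler_normM (a b A B : R) : `|a| <= A -> `|b| <= B -> `|a * b| <= A * B.
Proof. by move=> h1 h2; rewrite normrM ler_pM. Qed.

Lemma ler_norm_addn (a b A B : R) : `|a| <= A -> `|b| <= B -> `|a + b| <= A + B.
Proof. by move=> h1 h2; apply: le_trans (ler_normD _ _) _; apply: lerD. Qed.

Lemma ler_norm_sum_const n (f : 'I_n -> R) (B : R) : (forall i, `|f i| <= B) ->
  `|\sum_i f i| <= n%:R * B.
Proof.
move=> h; apply: le_trans (ler_norm_sum _ _ _) _.
apply: (@le_trans _ _ (\sum_(i < n) B)); first by apply: ler_sum => i _.
by rewrite sumr_const card_ord mulr_natl.
Qed.

(** Times X >= 1, where X bounds the eigenvalues, it bounds a first derivative of the logarithm of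
    the right side. *)
Definition grad_const (pp be K K2 iu im : R) :=
  `|pp| * (K * iu) + `|be| * (2 * K * iu ^+ 2) + K2 * im.

(** It collects the coefficients of X^2 and of A X over all error terms; it contains no A, so that A
    can be chosen from it. *)
Definition quad_const (n : nat) (pp be K K2 iu im d : R) :=
  `|pp| * (iu + (K * iu) ^+ 2 + 1)
  + `|be| * (2 * (1 + n%:R * K ^+ 2 + K) * iu ^+ 2 + (2 * K * iu ^+ 2) ^+ 2)
  + K2 * im + (K2 * im) ^+ 2 + d + n%:R * K * grad_const pp be K K2 iu im + K * d + 1.

Lemma quad_const_gt0 n pp be K K2 iu im d : 0 <= K -> 0 <= K2 -> 0 <= iu -> 0 <= im ->
  0 <= d -> 0 < quad_const n pp be K K2 iu im d.
Proof.
move=> K0 K20 iu0 im0 d0.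
by rewrite ltr_wpDl // !(addr_ge0, mulr_ge0, sqr_ge0, exprn_ge0, normr_ge0, ler0n, ler01).
Qed.

(* [lam], [y] are the eigenvalues of the Hessian and the gradient of the
   1-homogeneous extension in an eigenframe, [T i j] = w_iij, [Q i] = w_11ii. *)
Lemma absorb n (i1 : 'I_n) (lam y G Q fa : 'I_n -> R) (T : 'I_n -> 'I_n -> R)
    (A c c0 K K2 iu im pp be d w wi zi fi f11 : R) :
  0 < c -> 0 < c0 -> 0 <= K -> 0 <= K2 -> 0 <= d ->
  A = 2 * quad_const n pp be K K2 iu im d / (c * c0) ->
  (forall i, 0 <= G i) -> (forall i, c * \sum_j G j <= G i) -> c0 <= \sum_j G j ->
  (forall i, `|y i| <= K) -> `|w| <= K -> (forall i, `|fa i| <= K2) -> `|f11| <= K2 ->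
  `|wi| <= iu -> `|zi| <= iu ^+ 2 -> `|fi| <= im ->
  \sum_i G i * lam i = d -> 0 < lam i1 ->
  (forall i, T i1 i = - (A * (y i * lam i))) ->
  (forall i, lam i1 + Q i + A * (lam i ^+ 2 + \sum_j y j * T i j - w * lam i) <= 0) ->
  (forall a, \sum_i G i * T i a =
     pp * (y a * wi) + be * (2 * (y a * lam a) * zi) + fa a * fi) ->
  pp * (lam i1 * wi - (y i1 * wi) ^+ 2) - pp
  + be * (2 * (lam i1 ^+ 2 + \sum_j y j * T i1 j - w * lam i1) * zi
          - (2 * (y i1 * lam i1) * zi) ^+ 2)
  + (f11 * fi - (fa i1 * fi) ^+ 2)
    <= \sum_i G i * Q i + \sum_i G i * lam i + 2 * (G i1 * lam i1) ->
  lam i1 <= 1 + 2 * (quad_const n pp be K K2 iu im d * A / c0 + 2) / (A * c).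
Proof.
move=> cp c0p K0 K20 d0 AE G0 Gc c0S yK wK faK f11K wiK ziK fiK Gd l1 hT hQ hG1 hG2.
have iu0 : 0 <= iu by apply: le_trans (normr_ge0 wi) wiK.
have im0 : 0 <= im by apply: le_trans (normr_ge0 fi) fiK.
set C3 := quad_const n pp be K K2 iu im d in AE *.
have C30 : 0 < C3 by apply: quad_const_gt0.
have A0 : 0 < A by rewrite AE divr_gt0 ?mulr_gt0.
set S := \sum_j G j in Gc c0S *.
have S0 : 0 < S by apply: lt_le_trans c0p c0S.
(* X is the largest eigenvalue in modulus. Once X >= 1, constant and linear errors are dominated by
   X^2. *)
pose i0 := [arg max_(i > i1) `|lam i|]%O.
have [X XE] : exists X, X = `|lam i0| by exists `|lam i0|.
have lX i : `|lam i| <= X.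
  by rewrite XE /i0; case: arg_maxP => // j _ h; apply: h.
have [X1|X1] := ltP X 1.
  have := ler_norm (lam i1); have := lX i1.
  have : 0 <= 2 * (C3 * A / c0 + 2) / (A * c).
    by rewrite divr_ge0 ?mulr_ge0 ?addr_ge0 ?divr_ge0 ?mulr_ge0 ?ltW.
  lra.
have X0 : 0 <= X by lra.
have XX : X <= X ^+ 2 by rewrite expr2 ler_peMr.
(* The second order conditions at the maximum are summed against G; the third derivatives from
   |Dw|^2 appear as \sum_i G_i w_iij and are replaced by the differentiated equation. *)
have sumQ : S * lam i1 + \sum_i G i * Q i + A * (\sum_i G i * lam i ^+ 2
   + \sum_a y a * (pp * (y a * wi) + be * (2 * (y a * lam a) * zi) + fa a * fi) - w * d) <= 0.
  have -> : \sum_a y a * (pp * (y a * wi) + be * (2 * (y a * lam a) * zi) + fa a * fi) =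
      \sum_i G i * \sum_j y j * T i j.
    under eq_bigr => a _ do rewrite -hG1 mulr_sumr.
    rewrite exchange_big /=; apply: eq_bigr => i _; rewrite mulr_sumr.
    by apply: eq_bigr => j _; ring.
  rewrite -Gd mulr_suml [w * _]mulr_sumr -!big_split /= -sumrB mulr_sumr -big_split /=.
  apply: sumr_le0 => i _.
  have := mulr_ge0_le0 (G0 i) (hQ i).
  by move: (\sum_j y j * T i j) => t h; apply: le_trans h; rewrite le_eqVlt; apply/orP; left; apply/eqP; ring.
(* Comparability of the G_i: the index of the largest eigenvalue carries at least the fraction c of
   the total weight, wherever it lies. *)
have B1 : c * S * X ^+ 2 <= \sum_i G i * lam i ^+ 2.
  rewrite (bigD1 i0) //= -[leLHS]addr0 lerD //; last first.
    by apply: sumr_ge0 => i _; rewrite mulr_ge0 // sqr_ge0.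
  by rewrite XE real_normK ?num_real // ler_wpM2r ?sqr_ge0.
have B2 : `|\sum_a y a * (pp * (y a * wi) + be * (2 * (y a * lam a) * zi) + fa a * fi)| <=
    n%:R * (K * (grad_const pp be K K2 iu im * X)).
  apply: ler_norm_sum_const => a; apply: ler_normM => //.
  apply: (@le_trans _ _ (`|pp| * (K * iu) + `|be| * (2 * (K * X) * iu ^+ 2) + K2 * im)).
    apply: ler_norm_addn; last exact: ler_normM.
    apply: ler_norm_addn; first by apply: ler_normM => //; apply: ler_normM.
    apply: ler_normM => //; apply: ler_normM => //; apply: ler_normM.
      by rewrite ger0_norm.
    exact: ler_normM.
  have h1 : `|pp| * (K * iu) <= `|pp| * (K * iu) * X.
    by rewrite ler_peMr // !mulr_ge0.
  have h2 : K2 * im <= K2 * im * X by rewrite ler_peMr // mulr_ge0.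
  rewrite /grad_const; lra.
(* The third derivatives w_11j equal -A y_j lam_j at the maximum, so this term is only linear in X,
   though with the factor A. *)
have B3 : `|\sum_j y j * T i1 j| <= n%:R * (K * (A * (K * X))).
  apply: ler_norm_sum_const => j; apply: ler_normM => //; rewrite hT normrN.
  by apply: ler_normM; [rewrite ger0_norm // ltW|apply: ler_normM].
set t1 := \sum_j y j * T i1 j in B3 hG2.
have B4 : `|lam i1 * wi - (y i1 * wi) ^+ 2| <= X * iu + (K * iu) ^+ 2.
  apply: ler_norm_addn; first exact: ler_normM.
  by rewrite normrN !expr2; apply: ler_normM; apply: ler_normM.
have n2 : `|2 : R| <= 2 by rewrite ger0_norm.
have B5 : `|2 * (lam i1 ^+ 2 + t1 - w * lam i1) * zi - (2 * (y i1 * lam i1) * zi) ^+ 2| <=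
   2 * (X ^+ 2 + n%:R * (K * (A * (K * X))) + K * X) * iu ^+ 2 + (2 * (K * X) * iu ^+ 2) ^+ 2.
  apply: ler_norm_addn.
    apply: ler_normM => //; apply: ler_normM => //.
    apply: ler_norm_addn; last by rewrite normrN; apply: ler_normM.
    by apply: ler_norm_addn => //; rewrite !expr2; apply: ler_normM.
  rewrite normrN !expr2.
  by apply: ler_normM; (apply: ler_normM; [apply: ler_normM => //; apply: ler_normM|rewrite -expr2]).
have B6 : `|f11 * fi - (fa i1 * fi) ^+ 2| <= K2 * im + (K2 * im) ^+ 2.
  apply: ler_norm_addn; first exact: ler_normM.
  by rewrite normrN !expr2; apply: ler_normM; apply: ler_normM.
set b4 := (lam i1 * wi - _) in B4 hG2; set b6 := (f11 * fi - _) in B6 hG2.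
set b5 := (2 * _ * zi - _) in B5 hG2; set b2 := (\sum_a y a * _) in B2 sumQ.
set N := n%:R in B2 B3 B5 *.
have N0 : 0 <= N by rewrite ler0n.
have L4 : - (pp * b4 - pp) <= `|pp| * (iu + (K * iu) ^+ 2 + 1) * X ^+ 2.
  have : `|pp * b4 - pp| <= `|pp| * (X * iu + (K * iu) ^+ 2) + `|pp|.
    by apply: ler_norm_addn; [apply: ler_normM|rewrite normrN].
  rewrite ler_norml => /andP[h _].
  have : `|pp| * (X * iu + (K * iu) ^+ 2) + `|pp| <= `|pp| * (iu + (K * iu) ^+ 2 + 1) * X ^+ 2.
    have -> : `|pp| * (X * iu + (K * iu) ^+ 2) + `|pp| = `|pp| * (X * iu + (K * iu) ^+ 2 + 1) by ring.
    rewrite -[leRHS]mulrA ler_wpM2l // !mulrDl mul1r.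
    apply: lerD; last by rewrite expr_ge1.
    apply: lerD; first by rewrite mulrC ler_wpM2l.
    by rewrite ler_peMr ?sqr_ge0 // expr_ge1.
  lra.
have L5 : - (be * b5) <= `|be| * (2 * (1 + N * K ^+ 2 + K) * iu ^+ 2 + (2 * K * iu ^+ 2) ^+ 2) * (X ^+ 2 + A * X).
  have : `|be * b5| <= `|be| * (2 * (X ^+ 2 + N * (K * (A * (K * X))) + K * X) * iu ^+ 2 + (2 * (K * X) * iu ^+ 2) ^+ 2).
    exact: ler_normM.
  rewrite ler_norml => /andP[h _].
  suff : `|be| * (2 * (X ^+ 2 + N * (K * (A * (K * X))) + K * X) * iu ^+ 2 + (2 * (K * X) * iu ^+ 2) ^+ 2)
     <= `|be| * (2 * (1 + N * K ^+ 2 + K) * iu ^+ 2 + (2 * K * iu ^+ 2) ^+ 2) * (X ^+ 2 + A * X) by lra.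
  rewrite -[leRHS]mulrA ler_wpM2l // [leRHS]mulrDl; apply: lerD.
    have q1 : 0 <= A * X by rewrite mulr_ge0 // ltW.
    have q2 : 0 <= N * K ^+ 2 * X ^+ 2 by rewrite !mulr_ge0 ?sqr_ge0.
    have q3 : 0 <= K * (A * X) by rewrite mulr_ge0.
    have q4 : K * X <= K * X ^+ 2 by rewrite ler_wpM2l.
    have q5 : X ^+ 2 + N * (K * (A * (K * X))) + K * X <=
      (1 + N * K ^+ 2 + K) * (X ^+ 2 + A * X) by lra.
    have := ler_wpM2r (sqr_ge0 iu) q5.
    move: (X ^+ 2 + N * (K * (A * (K * X))) + K * X) (1 + N * K ^+ 2 + K) (X ^+ 2 + A * X) => L M Y.
    clear; lra.
  have -> : (2 * (K * X) * iu ^+ 2) ^+ 2 = (2 * K * iu ^+ 2) ^+ 2 * X ^+ 2 by ring.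
  by rewrite ler_wpM2l ?sqr_ge0 // lerDl mulr_ge0 // ltW.
have L6 : - b6 <= (K2 * im + (K2 * im) ^+ 2) * X ^+ 2.
  move: B6; rewrite ler_norml => /andP[h _].
  have : K2 * im + (K2 * im) ^+ 2 <= (K2 * im + (K2 * im) ^+ 2) * X ^+ 2.
    by rewrite ler_peMr ?expr_ge1 // addr_ge0 ?sqr_ge0 ?mulr_ge0.
  lra.
have L2 : - (A * b2) <= N * K * grad_const pp be K K2 iu im * (A * X).
  move: B2; rewrite ler_norml => /andP[h _].
  have := ler_wpM2l (ltW A0) h; lra.
have Lw : A * (w * d) <= K * d * (A * X).
  have h : w <= K by apply: le_trans (ler_norm _) wK.
  have h1 : w * d <= K * d * X.
    by apply: (@le_trans _ _ (K * d)); [rewrite ler_wpM2r|rewrite ler_peMr // mulr_ge0].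
  by have := ler_wpM2l (ltW A0) h1; lra.
have Ld : d <= d * X ^+ 2 by rewrite ler_peMr ?expr_ge1.
have LG : 2 * (G i1 * lam i1) <= 2 * (S * X).
  rewrite ler_wpM2l // ler_pM ?(ltW l1) //.
    by rewrite /S (bigD1 i1) //= lerDl sumr_ge0.
  exact: le_trans (ler_norm _) (lX i1).
have LS : 0 <= S * lam i1 by rewrite mulr_ge0 ?ltW.
have AX0 : 0 <= A * X by rewrite mulr_ge0 // ltW.
have X20 : 0 <= X ^+ 2 by rewrite sqr_ge0.
have AB1 := ler_wpM2l (ltW A0) B1.
have main : A * (c * S * X ^+ 2) <= C3 * X ^+ 2 + C3 * (A * X) + 2 * (S * X).
  have g0 : 0 <= grad_const pp be K K2 iu im.
    by rewrite /grad_const !(addr_ge0, mulr_ge0, sqr_ge0, exprn_ge0, normr_ge0).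
  set q1 := `|pp| * (iu + (K * iu) ^+ 2 + 1) in L4 *.
  set q2 := `|be| * (2 * (1 + N * K ^+ 2 + K) * iu ^+ 2 + (2 * K * iu ^+ 2) ^+ 2) in L5 *.
  set q3 := N * K * grad_const pp be K K2 iu im in L2 *.
  have q10 : 0 <= q1 by rewrite /q1 !(addr_ge0, mulr_ge0, sqr_ge0, exprn_ge0, normr_ge0).
  have q30 : 0 <= q3 by rewrite /q3 !mulr_ge0.
  have Kim : 0 <= K2 * im by rewrite mulr_ge0.
  have Kd0 : 0 <= K * d by rewrite mulr_ge0.
  have C3E : C3 = q1 + q2 + K2 * im + (K2 * im) ^+ 2 + d + q3 + K * d + 1 by [].
  have r1 : 0 <= q1 * (A * X) by rewrite mulr_ge0.
  have r2 : 0 <= q3 * X ^+ 2 by rewrite mulr_ge0.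
  have r3 : 0 <= K2 * im * (A * X) by rewrite mulr_ge0.
  have r4 : 0 <= (K2 * im) ^+ 2 * (A * X) by rewrite mulr_ge0 ?sqr_ge0.
  have r5 : 0 <= d * (A * X) by rewrite mulr_ge0.
  have r6 : 0 <= K * d * X ^+ 2 by rewrite mulr_ge0.
  rewrite Gd in hG2.
  have E1 : A * (\sum_i G i * lam i ^+ 2 + b2 - w * d) =
     A * (\sum_i G i * lam i ^+ 2) + A * b2 - A * (w * d) by ring.
  rewrite E1 in sumQ.
  move: (\sum_i G i * Q i) (\sum_i G i * lam i ^+ 2) sumQ hG2 AB1 => sQ sl sumQ hG2 AB1.
  rewrite C3E.
  have -> : (q1 + q2 + K2 * im + (K2 * im) ^+ 2 + d + q3 + K * d + 1) * X ^+ 2 +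
    (q1 + q2 + K2 * im + (K2 * im) ^+ 2 + d + q3 + K * d + 1) * (A * X) =
    q1 * X ^+ 2 + q2 * (X ^+ 2 + A * X) + (K2 * im + (K2 * im) ^+ 2) * X ^+ 2 + d * X ^+ 2
    + q3 * X ^+ 2 + K * d * X ^+ 2 + X ^+ 2 + q1 * (A * X) + K2 * im * (A * X)
    + (K2 * im) ^+ 2 * (A * X) + d * (A * X) + q3 * (A * X) + K * d * (A * X) + A * X by ring.
  move: (q1 * X ^+ 2) (q2 * (X ^+ 2 + A * X)) ((K2 * im + (K2 * im) ^+ 2) * X ^+ 2) (d * X ^+ 2)
    (q3 * X ^+ 2) (K * d * X ^+ 2) (q1 * (A * X)) (K2 * im * (A * X)) ((K2 * im) ^+ 2 * (A * X))
    (d * (A * X)) (q3 * (A * X)) (K * d * (A * X)) L4 L5 L6 L2 Lw Ld LG LS AX0 X20 r1 r2 r3 r4 r5 r6 AB1 sumQ hG2.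
  move: (A * X) (X ^+ 2) (2 * (S * X)) (S * lam i1) (A * (c * S * _)) (A * sl) (A * b2) (A * (w * d)) (pp * b4) (be * b5) (2 * (G i1 * lam i1)).
  clear; move=> *; lra.
have l1X : lam i1 <= X by apply: le_trans (ler_norm _) (lX i1).
apply: le_trans l1X _.
suff : X <= 2 * (C3 * A / c0 + 2) / (A * c) by lra.
rewrite ler_pdivlMr ?mulr_gt0 //.
have Xp : 0 < X by lra.
(* This is where A comes from: A c c0 = 2 C3 and S >= c0 let the errors quadratic in X take at most
   half of the good term. The rest is linear in X, and dividing by S X / 2 bounds X. *)
have half : C3 * X ^+ 2 <= A * (c * S * X ^+ 2) / 2.
  have -> : A * (c * S * X ^+ 2) / 2 = C3 * X ^+ 2 * (S / c0).
    by rewrite AE; field; rewrite !gt_eqF.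
  by rewrite ler_peMr ?mulr_ge0 ?(ltW C30) // ler_pdivlMr // mul1r.
have m2 : A * (c * S * X ^+ 2) / 2 <= C3 * (A * X) + 2 * (S * X) by lra.
have CAS : C3 * A <= C3 * A / c0 * S.
  by rewrite mulrAC ler_pdivlMr // ler_wpM2l // mulr_ge0 // ltW.
have m3 : A * (c * S * X ^+ 2) / 2 <= (C3 * A / c0 * S + 2 * S) * X.
  by have := ler_wpM2r X0 CAS; lra.
have SX : 0 < S * X / 2 by rewrite divr_gt0 ?mulr_gt0.
rewrite -(ler_pM2r SX).
have -> : X * (A * c) * (S * X / 2) = A * (c * S * X ^+ 2) / 2 by ring.
have -> : 2 * (C3 * A / c0 + 2) * (S * X / 2) = (C3 * A / c0 * S + 2 * S) * X by field; rewrite gt_eqF.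
exact: m3.
Qed.

End Absorption.

(** * First and second order conditions in an eigenframe *)

Section Eigenframe.
Context {R : realType} {n : nat} (P k l : nat) (p q : R).
Context (u phi : 'rV[R]_(n.+1) -> R) (sol : admissible_solution P k l p q u phi).
Local Notation dot := (dotr n.+1).
Local Notation U := (@punct R n.+1).
Local Notation lnrhs := (lnrhs k p q u phi).
Context (x : 'rV[R]_n.+1) (E : 'M[R]_(n, n.+1)) (lam : 'rV[R]_n).
Context (Sx : sphere x) (fE : frame x E).
Context (ED : E *m hessm (hext u) x *m E^T = diag_mx lam).
Local Notation w := (hext u).
Local Notation D i := (dird (row i E)).
Local Notation y i := (D i w x).
Local Notation T i j := (D j (D i (D i w)) x).
Local Notation Q i j := (D j (D j (D i (D i w))) x).
Local Notation z := (gradsq_hext u x).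

Let oU : open U := @open_punct R n.+1.
Let Ux : U x := sphere_punct x Sx.
Let x0 : x != 0 := sphere_neq0 x Sx.
Let c4 : CkOn 4 U w := CkOn_hext 4 u (C4_ext _ _ _ _ _ _ _ sol).
Let c3 : CkOn 3 U w := CkOnW _ _ _ c4.
Let c2 : CkOn 2 U w := CkOnW _ _ _ c3.

Let Us a (s : R) : U (x + s *: row a E).
Proof. by apply/punctE; apply: line_neq0 => //; apply: frame_row_orth fE. Qed.

Let ya a (s : R) : x + s *: row a E != 0.
Proof. exact/punctE/Us. Qed.

Lemma eigenframe_hess i j : D i (D j w) x = if i == j then lam 0 i else 0.
Proof.
rewrite -hessm_frame // ED mxE; case: eqP => [->|]; by rewrite ?mulr1n ?mulr0n.
Qed.

Lemma jet_hext a : jet2 (fun s => w (x + s *: row a E)) (u x) (y a) (lam 0 a).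
Proof.
apply: jet2_eq (jet2_line U w x (row a E) oU c2 (Us a)) _ _ _ _; [by []| |by []|].
  exact: hext_sphere.
by rewrite eigenframe_hess eqxx.
Qed.

Lemma jet_hess i a :
  jet2 (fun s => D i (D i w) (x + s *: row a E)) (lam 0 i) (T i a) (Q i a).
Proof.
have c : CkOn 2 U (D i (D i w)) := CkOn_dird 2 U _ _ oU (CkOn_dird 3 U _ _ oU c4).
apply: jet2_eq (jet2_line U _ x (row a E) oU c (Us a)) _ _ _ _; [by []| |by []|by []].
by rewrite eigenframe_hess eqxx.
Qed.

Lemma dird3_comm e e' : dird e' (dird e' (dird e w)) x = dird e (dird e' (dird e' w)) x.
Proof.
have c e1 : CkOn 2 U (dird e1 w) := CkOn_dird 2 U w e1 oU c3.
rewrite (dird_congr U _ (dird e (dird e' w)) e' x oU Ux); last first.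
  by move=> v Uv; apply: (dird_comm U w e' e v oU c2 Uv).
exact: (dird_comm U (dird e' w) e' e x oU (c e') Ux).
Qed.

(** The squared gradient is split in the constant orthonormal basis of the rows of [E] and [x]. The
    derivative of w along [x] has jet (u, 0, -lam_a), since second derivatives of w have degree -1;
    it accounts for the term -u lam_a. *)
Lemma jet_gradsq a : jet2 (fun s => gradsq_hext u (x + s *: row a E)) z
  (2 * (y a * lam 0 a))
  (2 * (lam 0 a ^+ 2 + \sum_j y j * T a j - u x * lam 0 a)).
Proof.
have c e : CkOn 2 U (dird e w) := CkOn_dird 2 U w e oU c3.
have jE i : jet2 (fun s => D i w (x + s *: row a E)) (y i)
    (if i == a then lam 0 a else 0) (T a i).
  apply: jet2_eq (jet2_line U _ x (row a E) oU (c (row i E)) (Us a)) _ _ _ _; [by []|by []| |].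
    by rewrite eigenframe_hess eq_sym.
  exact: dird3_comm.
have jx : jet2 (fun s => dird x w (x + s *: row a E)) (u x) 0 (- lam 0 a).
  apply: jet2_eq (jet2_line U _ x (row a E) oU (c x) (Us a)) _ _ _ _; [by []| | |].
  - by rewrite dird_hext_radial; [rewrite hext_sphere|exact: C1_ext sol|exact: x0].
  - rewrite (dird_comm U w _ _ x oU c2 Ux); apply: dird2_hext_radial; [exact: C2_ext sol|exact: x0].
  - rewrite dird3_comm dird3_hext_radial; [|exact: C3_ext sol|exact: x0].
    by rewrite eigenframe_hess eqxx.
have J := jet2D _ _ _ _ _ _ _ _ (jet2_sum n _ _ _ _ xpredT (fun i _ => jet2_sqr _ _ _ _ (jE i))) (jet2_sqr _ _ _ _ jx).
apply: jet2_eq J _ _ _ _.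
- by move=> s; rewrite /gradsq_hext (gradsq_frame _ x E _ Sx fE).
- rewrite /gradsq_hext (gradsq_frame _ x E _ Sx fE) dird_hext_radial; [|exact: C1_ext sol|exact: x0].
  by rewrite hext_sphere.
- rewrite (bigD1 a) //= eqxx big1 => [|i /negPf ->]; ring.
- rewrite -mulr_sumr -mulrDr; congr (2 * _); rewrite big_split /= expr0n /= add0r.
  rewrite (bigD1 a) //= eqxx big1 => [|i /negPf ->]; last by rewrite expr0n.
  ring.
Qed.

Lemma jet_enorm a : jet2 (fun s => enorm (x + s *: row a E)) 1 0 1.
Proof.
apply: jet2_eq jet2_sqrt1Dsqr _ _ _ _ => // s.
rewrite enorm_line //; last exact: frame_row_orth fE.
by rewrite enorm_dotr (frame_row x E) // eqxx sqrtr1.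
Qed.

Lemma jet_phi a : jet2 (fun s => ext phi (x + s *: row a E)) (phi x)
  (D a (ext phi) x) (D a (D a (ext phi)) x).
Proof.
have cp : CkOn 2 U (ext phi) := sol_C2phi _ _ _ _ _ _ _ sol.
by apply: jet2_eq (jet2_line U _ x (row a E) oU cp (Us a)) _ _ _ _; rewrite ?ext_sphere.
Qed.

Lemma jet_lnrhs a : jet2 (fun s => lnrhs (x + s *: row a E)) (lnrhs x)
  ((p - 1) * (y a / u x) + (k.+1%:R - q) / 2 * (2 * (y a * lam 0 a) / z) + D a (ext phi) x / phi x)
  ((p - 1) * (lam 0 a / u x - (y a / u x) ^+ 2) - (p - 1)
   + (k.+1%:R - q) / 2 * (2 * (lam 0 a ^+ 2 + \sum_j y j * T a j - u x * lam 0 a) / z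
       - (2 * (y a * lam 0 a) / z) ^+ 2)
   + (D a (D a (ext phi)) x / phi x - (D a (ext phi) x / phi x) ^+ 2)).
Proof.
have J1 := jet2_ln _ _ _ _ (jet_hext a) (fun s => hext_gt0 _ _ _ _ _ _ _ sol _ (ya a s)).
have J2 := jet2_ln _ _ _ _ (jet_enorm a) (fun s => enorm_gt0 _ _ (ya a s)).
have J3 := jet2_ln _ _ _ _ (jet_gradsq a) (fun s => gradsq_hext_gt0 _ _ _ _ _ _ _ sol _ (ya a s)).
have J4 := jet2_ln _ _ _ _ (jet_phi a) (fun s => ext_phi_gt0 _ _ _ _ _ _ _ sol _ (ya a s)).
have J := jet2D _ _ _ _ _ _ _ _ (jet2D _ _ _ _ _ _ _ _
  (jet2Z (p - 1) _ _ _ _ (jet2D _ _ _ _ _ _ _ _ J1 (jet2N _ _ _ _ J2)))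
  (jet2Z ((k.+1%:R - q) / 2) _ _ _ _ J3)) J4.
apply: jet2_eq J _ _ _ _; [by []| | |].
- rewrite /lnrhs hext_sphere // ext_sphere //.
  by have -> : enorm x = 1 := Sx.
- by rewrite !mul0r oppr0 addr0.
- by rewrite !mul0r expr0n /= subr0 divr1 mulrBr mulr1.
Qed.

Section Support.
Context (d : R) (G : 'I_n -> R).
Context (Glam : \sum_i G i * lam 0 i = d).
Context (Gsup : forall nu : 'I_n -> R, in_Gamma P k nu ->
  ln (sigmaL P nu k / sigmaL P nu l) <=
  ln (sigmaL P (fun i => lam 0 i) k / sigmaL P (fun i => lam 0 i) l) + \sum_i G i * nu i - d).

(** The weighted inequality of [support_line] is an equality at s = 0, because G takes the value [d]
    at [lam]. *)
Lemma support_jet a :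
  \sum_i G i * T i a =
    (p - 1) * (y a / u x) + (k.+1%:R - q) / 2 * (2 * (y a * lam 0 a) / z) + D a (ext phi) x / phi x
  /\ (p - 1) * (lam 0 a / u x - (y a / u x) ^+ 2) - (p - 1)
   + (k.+1%:R - q) / 2 * (2 * (lam 0 a ^+ 2 + \sum_j y j * T a j - u x * lam 0 a) / z
       - (2 * (y a * lam 0 a) / z) ^+ 2)
   + (D a (D a (ext phi)) x / phi x - (D a (ext phi) x / phi x) ^+ 2)
   <= \sum_i G i * Q i a + \sum_i G i * lam 0 i + 2 * (G a * lam 0 a).
Proof.
pose c := lnrhs x - d.
have H nu : in_Gamma P k nu -> ln (sigmaL P nu k / sigmaL P nu l) <= c + \sum_i G i * nu i.
  move=> gn; have := Gsup nu gn.
  rewrite (lnQ_diag _ _ _ _ _ _ _ sol x E lam Sx fE ED) /c; lra.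
apply: (jet2_support n a G (fun i => lam 0 i) _ _ _ _ c _ _ _
  (fun i => jet_hess i a) (jet_lnrhs a)) => [|s].
  by rewrite Glam /c subrK.
exact: (support_line _ _ _ _ _ _ _ sol x E a s c G Sx fE H).
Qed.

End Support.

Section Maximum.
Context (A : R) (i1 : 'I_n).
Context (xmax : forall v, v != 0 ->
  enorm v * D i1 (D i1 w) v + A / 2 * gradsq_hext u v <= lam 0 i1 + A / 2 * z).

(** The factor |v| makes the Hessian term 0-homogeneous, so a maximum over the sphere can be tested
    along straight tangent lines. *)
Lemma max_jet i : T i1 i = - (A * (y i * lam 0 i)) /\
  lam 0 i1 + Q i1 i + A * (lam 0 i ^+ 2 + \sum_j y j * T i j - u x * lam 0 i) <= 0.
Proof.
apply: (jet2_maximum _ _ _ _ _ _ _ _ _ _ (jet_enorm i) (jet_hess i1 i) (jet_gradsq i)) => s.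
exact: xmax (ya i s).
Qed.

End Maximum.

End Eigenframe.

(** * Extremal points of the solution and of the test function *)

Section Extrema.
Context {R : realType} {n : nat} (P k l : nat) (p q : R).
Context (u phi : 'rV[R]_(n.+1) -> R) (sol : admissible_solution P k l p q u phi).
Local Notation dot := (dotr n.+1).
Local Notation U := (@punct R n.+1).
Local Notation lnrhs := (lnrhs k p q u phi).
Implicit Types (x v xi : 'rV[R]_n.+1) (E : 'M[R]_(n, n.+1)) (lam : 'rV[R]_n).

Lemma sphere_nonempty : @sphere R n !=set0.
Proof. by exists (delta_mx 0 ord0); apply: delta_unit. Qed.

Lemma ext_min_point : exists2 x, sphere x & forall v, v != 0 -> ext u x <= ext u v.
Proof.
have cont : {within @sphere R n, continuous (ext u)}.
  apply: continuous_in_subspaceT => x; rewrite inE => Sx.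
  exact: (CkOn_for 4 U _ x open_punct (C4_ext _ _ _ _ _ _ _ sol) (sphere_punct x Sx)).
have [x] := @EVT_min_rV R n.+1 (ext u) _ sphere_nonempty (compact_unit_sphere n.+1) cont.
rewrite inE => Sx xmin; exists x => // v v0.
rewrite (normalizeK v v0) ext_homog ?enorm_gt0 //; apply: xmin; rewrite inE.
exact: sphere_normalize.
Qed.

(** [xi] need not be tangent: its radial part lies in the kernel of the Hessian. *)
Lemma hess_quadform x E lam xi : sphere x -> frame x E ->
  E *m hessm (hext u) x *m E^T = diag_mx lam ->
  (xi *m hessm (hext u) x *m xi^T) 0 0 = \sum_i lam 0 i * dot xi (row i E) ^+ 2.
Proof.
move=> Sx fE ED; set H := hessm _ x.
have cw : CkOn 2 U (hext u) by exact/CkOn_hext/(C2_ext _ _ _ _ _ _ _ sol).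
have Hx (e : 'rV[R]_n.+1) : (x *m H *m e^T) 0 0 = 0.
  rewrite /H -(dird_hessm U _ _ _ _ open_punct cw (sphere_punct x Sx)).
  by apply: dird2_hext_radial; [exact: (C2_ext _ _ _ _ _ _ _ sol)|exact: sphere_neq0].
have xH : x *m H = 0.
  apply/rowP => j; rewrite [RHS]mxE -[RHS](Hx (delta_mx 0 j)) mul_rV_trE.
  rewrite (bigD1 j) //= big1 ?addr0 => [|i ij]; last by rewrite !mxE (negPf ij) mulr0.
  by rewrite [X in _ * X]mxE !eqxx mulr1.
have HT : H^T = H by apply: (hessm_hext_sym _ _ _ _ _ _ _ sol).
have HxT : H *m x^T = 0 by rewrite -[H]HT -trmx_mul xH trmx0.
pose C := E^T *m E + x^T *m x.
have C1 : C = 1%:M := frame_complete x E Sx fE.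
have CH : C *m H *m C = E^T *m diag_mx lam *m E.
  rewrite /C mulmxDl -(mulmxA x^T x) xH mulmx0 addr0 mulmxDr.
  by rewrite [X in _ + X]mulmxA -[X in _ + X *m x]mulmxA HxT mulmx0 mul0mx addr0 -ED !mulmxA.
have -> : xi *m H *m xi^T = (xi *m E^T) *m diag_mx lam *m (xi *m E^T)^T.
  rewrite trmx_mul trmxK !mulmxA -(mulmxA xi E^T) -(mulmxA xi _ E) -CH C1 mul1mx mulmx1.
  by [].
rewrite mul_rV_trE; apply: eq_bigr => i _; rewrite mul_mx_diag mxE.
have -> : (xi *m E^T) 0 i = dot xi (row i E).
  by rewrite dotrE mxE; apply: eq_bigr => j _; rewrite !mxE.
by rewrite expr2 mulrAC mulrC.
Qed.

Lemma frame_bessel x E xi : sphere x -> frame x E -> enorm xi = 1 ->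
  \sum_i dot xi (row i E) ^+ 2 <= 1.
Proof.
move=> Sx fE x1; have := frame_parseval x E xi xi Sx fE; rewrite dotr_unit // => ->.
rewrite -[leLHS]addr0; apply: lerD; last by rewrite -expr2 sqr_ge0.
by apply: ler_sum => i _; rewrite [dot xi _]dotrC expr2.
Qed.

(** The maximum is taken over a product of two spheres instead of the unit tangent bundle:
    compactness is immediate, and radial components of the direction do not contribute to the
    Hessian term. *)
Lemma test_max_point (A : R) : exists x, exists xi, [/\ sphere x, sphere xi
  & forall v zeta, sphere v -> sphere zeta ->
    (zeta *m hessm (hext u) v *m zeta^T) 0 0 + A / 2 * gradsq_hext u v <=
    (xi *m hessm (hext u) x *m xi^T) 0 0 + A / 2 * gradsq_hext u x].
Proof.
pose F (t : 'rV[R]_n.+1 * 'rV[R]_n.+1) :=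
  (t.2 *m hessm (hext u) t.1 *m t.2^T) 0 0 + A / 2 * gradsq_hext u t.1.
have cS : compact (@sphere R n `*` @sphere R n).
  by apply: compact_setX; exact: compact_unit_sphere.
have nS : (@sphere R n `*` @sphere R n) !=set0.
  by have [x Sx] := sphere_nonempty; exists (x, x).
have cw : CkOn 2 U (hext u) by exact/CkOn_hext/(C2_ext _ _ _ _ _ _ _ sol).
have cF : {within @sphere R n `*` @sphere R n, continuous F}.
  apply: continuous_in_subspaceT => -[x xi]; rewrite inE => -[/= Sx _].
  have Ux := sphere_punct x Sx.
  have c1 (f : 'rV[R]_n.+1 -> R) : {for x, continuous f} ->
      (fun t : 'rV[R]_n.+1 * 'rV[R]_n.+1 => f t.1) @ (x, xi) --> f x.
    move=> cf; apply: (@cvg_comp _ _ _ (fun t : 'rV[R]_n.+1 * 'rV[R]_n.+1 => t.1) f _ (nbhs x)).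
      exact: cvg_fst.
    exact: cf.
  have c2 i : (fun t : 'rV[R]_n.+1 * 'rV[R]_n.+1 => t.2 0 i) @ (x, xi) --> xi 0 i.
    apply: (@cvg_comp _ _ _ (fun t : 'rV[R]_n.+1 * 'rV[R]_n.+1 => t.2) (fun v : 'rV[R]_n.+1 => v 0 i) _ (nbhs xi)).
      exact: cvg_snd.
    exact: coord_continuous.
  rewrite /continuous_at.
  have FE : F = fun t => (\sum_i \sum_j t.2 0 i * pd i (pd j (hext u)) t.1 * t.2 0 j)
      + A / 2 * \sum_j pd j (hext u) t.1 ^+ 2.
    apply/funext => t; rewrite /F mul_rV_mx_trE; congr (_ + _).
    by apply: eq_bigr => i _; apply: eq_bigr => j _; rewrite mxE.
  rewrite FE /=; apply: cvgD.
    apply: cvg_sum_ord => i; apply: cvg_sum_ord => j.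
    apply: cvgM; last exact: c2.
    apply: cvgM; first exact: c2.
    apply: c1; exact: (CkOn_for 0 U _ x open_punct (CkOn_pd _ _ _ i (CkOn_pd _ _ _ j cw)) Ux).
  apply: cvgM; first exact: cvg_cst.
  apply: cvg_sum_ord => j.
  have cj := c1 _ (CkOn_for 1 U _ x open_punct (CkOn_pd _ _ _ j cw) Ux).
  by under eq_cvg do rewrite expr2; rewrite expr2; apply: cvgM.
have [[x xi]] := compact_EVT_max nS cS cF.
rewrite inE => -[/= Sx Sxi] xmax; exists x, xi; split => // v zeta Sv Sz.
by have := xmax (v, zeta); rewrite inE; apply.
Qed.

End Extrema.

(** * A priori bounds *)

Section Estimates.
Context {R : realType} {n : nat} (P k l : nat) (p q : R).
Context (P1 : (1 < P)%N) (Pn : (P <= n - 1)%N) (lk : (l < k)%N).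
Context (kC : (k <= 'C(n - 1, P - 1))%N).
Local Notation dot := (dotr n.+1).
Local Notation U := (@punct R n.+1).
Implicit Types (u phi : 'rV[R]_n.+1 -> R) (x v xi : 'rV[R]_n.+1).

Let kN : (k <= 'C(n, P))%N.
Proof.
apply: leq_trans kC _.
have := P1; have := Pn; case: n P => [|n'] [|P'] // _ _.
by rewrite !subn1 /= binS leq_addl.
Qed.

Lemma in_Gamma_const (a : R) : 0 < a -> in_Gamma P k (fun _ : 'I_n => a).
Proof.
move=> a0 j /andP[_ jk]; rewrite sigmaL_const mulr_gt0 ?ltr0n ?bin_gt0 ?(leq_trans jk) //.
by rewrite exprn_gt0 // mulr_gt0 // ltr0n ltnW.
Qed.

Lemma lnQ_const_ge (a : R) : 0 < a ->
  ln ('C('C(n, P), k)%:R / 'C('C(n, P), l)%:R) + (k - l)%:R * ln a <=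
  ln (sigmaL P (fun _ : 'I_n => a) k / sigmaL P (fun _ : 'I_n => a) l).
Proof.
move=> a0; set b1 : R := 'C(_, k)%:R; set b2 : R := 'C(_, l)%:R.
have b10 : 0 < b1 by rewrite ltr0n bin_gt0.
have b20 : 0 < b2 by rewrite ltr0n bin_gt0 (leq_trans (ltnW lk)).
have P0 : (1 : R) <= P%:R by rewrite ler1n ltnW.
have Pa : 0 < P%:R * a by rewrite mulr_gt0 // (lt_le_trans ltr01).
rewrite !sigmaL_const -/b1 -/b2 -(subnKC (ltnW lk)) addKn exprD.
have -> : b1 * ((P%:R * a) ^+ l * (P%:R * a) ^+ (k - l)) / (b2 * (P%:R * a) ^+ l) =
    b1 / b2 * (P%:R * a) ^+ (k - l).
  by field; rewrite expf_neq0 ?gt_eqF.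
rewrite lnM ?posrE ?divr_gt0 ?exprn_gt0 // lerD2l lnXn // mulr_natl.
by rewrite lerMn2r ler_ln ?posrE // ler_peMl ?orbT // ltW.
Qed.

(* At a minimum of u the gradient vanishes and all eigenvalues are at least u,
   so the equation gives c u^(k-l) <= u^(p+k-q) phi, where p - q + l > 0. *)
Lemma solution_lower_bound (K2 : R) : q - l%:R < p ->
  exists2 u0, 0 < u0 & forall u phi, admissible_solution P k l p q u phi ->
    (forall x, sphere x -> phi x <= K2) -> forall x, sphere x -> u0 <= u x.
Proof.
move=> pq.
have [c [_ Hsup]] := @sigmaL_support R n P k l P1 Pn lk kC.
pose b : R := ln ('C('C(n, P), k)%:R / 'C('C(n, P), l)%:R).
(* The solution of b + (k - l) ln u = (p - 1) ln u + (k + 1 - q) ln u + ln K2 for u, where the total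
   coefficient of ln u is p - q + l > 0. *)
exists (expR ((b - ln K2) / (p - q + l%:R))); first exact: expR_gt0.
move=> u phi sol phiK.
have [x Sx xmin] := ext_min_point _ _ _ _ _ _ _ sol.
suff H : expR ((b - ln K2) / (p - q + l%:R)) <= u x.
  move=> v Sv; apply: le_trans H _.
  by have := xmin v (sphere_neq0 v Sv); rewrite !ext_sphere.
have [E0 fE0] := exists_frame n x Sx.
have [ O [lam [_ fE ED]]] := spectral_frame _ _ _ _ _ _ _ sol x E0 Sx fE0.
move: (O *m E0) fE ED => E fE ED.
have c2 := C2_ext _ _ _ _ _ _ _ sol.
have u0 := sol_u_gt0 _ _ _ _ _ _ _ sol x Sx.
have f0 := sol_phi_gt0 _ _ _ _ _ _ _ sol x Sx.
have crit i : dird (row i E) (ext u) x = 0 /\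
    0 <= dird (row i E) (dird (row i E) (ext u)) x.
  have xE := frame_row_orth x E i fE.
  have J := jet2_line U (ext u) x (row i E) open_punct c2
    (fun s => proj2 (punctE _) (line_neq0 x (row i E) s Sx xE)).
  apply: (jet2_min _ _ _ _ J) => s; apply: xmin; exact: line_neq0.
have lamE i : u x <= lam 0 i.
  have xE := frame_row_orth x E i fE.
  have := eigenframe_hess _ _ _ _ _ _ _ sol x E lam Sx ED i i; rewrite eqxx => <-.
  rewrite (dird2_hext u _ _ x c2 Sx xE xE) (frame_row x E i i fE) eqxx mulr1.
  by rewrite lerDr; have [] := crit i.
have g0 : grad_sq u x = 0.
  rewrite /grad_sq (eq_bigr (fun j => pd j (ext u) x ^+ 2)); last by move=> j _; rewrite mxE.
  rewrite (gradsq_frame _ x E _ Sx fE) dird_ext_radial; [|exact: CkOnW|exact: sphere_neq0].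
  rewrite expr0n addr0 big1 // => i _; have [-> _] := crit i; by rewrite expr0n.
have [G [G0 _ Glam _ sup]] := Hsup _ (in_Gamma_diag _ _ _ _ _ _ _ sol x E lam Sx fE ED).
(* The functional at the eigenvalues is evaluated at the constant vector u(x): as all eigenvalues
   are at least u(x) and G >= 0, it gives at most k - l. This replaces monotonicity of the
   operator. *)
have := sup _ (in_Gamma_const (u x) u0).
rewrite (lnQ_diag _ _ _ _ _ _ _ sol x E lam Sx fE ED) (lnrhs_sphere _ _ _ _ _ _ _ sol x Sx).
move=> h1; have := le_trans (lnQ_const_ge (u x) u0) h1.
have h2 : \sum_i G i * u x <= (k - l)%:R.
  by rewrite -Glam; apply: ler_sum => i _; apply: ler_wpM2l.
rewrite g0 addr0 lnM ?posrE ?mulr_gt0 ?powR_gt0 ?exprn_gt0 // lnM ?posrE ?powR_gt0 ?exprn_gt0 //.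
rewrite !ln_powR lnXn // -/b.
have h3 : ln (phi x) <= ln K2 by rewrite ler_ln ?posrE ?(lt_le_trans f0) ?phiK.
rewrite natrB ?(ltnW lk) // in h2 *; rewrite -[k.+1%:R]natr1 -[ln (u x) *+ 2]mulr_natl => h4.
have pos : 0 < p - q + l%:R by lra.
rewrite -[leRHS](lnK (x := u x)) ?posrE // ler_expR ler_pdivrMr //.
move: (ln (u x)) (ln (phi x)) (ln K2) (\sum_i G i * u x) h2 h3 h4 => L1 L2 L3 S.
by clear; move=> *; lra.
Qed.

Lemma abs_ln_le (a b t : R) : 0 < a -> a <= t -> t <= b -> `|ln t| <= `|ln a| + `|ln b|.
Proof.
move=> a0 at_ tb; have t0 : 0 < t by apply: lt_le_trans at_.
have h1 : ln a <= ln t by rewrite ler_ln ?posrE.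
have h2 : ln t <= ln b by rewrite ler_ln ?posrE // (lt_le_trans t0).
have := ler_norm (ln b); have := ler_norm (- ln a); rewrite normrN.
have := normr_ge0 (ln a); have := normr_ge0 (ln b).
by rewrite ler_norml => *; apply/andP; split; lra.
Qed.

Lemma sqr_le_sum (f : 'I_n -> R) i : f i ^+ 2 <= \sum_j f j ^+ 2.
Proof. by rewrite (bigD1 i) //= lerDl sumr_ge0 // => j _; apply: sqr_ge0. Qed.

Lemma abs_le_sqrt (a b : R) : a ^+ 2 <= b -> `|a| <= Num.sqrt b.
Proof.
move=> h; have b0 : 0 <= b by apply: le_trans (sqr_ge0 a) h.
by rewrite -sqrtr_sqr ler_sqrt.
Qed.

Lemma frob_entry (A : 'M[R]_n) i j : `|A i j| <= frob A.
Proof.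
apply: abs_le_sqrt; apply: le_trans (sqr_le_sum (fun j => A i j) j) _.
rewrite [leRHS](bigD1 i) //= lerDl; apply: sumr_ge0 => h _.
by apply: sumr_ge0 => g _; apply: sqr_ge0.
Qed.

Lemma hess_upper_bound (m K K2 : R) : (0 < n)%N -> 0 < m -> 0 < K -> 0 <= K2 -> q - l%:R < p ->
  exists2 M, 0 <= M & forall u phi, admissible_solution P k l p q u phi ->
  (forall x, sphere x -> m <= phi x) ->
  (forall x, sphere x -> u x <= K /\ Num.sqrt (grad_sq u x) <= K) ->
  (forall x E, sphere x -> frame x E ->
    [/\ phi x <= K2, Num.sqrt (grad_sq phi x) <= K2 & frob (cov_hess phi x E) <= K2]) ->
  forall x xi, sphere x -> sphere xi -> (xi *m hessm (hext u) x *m xi^T) 0 0 <= M.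
Proof.
move=> n0 m0 K0 K20 pq.
have [c [cp Hsup]] := @sigmaL_support R n P k l P1 Pn lk kC.
have [u0 u00 Hu0] := solution_lower_bound K2 pq.
pose be := (k.+1%:R - q) / 2.
(* B bounds the logarithm of the right side for every solution obeying the bounds, hence the
   quotient is at most exp B and the sum of the G_i at least c0. *)
pose B := `|p - 1| * (`|ln u0| + `|ln K|) + `|be| * (`|ln (u0 ^+ 2)| + `|ln (K ^+ 2 + K ^+ 2)|)
  + `|ln m| + `|ln K2|.
pose c0 := c / (1 + expR B).
have e0 : 0 < 1 + expR B by rewrite addr_gt0 // expR_gt0.
have c00 : 0 < c0 by rewrite divr_gt0.
pose C3 := quad_const n (p - 1) be K K2 u0^-1 m^-1 (k - l)%:R.
have C30 : 0 < C3.
  by apply: quad_const_gt0; rewrite ?invr_ge0 ?ler0n // ltW.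
pose A := 2 * C3 / (c * c0).
have A0 : 0 < A by rewrite divr_gt0 ?mulr_gt0.
pose X0 := 1 + 2 * (C3 * A / c0 + 2) / (A * c).
have X00 : 0 <= X0.
  by rewrite /X0 !(addr_ge0, divr_ge0, mulr_ge0, ltW A0, ltW C30, ltW c00, ltW cp, ler01, ler0n).
exists (X0 + A / 2 * (K ^+ 2 + K ^+ 2)).
  apply: addr_ge0 => //; apply: mulr_ge0; first by rewrite divr_ge0 // ltW.
  by rewrite addr_ge0 ?sqr_ge0.
move=> u phi sol phim uK phiK.
have phiK2 x : sphere x -> phi x <= K2.
  by move=> Sx; have [E fE] := exists_frame n x Sx; have [] := phiK x E Sx fE.
have uu := Hu0 u phi sol phiK2.
have c1 := C1_ext _ _ _ _ _ _ _ sol.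
have zE x (Sx : sphere x) := gradsq_hextE u x c1 Sx.
have gK x : sphere x -> grad_sq u x <= K ^+ 2.
  move=> Sx; have [_ h] := uK x Sx.
  by rewrite -[leLHS](sqr_sqrtr (grad_sq_ge0 u x)) ler_pXn2r // nnegrE ?sqrtr_ge0 ?(ltW K0).
have zK x : sphere x -> u0 ^+ 2 <= gradsq_hext u x <= K ^+ 2 + K ^+ 2.
  move=> Sx; have [h _] := uK x Sx; have := uu x Sx => h2.
  have ux0 : 0 <= u x by apply: le_trans (ltW u00) h2.
  rewrite zE //; apply/andP; split.
    by rewrite -[leLHS]addr0 lerD ?grad_sq_ge0 // ler_pXn2r // nnegrE ltW.
  by rewrite lerD ?gK // ler_pXn2r // nnegrE ltW.
have [x [xi [Sx Sxi xmax]]] := test_max_point _ _ _ _ _ _ _ sol A.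
(* At any other point the gradient term is nonnegative and at the maximum it is at most A / 2 times
   2 K^2, which is the additional summand of the final bound. *)
suff bound : (xi *m hessm (hext u) x *m xi^T) 0 0 <= X0.
  move=> v zeta Sv Sz; have := xmax v zeta Sv Sz.
  have /andP[_ z1] := zK x Sx.
  have z2 : 0 <= A / 2 * gradsq_hext u v.
    apply: mulr_ge0; first by rewrite divr_ge0 // ltW.
    by have /andP[h _] := zK v Sv; apply: le_trans h; apply: sqr_ge0.
  have A20 : 0 <= A / 2 by rewrite divr_ge0 // ltW.
  have := ler_wpM2l A20 z1; lra.
have [E0 fE0] := exists_frame n x Sx.
have [ O [lam [_ fE ED]]] := spectral_frame _ _ _ _ _ _ _ sol x E0 Sx fE0.
move: (O *m E0) fE ED => E fE ED.
pose i1 := [arg max_(i > Ordinal n0) lam 0 i]%O.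
have lam1 i : lam 0 i <= lam 0 i1.
  by rewrite /i1; case: arg_maxP => // j _ h; apply: h.
have quadE := hess_quadform _ _ _ _ _ _ _ sol x E lam xi Sx fE ED.
have quad1 : (xi *m hessm (hext u) x *m xi^T) 0 0 <= lam 0 i1 * \sum_i dot xi (row i E) ^+ 2.
  by rewrite quadE mulr_sumr; apply: ler_sum => i _; rewrite ler_wpM2r // sqr_ge0.
(* If the top eigenvalue is not positive, neither is the quadratic form, and the bound is immediate.
   Otherwise Bessel's inequality bounds the form at [xi] by that eigenvalue. *)
have [l0|l0] := leP (lam 0 i1) 0.
  apply: le_trans quad1 (le_trans _ X00).
  by apply: mulr_le0_ge0 => //; apply: sumr_ge0 => i _; apply: sqr_ge0.
have quad2 : (xi *m hessm (hext u) x *m xi^T) 0 0 <= lam 0 i1.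
  by apply: le_trans quad1 _; rewrite ler_piMr ?(ltW l0) // (frame_bessel x E xi).
apply: (le_trans quad2).
have c2 : CkOn 2 U (hext u) by exact/CkOn_hext/(C2_ext _ _ _ _ _ _ _ sol).
(* The top eigenvector replaces [xi] while remaining a maximizer, and homogeneity extends the
   comparison to all nonzero points. *)
have xmax1 v : v != 0 -> enorm v * dird (row i1 E) (dird (row i1 E) (hext u)) v
    + A / 2 * gradsq_hext u v <= lam 0 i1 + A / 2 * gradsq_hext u x.
  move=> v0; have Sv := sphere_normalize v v0; set v1 := _ *: v in Sv.
  have en := enorm_gt0 _ _ v0.
  have S1 : sphere (row i1 E).
    by rewrite /sphere /= enorm_dotr (frame_row x E) // eqxx sqrtr1.
  have q1 := dird_hessm U (hext u) (row i1 E) (row i1 E) v1 open_punct c2 (sphere_punct v1 Sv).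
  have e1 : enorm v * dird (row i1 E) (dird (row i1 E) (hext u)) v <=
      (row i1 E *m hessm (hext u) v1 *m (row i1 E)^T) 0 0.
    rewrite -q1 /v1 (dird2_hext_homog _ _ _ _ _ (C2_ext _ _ _ _ _ _ _ sol) v0) ?invr_gt0 //.
    by rewrite invrK.
  have e2 : A / 2 * gradsq_hext u v <= A / 2 * gradsq_hext u v1.
    by rewrite /v1 (gradsq_hext_homog _ _ _ c1 v0) ?invr_gt0.
  apply: le_trans (le_trans (lerD e1 e2) (xmax v1 (row i1 E) Sv S1)) _.
  by apply: lerD; first exact: quad2.
have gam := in_Gamma_diag _ _ _ _ _ _ _ sol x E lam Sx fE ED.
have [G [G0 Gc Glam Gc0 sup]] := Hsup _ gam.
have u1 := uu x Sx; have [u2 _] := uK x Sx.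
have ux0 : 0 < u x by apply: lt_le_trans u1.
have /andP[z1 z2] := zK x Sx.
have z0 : 0 < gradsq_hext u x by apply: lt_le_trans z1; rewrite exprn_gt0.
have f1 := phim x Sx; have f2 := phiK2 x Sx.
have f0 : 0 < phi x by apply: lt_le_trans f1.
set Q := sigmaL P _ k / _ in Gc0.
have Q0 : 0 < Q.
  rewrite /Q divr_gt0 //; first by apply: gam; rewrite leqnn andbT (leq_ltn_trans _ lk).
  exact: (garding_ge0 _ _ k _ gam (ltnW lk)).
have QB : Q <= expR B.
  rewrite -[leLHS](lnK (x := Q)) ?posrE // ler_expR.
  rewrite (lnQ_diag _ _ _ _ _ _ _ sol x E lam Sx fE ED) /lnrhs hext_sphere // ext_sphere //.
  rewrite (_ : enorm x = 1) // ln1 subr0 -/be /B -[leRHS]addrA.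
  have h1 : (p - 1) * ln (u x) <= `|p - 1| * (`|ln u0| + `|ln K|).
    by apply: le_trans (ler_norm _) _; apply: ler_normM => //; apply: abs_ln_le.
  have h2 : be * ln (gradsq_hext u x) <= `|be| * (`|ln (u0 ^+ 2)| + `|ln (K ^+ 2 + K ^+ 2)|).
    apply: le_trans (ler_norm _) _; apply: ler_normM => //; apply: abs_ln_le => //.
    by rewrite exprn_gt0.
  have h3 : ln (phi x) <= `|ln m| + `|ln K2|.
    by apply: le_trans (ler_norm _) _; apply: abs_ln_le.
  exact: lerD (lerD h1 h2) h3.
have cS : c0 <= \sum_j G j.
  rewrite /c0 ler_pdivrMr // mulrC; apply: le_trans Gc0 _; apply: ler_wpM2r.
    exact: sumr_ge0.
  by rewrite lerD2l.
have sj := fun a => support_jet _ _ _ _ _ _ _ sol x E lam Sx fE ED (k - l)%:R G Glam sup a.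
have mj := max_jet _ _ _ _ _ _ _ sol x E lam Sx fE ED A i1 xmax1.
have gsum : \sum_i dird (row i E) (hext u) x ^+ 2 = grad_sq u x.
  have := gradsq_frame (hext u) x E x Sx fE; rewrite -/(gradsq_hext u x) (zE x Sx).
  rewrite dird_hext_radial ?sphere_neq0 // hext_sphere // addrC => /addIr.
  by move=> ->.
have yK i : `|dird (row i E) (hext u) x| <= K.
  have [_ h] := uK x Sx; apply: le_trans h; apply: abs_le_sqrt.
  by rewrite -gsum; exact: (sqr_le_sum (fun i => dird (row i E) (hext u) x)).
have cph : CkOn 2 U (ext phi) := sol_C2phi _ _ _ _ _ _ _ sol.
have [_ p2 p3] := phiK x E Sx fE.
have faK i : `|dird (row i E) (ext phi) x| <= K2.
  apply: le_trans p2; apply: abs_le_sqrt.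
  rewrite /grad_sq (eq_bigr (fun j => pd j (ext phi) x ^+ 2)); last by move=> j _; rewrite mxE.
  rewrite (gradsq_frame _ x E _ Sx fE).
  apply: le_trans (sqr_le_sum (fun i => dird (row i E) (ext phi) x) i) _.
  by rewrite lerDl sqr_ge0.
have f11K : `|dird (row i1 E) (dird (row i1 E) (ext phi)) x| <= K2.
  apply: le_trans p3; rewrite -(hessm_frame _ _ x E i1 i1 (sphere_punct x Sx) cph).
  exact: frob_entry.
have wK : `|u x| <= K by rewrite gtr0_norm.
have wiK : `|(u x)^-1| <= u0^-1 by rewrite gtr0_norm ?invr_gt0 // lef_pV2 ?posrE.
have ziK : `|(gradsq_hext u x)^-1| <= u0^-1 ^+ 2.
  by rewrite gtr0_norm ?invr_gt0 // exprVn lef_pV2 ?posrE ?exprn_gt0.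
have fiK : `|(phi x)^-1| <= m^-1 by rewrite gtr0_norm ?invr_gt0 // lef_pV2 ?posrE.
(* The equation produces w_ii11 and the maximum condition w_11ii; the two are matched here. *)
have comm4 i : dird (row i1 E) (dird (row i1 E) (dird (row i E) (dird (row i E) (hext u)))) x =
    dird (row i E) (dird (row i E) (dird (row i1 E) (dird (row i1 E) (hext u)))) x.
  exact: (dird_comm4 U _ _ _ x open_punct (CkOn_hext 4 u (C4_ext _ _ _ _ _ _ _ sol)) (sphere_punct x Sx)).
have swap (S1 S2 a b X : R) : S1 = S2 -> X <= S1 + a + b -> X <= S2 + a + b by move=> ->.
have hG2 := swap _ _ _ _ _ (eq_bigr _ (fun i _ => congr1 (fun t => G i * t) (comm4 i))) (proj2 (sj i1)).
exact: (absorb n i1 (fun i => lam 0 i) (fun i => dird (row i E) (hext u) x) G _ _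
  (fun i j => dird (row j E) (dird (row i E) (dird (row i E) (hext u))) x) A c c0 K K2 u0^-1 m^-1
  (p - 1) be (k - l)%:R (u x) (u x)^-1 (gradsq_hext u x)^-1 (phi x)^-1 _
  cp c00 (ltW K0) K20 (ler0n _ _) erefl G0 Gc cS yK wK faK f11K wiK ziK fiK Glam l0
  (fun i => proj1 (mj i)) (fun i => proj2 (mj i)) (fun a => proj1 (sj a)) hG2).
Qed.

End Estimates.

(** * From the upper Hessian bound to the Frobenius norm *)

Section FrobeniusBound.
Context {R : realType} {n : nat}.

Lemma frob_le (A : 'M[R]_n) (t : R) : 0 <= t -> (forall i j, `|A i j| <= t) -> frob A <= n%:R * t.
Proof.
move=> t0 h; have nt0 : 0 <= n%:R * t by rewrite mulr_ge0.
rewrite /frob -[leRHS](ger0_norm nt0) -[leRHS]sqrtr_sqr ler_sqrt ?sqr_ge0 //.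
have -> : (n%:R * t) ^+ 2 = n%:R * (n%:R * t ^+ 2) by ring.
apply: le_trans (ler_norm _) _; apply: ler_norm_sum_const => i.
by apply: ler_norm_sum_const => j; rewrite normrX ler_pXn2r ?nnegrE.
Qed.

(** Membership in the cone makes the trace positive ([sigmaL1]), so eigenvalues bounded above by M
    are bounded below by -n M. Entries of an orthogonal matrix have modulus at most 1, and removing
    u I costs at most K per entry. *)
Lemma cov_hess_frob_bound (P k l : nat) (p q : R) (u phi : 'rV[R]_n.+1 -> R) (M K : R) :
  (0 < P)%N -> (0 < k)%N -> (0 < 'C(n - 1, P - 1))%N -> 0 <= M ->
  admissible_solution P k l p q u phi ->
  (forall x xi, sphere x -> sphere xi -> (xi *m hessm (hext u) x *m xi^T) 0 0 <= M) ->
  (forall x, sphere x -> u x <= K) ->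
  forall x E, sphere x -> frame x E ->
  frob (cov_hess u x E) <= n%:R * (n%:R * (n%:R * M) + K).
Proof.
move=> P0 k0 C0 M0 sol HM HK x E Sx fE.
have [ O [lam [OO fO D]]] := spectral_frame _ _ _ _ _ _ _ sol x E Sx fE.
have OtO : O^T *m O = 1%:M by apply: mulmx1C.
have ux0 := sol_u_gt0 _ _ _ _ _ _ _ sol x Sx.
have c2 : CkOn 2 (@punct R n.+1) (hext u) by exact/CkOn_hext/(C2_ext _ _ _ _ _ _ _ sol).
have lamM i : lam 0 i <= M.
  have := eigenframe_hess _ _ _ _ _ _ _ sol x _ lam Sx D i i; rewrite eqxx => <-.
  rewrite (dird_hessm _ (hext u) _ _ x open_punct c2 (sphere_punct x Sx)); apply: HM => //.
  by rewrite /sphere /= enorm_dotr (frame_row x _ i i fO) eqxx sqrtr1.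
have sum0 : 0 < \sum_i lam 0 i.
  have := in_Gamma_diag _ _ _ _ _ _ _ sol x _ lam Sx fO D 1%N; rewrite k0 => /(_ isT).
  by rewrite sigmaL1 // pmulr_rgt0 // ltr0n.
have lamN i : `|lam 0 i| <= n%:R * M.
  have nM : M <= n%:R * M by rewrite ler_peMl // ler1n (leq_trans _ (ltn_ord i)).
  rewrite ler_norml; apply/andP; split; last exact: le_trans (lamM i) nM.
  move: sum0; rewrite (bigD1 i) //= => h.
  have : \sum_(j | j != i) lam 0 j <= n%:R * M.
    apply: (@le_trans _ _ (\sum_(j < n | j != i) M)); first by apply: ler_sum.
    rewrite sumr_const -[leLHS]mulr_natl ler_wpM2r // ler_nat.
    by apply: leq_trans (max_card _) _; rewrite card_ord.
  lra.
have O1 i j : `|O i j| <= 1.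
  rewrite -(expr_le1 (n := 2)) // real_normK ?num_real //.
  have := congr1 (fun A : 'M[R]_n => A i i) OO; rewrite /= [RHS]mxE eqxx mulr1n => <-.
  rewrite mxE (bigD1 j) //= mxE -expr2 lerDl sumr_ge0 // => m _.
  by rewrite mxE -expr2 sqr_ge0.
have bE : E *m hessm (hext u) x *m E^T = O^T *m diag_mx lam *m O.
  by rewrite -D trmx_mul !mulmxA OtO mul1mx -!mulmxA OtO mulmx1.
have covE : cov_hess u x E = O^T *m diag_mx lam *m O - (u x)%:M.
  rewrite -bE -(cov_hess_hext u x E (C2_ext _ _ _ _ _ _ _ sol) Sx fE) addrK //.
rewrite covE; apply: frob_le.
  by rewrite addr_ge0 ?mulr_ge0 // (le_trans (ltW ux0) (HK x Sx)).
move=> i j; rewrite mxE; apply: ler_norm_addn.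
  rewrite mxE; apply: ler_norm_sum_const => m.
  rewrite mul_mx_diag [X in X * _]mxE -[n%:R * M]mulr1; apply: ler_normM => //.
  by rewrite -[n%:R * M]mul1r; apply: ler_normM => //; rewrite mxE.
rewrite mxE normrN mxE; case: (i == j); first by rewrite mulr1n gtr0_norm ?HK.
by rewrite mulr0n normr0 (le_trans (ltW ux0) (HK x Sx)).
Qed.

End FrobeniusBound.

Theorem theorem4p3 (R : realType) (n P k l : nat) (p q : R) :
  (2 <= n)%N -> (1 < P)%N -> (P <= n - 1)%N ->
  (l < k)%N -> (k <= 'C(n - 1, P - 1))%N ->
  q - l%:R < p ->
  forall (m K1 K2 : R), 0 < m ->
  exists C : R, 0 < C /\
  forall (u phi : 'rV[R]_(n.+1) -> R),
    Ck_sphere 2 phi ->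
    (forall x, sphere x -> 0 < phi x) ->
    Ck_sphere 4 u ->
    (forall x, sphere x -> 0 < u x) ->
    admissible P k u ->
    (forall x E lam, sphere x -> frame x E ->
       eigs (cov_hess u x E + (u x)%:M) lam ->
       sigmaL P lam k / sigmaL P lam l =
       powR (u x) (p - 1) *
       powR (u x ^+ 2 + grad_sq u x) ((k.+1%:R - q) / 2) * phi x) ->
    (* min phi >= m *)
    (forall x, sphere x -> m <= phi x) ->
    (* ||u||_{C^1} <= K1 *)
    (forall x, sphere x -> `|u x| <= K1 /\ Num.sqrt (grad_sq u x) <= K1) ->
    (* ||phi||_{C^2} <= K2 *)
    (forall x E, sphere x -> frame x E ->
       [/\ `|phi x| <= K2, Num.sqrt (grad_sq phi x) <= K2
         & frob (cov_hess phi x E) <= K2]) ->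
    forall x E, sphere x -> frame x E -> frob (cov_hess u x E) <= C.
Proof.
move=> n2 P1 Pn lk kC pq m K1 K2 m0.
(* No sign is assumed for [K1] and [K2]; 1 + |K1| and |K2| stand in for them where positivity or
   nonnegativity is required. *)
have K0 : 0 < 1 + `|K1| by rewrite ltr_wpDr.
have K1K : K1 <= 1 + `|K1| by have := ler_norm K1; lra.
have K2K : K2 <= `|K2| := ler_norm K2.
have [M M0 HM] := hess_upper_bound P k l p q P1 Pn lk kC m (1 + `|K1|) `|K2| (ltnW n2) m0 K0 (normr_ge0 _) pq.
exists (1 + n%:R * (n%:R * (n%:R * M) + (1 + `|K1|))); split.
  by rewrite ltr_pwDl // mulr_ge0 // addr_ge0 ?mulr_ge0 // ltW.
move=> u phi cphi phi0 cu u0 adm eqn phim uK phiK x E Sx fE.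
have sol := AdmissibleSolution _ _ P k l p q u phi cphi phi0 cu u0 adm eqn.
have uK' v : sphere v -> u v <= 1 + `|K1|.
  by move=> Sv; have [h _] := uK v Sv; apply: le_trans (ler_norm _) (le_trans h K1K).
apply: (@le_trans _ _ (n%:R * (n%:R * (n%:R * M) + (1 + `|K1|)))); last by rewrite lerDr.
apply: (cov_hess_frob_bound P k l p q u phi M) => //.
- exact: ltnW.
- exact: leq_ltn_trans lk.
- by apply: leq_trans kC; apply: leq_ltn_trans lk.
apply: (HM u phi sol phim).
- move=> v Sv; split; first exact: uK'.
  by have [_ h] := uK v Sv; apply: le_trans h K1K.
move=> v F Sv fF; have [h1 h2 h3] := phiK v F Sv fF.
split; [|exact: le_trans h2 K2K|exact: le_trans h3 K2K].
by apply: le_trans (ler_norm _) (le_trans h1 K2K).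
Qed.
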